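(* Let $X$ be a uniquely geodesic NPC space and let $G$ be a totally disconnected, locally compact group acting properly and continuously by isometries on $X$ with open point stabilizers. Suppose $\rho: \mathbb{R} \rightarrow X$ is a geodesic line and $g \in G$ is such that $|g|>0$ and $g\rho(t) = \rho(t+|g|)$ for all $t \in \mathbb{R}$, and let $\xi = \lim_{t \rightarrow +\infty}\rho(t)\in\partial X$ (the attracting point of $g$). Let $L_{G,\rho}$, $T=T_{G,\rho}$, $d_T$, $\le_T$ and $\sigma_{T,x_0}$ be as defined in the context. Let $H$ be the stabilizer of $T$ in $G_\xi$, and let $S$ be the set of elements of $G$ with attracting point $\xi$ and possessing an axis that belongs to $L_{G,\rho}$. Let $\lambda = \inf\{|h| \mid h \in S\}$. Then $\lambda>0$ and the following hold. (i) The group $H$ is an open subgroup of $G_{\xi}$ with $g \in S \subseteq H$, and $s_H(h) = s_G(h)$ for all $h \in S$. (ii) Every unbounded element of $H$ has an axis contained in $T$. Moreover, there is a continuous homomorphism $\beta: H \rightarrow \mathbb{R}$ with image $\lambda \mathbb{Z}$ such that, for all $h\in H$, $|\beta(h)| = |h|$, and $h \in S$ if and only if $\beta(h)<0$. (iii) The space $T$ is embedded as a closed path-connected subspace of $X$. As a metric space, $(T,d_T)$ is a geometric realization of a locally finite tree (in the combinatorial sense) with finitely many edge lengths; the sum of the edge lengths, taking one length for each $H$-orbit of edges, is $\lambda$. (iv) $H$ acts continuously, properly and cocompactly by isometries on $(T,d_T)$. (v) For all $h \in H$ and $x_0 \in T$, we have $s_H(h) = \sigma_{T,x_0}(-\beta(h))$,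 where $\beta$ is the homomorphism in (ii).
   Context: An NPC space is a geodesic metric space $X$ that is either (a) complete and CAT(0), or (b) proper (closed balls are compact) and $\delta$-hyperbolic for some $\delta \ge 0$ (every geodesic triangle is $\delta$-thin: each point on a side lies within distance $\delta$ of a point on another side). $X$ is uniquely geodesic if any two points are joined by a unique geodesic segment. A geodesic line is an isometric embedding $\mathbb{R}\to X$. The boundary $\partial X$ is the set of equivalence classes of geodesic rays, where $\gamma_1\sim\gamma_2$ if $d(\gamma_1(t),\gamma_2(t))$ is bounded over $t\ge 0$; isometries act on $\partial X$, and $G_\xi$ denotes the stabilizer of $\xi$ in $G$. Convergence in $X$ to boundary points is in the usual sense (cone topology for CAT(0) spaces, Gromov boundary for proper $\delta$-hyperbolic spaces). For an isometry $h$ of a metric space, the translation length is $|h|=\liminf_{n\to+\infty}d(h^nx,x)/n$ (independent of $x$). An axis of $h$ is the image of a geodesic line $\gamma:\mathbb{R}\to X$ for which there is $k>0$ with $h\gamma(t)=\gamma(t+k)$ for all $t$ (then $k=|h|$). $h$ is bounded if the orbits of $\langle h\rangle$ are bounded, and unbounded otherwise. $\xi\in\partial X$ is the attracting point of $h$ if $h^nx\to\xi$ as $n\to+\infty$ for all $x\in X$. An isometric action of a locally compact group $G$ on $X$ is proper if for all $x\in X$, $r>0$ the set $\{g\in G: d(gx,x)\le r\}$ has compact closure. Definitions for the statement: $L_{G,\rho}$ is the set of axes of (translation of) elements of $G$ that contain $\rho([t,+\infty))$ for some $t\in\mathbb{R}$. $T=T_{G,\rho}$ is the union of all members of $L_{G,\rho}$,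 regarded as a topological subspace of $X$ but equipped with the metric $d_T$, where $d_T(x,y)$ is the length of the shortest path from $x$ to $y$ within $T$. For $x,y\in T$, write $x\le_T y$ if there is a geodesic ray from $x$ to $\xi$ contained in $T$ that passes through $y$. For $x_0\in T$, the branching function $\sigma_{T,x_0}:\mathbb{R}\to\mathbb{N}$ is given by $\sigma_{T,x_0}(m)=|\{y\in T: y\le_T x_0,\ d_T(x_0,y)=m\}|$ if $m>0$, and $\sigma_{T,x_0}(m)=1$ otherwise. For a totally disconnected, locally compact group $K$ and $h\in K$, the scale $s_K(h)$ is the minimum of $|hUh^{-1}:U\cap hUh^{-1}|$ over all compact open subgroups $U$ of $K$. *)

(* Defs.v *)
From HB Require Import structures.
From mathcomp Require Import all_boot all_order all_algebra finmap.
From mathcomp Require Import all_classical all_reals all_analysis.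

Set Implicit Arguments.
Unset Strict Implicit.
Unset Printing Implicit Defensive.

Import Order.TTheory GRing.Theory Num.Theory.
Import numFieldNormedType.Exports.

Local Open Scope classical_set_scope.
Local Open Scope ring_scope.

HB.mixin Record isTopologicalGroup G of Group G & Topological G := {
  mulg_cts : continuous (fun p : G * G => (p.1 * p.2)%g) ;
  invg_cts : continuous (fun x : G => (x^-1)%g)
}.

#[short(type="topGroupType")]
HB.structure Definition TopologicalGroup :=
  { G of Group G & Topological G & isTopologicalGroup G }.

Section MetricSpaces.
Variables (R : realType) (X : metricType R).
Local Notation d := (@mdist R X).

Definition geodesic_path (x y : X) (c : R -> X) :=
  [/\ c 0 = x, c (d x y) = y &
      forall s t, 0 <= s <= d x y -> 0 <= t <= d x y ->
        d (c s) (c t) = `|s - t| ].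

Definition geodesic_segment (x y : X) (A : set X) :=
  exists2 c, geodesic_path x y c & A = c @` [set t | 0 <= t <= d x y].

Definition geodesic_space := forall x y, exists A, geodesic_segment x y A.

Definition uniquely_geodesic := forall x y, exists! A, geodesic_segment x y A.

Definition geodesic_line (c : R -> X) := forall s t, d (c s) (c t) = `|s - t|.

(** Only the restriction of [c] to [0, +oo) is meaningful. *)
Definition geodesic_ray (c : R -> X) :=
  forall s t, 0 <= s -> 0 <= t -> d (c s) (c t) = `|s - t|.

Definition complete_space :=
  forall u : nat -> X, cauchy (u @ \oo) -> exists l : X, u @ \oo --> l.

Definition proper_space := forall x (r : R), compact [set y | d x y <= r].

Definition dist2 (a b : R * R) : R :=
  Num.sqrt ((a.1 - b.1) ^+ 2 + (a.2 - b.2) ^+ 2).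

(** [p', q', r'] is a comparison triangle in the Euclidean plane, and [x'], [y']
    are the comparison points of [x] on the side [p, q] and [y] on the side
    [p, r]; by relabelling this covers points on any two sides. *)
Definition cat0 :=
  forall (p q r : X) (A B C : set X) (p' q' r' : R * R),
    geodesic_segment p q A -> geodesic_segment p r B ->
    geodesic_segment q r C ->
    dist2 p' q' = d p q -> dist2 p' r' = d p r -> dist2 q' r' = d q r ->
  forall (x y : X) (x' y' : R * R), A x -> B y ->
    dist2 p' x' = d p x -> dist2 x' q' = d x q ->
    dist2 p' y' = d p y -> dist2 y' r' = d y r ->
  d x y <= dist2 x' y'.

(** As [p, q, r] and the segments are arbitrary, thinness of one side gives
    thinness of all three. *)
Definition thin_triangles (delta : R) :=
  forall (p q r : X) (A B C : set X),
    geodesic_segment p q A -> geodesic_segment p r B ->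
    geodesic_segment q r C ->
  forall x, A x -> exists2 y, B y \/ C y & d x y <= delta.

Definition hyperbolic := exists2 delta : R, 0 <= delta & thin_triangles delta.

Definition npc_space :=
  geodesic_space /\
  ((complete_space /\ cat0) \/ (proper_space /\ hyperbolic)).

(** A boundary point is a class of asymptotic geodesic rays, represented as the
    set of its members. *)
Definition asymptotic (c1 c2 : R -> X) :=
  exists M, forall t, 0 <= t -> d (c1 t) (c2 t) <= M.

Definition boundary_class (c : R -> X) : set (R -> X) :=
  [set c' | geodesic_ray c' /\ asymptotic c c'].

(** Convergence in the cone topology: the sets
    [{x | r < d (c 0) x, d (p_r x) (c r) < e}], where [p_r x] is the point at
    distance [r] from [c 0] on the segment to [x], are the basic neighbourhoods
    of the class of the ray [c]. *)
Definition cone_cvg (u : nat -> X) (xi : set (R -> X)) :=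
  forall c, xi c -> forall r e, 0 < r -> 0 < e ->
  \forall n \near \oo, r < d (c 0) (u n) /\
    forall b, geodesic_path (c 0) (u n) b -> d (b r) (c r) < e.

Definition gromov_product (o x y : X) : R := (d o x + d o y - d x y) / 2.

Definition gromov_cvg (u : nat -> X) (xi : set (R -> X)) :=
  forall c, xi c -> forall M : R, exists N : nat,
  forall (n : nat) (t : R), (N <= n)%N -> N%:R <= t ->
    M <= gromov_product (c 0) (u n) (c t).

Definition boundary_cvg (u : nat -> X) (xi : set (R -> X)) :=
  (complete_space /\ cat0 /\ cone_cvg u xi) \/
  (proper_space /\ hyperbolic /\ gromov_cvg u xi).

Definition path_in (T : set X) (x y : X) (p : R -> X) :=
  [/\ {within `[0, 1], continuous p}, p 0 = x, p 1 = y &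
      forall t, 0 <= t <= 1 -> T (p t)].

Definition path_connected_set (T : set X) :=
  forall x y, T x -> T y -> exists p, path_in T x y p.

Definition path_length (p : R -> X) : \bar R :=
  ereal_sup [set (\sum_(0 <= i < size s)
      d (p (nth 1 (0 :: s) i)) (p (nth 1 (0 :: s) i.+1)))%:E
    | s in itv_partition 0 1].

Definition shortest_length (T : set X) (x y : X) (l : R) :=
  (exists2 p, path_in T x y p & path_length p = l%:E) /\
  (forall p, path_in T x y p -> (l%:E <= path_length p)%E).

(** The default value 0 is used when no shortest path exists. *)
Definition length_dist (T : set X) (x y : X) : R :=
  xget 0 [set l | shortest_length T x y l].

Definition metrizes_subspace (T : set X) (dT : X -> X -> R) :=
  forall x, T x -> forall A : set X,
    within T (nbhs x) A <->
    exists2 e : R, 0 < e & [set y | T y /\ dT x y < e] `<=` A.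

(** Vertices are points of [X], and an edge is a two-element set of vertices. *)
Definition edge_rel (E : set (set X)) : rel X :=
  fun v w => `[< E [set v; w] >].

Definition combinatorial_tree (V : set X) (E : set (set X)) :=
  [/\ V !=set0,
      forall e, E e -> exists v w, [/\ V v, V w, v <> w & e = [set v; w]],
      forall v w, V v -> V w ->
        exists2 s, path (edge_rel E) v s & last v s = w &
      forall s, ucycle (edge_rel E) s -> (size s < 3)%N].

Definition locally_finite_graph (V : set X) (E : set (set X)) :=
  forall v, V v -> finite_set [set w | edge_rel E v w].

(** Lengths of the piecewise linear paths in a metric graph whose oriented edge
    [(v, w)] is parametrized by [c v w] on [0, len {v, w}]. *)
Inductive pl_path (T : set X) (E : set (set X)) (len : set X -> R)
    (c : X -> X -> R -> X) : X -> X -> R -> Prop :=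
| pl_nil x : T x -> pl_path T E len c x x 0
| pl_cons v w s t y l : E [set v; w] ->
    0 <= s <= len [set v; w] -> 0 <= t <= len [set v; w] ->
    pl_path T E len c (c v w t) y l ->
    pl_path T E len c (c v w s) y (`|s - t| + l).

(** [T] is the set of points of the geometric realization: [c v w] glues an
    interval to [v] and [w] for each edge, with no other identification, and
    [dT] is the infimum of the lengths of piecewise linear paths. *)
Definition geometric_realization (T : set X) (dT : X -> X -> R)
    (V : set X) (E : set (set X)) (len : set X -> R) :=
  (forall e, E e -> 0 < len e) /\
  exists c : X -> X -> R -> X,
  [/\ (forall v w, E [set v; w] ->
        [/\ c v w 0 = v, c v w (len [set v; w]) = w &
            forall t, 0 <= t <= len [set v; w] ->
              c w v t = c v w (len [set v; w] - t)]),
      (forall x, T x <-> V x \/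
        exists v w t, [/\ E [set v; w], 0 <= t <= len [set v; w] &
                          x = c v w t]),
      (forall v w t, E [set v; w] -> 0 < t < len [set v; w] -> ~ V (c v w t)),
      (forall v w s v' w' s', E [set v; w] -> E [set v'; w'] ->
        0 < s < len [set v; w] -> 0 < s' < len [set v'; w'] ->
        c v w s = c v' w' s' ->
        [/\ v' = v, w' = w & s' = s] \/
        [/\ v' = w, w' = v & s' = len [set v; w] - s]) &
      (forall x y, T x -> T y ->
        dT x y = inf [set l | pl_path T E len c x y l])].

End MetricSpaces.

Section Scale.
Variable G : topGroupType.

Definition is_subgroup (K : set G) :=
  [/\ K 1%g, (forall x y, K x -> K y -> K (x * y)%g) &
      (forall x, K x -> K (x^-1)%g)].

Definition open_in (K U : set G) := exists2 W, open W & U = K `&` W.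

Definition conj_set (h : G) (U : set G) : set G :=
  [set (h * u * h^-1)%g | u in U].

Definition has_index (A B : set G) (n : nat) :=
  ([set [set (a * b)%g | b in B] | a in A] #= `I_n)%card.

Definition scale_value (K : set G) (h : G) (n : nat) :=
  exists U, [/\ U `<=` K, is_subgroup U, compact U, open_in K U &
    has_index (conj_set h U) (U `&` conj_set h U) n].

(** The scale of [h] in the subgroup [K] with its subspace topology; the default
    value 0 is used only if no compact open subgroup has a finite index. *)
Definition scale (K : set G) (h : G) : nat :=
  xget 0%N [set n | scale_value K h n /\
                    forall m, scale_value K h m -> (n <= m)%N].

End Scale.

Section Actions.
Variables (R : realType) (X : metricType R) (G : topGroupType).
Variable act : G -> X -> X.
Local Notation d := (@mdist R X).

Definition is_action :=
  (forall x, act 1%g x = x) /\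
  (forall g h x, act (g * h)%g x = act g (act h x)).

(** The next three notions concern the action of [K] on a subset [Y] of [X]
    endowed with a distance [dY]. *)
Definition acts_by_isometries (K : set G) (Y : set X) (dY : X -> X -> R) :=
  forall h, K h ->
    (forall x, Y x -> Y (act h x)) /\
    (forall x y, Y x -> Y y -> dY (act h x) (act h y) = dY x y).

Definition acts_continuously (K : set G) (Y : set X) (dY : X -> X -> R) :=
  forall h x, K h -> Y x -> forall e : R, 0 < e ->
  exists2 U, nbhs h U & exists2 a : R, 0 < a &
    forall k y, K k -> U k -> Y y -> dY x y < a ->
      dY (act h x) (act k y) < e.

Definition acts_properly (K : set G) (Y : set X) (dY : X -> X -> R) :=
  forall x (r : R), Y x -> 0 < r ->
    compact (K `&` closure [set h | K h /\ dY (act h x) x <= r]).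

Definition acts_cocompactly (K : set G) (Y : set X) :=
  exists C : set X, [/\ C `<=` Y, compact C &
    Y = [set act h x | h in K & x in C]].

(** The translation length: the common value of the limits inferior at all base
    points. *)
Definition tlen (h : G) : R :=
  xget 0 [set l | forall x,
    limn_einf (fun n : nat => (d (act (h ^+ n)%g x) x / n%:R)%:E) = l%:E].

Definition axis (h : G) (A : set X) :=
  exists2 c : R -> X, geodesic_line c &
    (exists2 k : R, 0 < k & forall t, act h (c t) = c (t + k)) /\ A = range c.

Definition bounded_elt (h : G) :=
  forall x, exists M : R, forall n : nat,
    d x (act (h ^+ n)%g x) <= M /\ d x (act (h ^- n)%g x) <= M.

Definition attracting_point (h : G) (xi : set (R -> X)) :=
  forall x, boundary_cvg (fun n => act (h ^+ n)%g x) xi.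

Definition boundary_act (h : G) (xi : set (R -> X)) : set (R -> X) :=
  [set act h \o c | c in xi].

Definition boundary_stab (xi : set (R -> X)) : set G :=
  [set h | boundary_act h xi = xi].

Section Tree.
Variable rho : R -> X.

Definition axis_set : set (set X) :=
  [set A | (exists h, axis h A) /\
           exists t0, forall t, t0 <= t -> A (rho t)].

Definition axis_union : set X := \bigcup_(A in axis_set) A.

Definition tree_dist : X -> X -> R := length_dist axis_union.

Definition tree_le (x y : X) :=
  exists2 c, boundary_class rho c &
    [/\ c 0 = x, (forall t, 0 <= t -> axis_union (c t)) &
        exists2 t, 0 <= t & c t = y].

(** [fset_set] is empty on infinite sets. *)
Definition branching (x0 : X) (m : R) : nat :=
  if 0 < m then
    #|` fset_set [set y | [/\ axis_union y, tree_le y x0 &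
                              tree_dist x0 y = m]] |%N
  else 1%N.

Definition tree_stab : set G :=
  [set h | boundary_stab (boundary_class rho) h /\
           act h @` axis_union = axis_union].

Definition attracted_set : set G :=
  [set h | attracting_point h (boundary_class rho) /\
           exists2 A, axis h A & axis_set A].

Definition min_tlen : R := inf [set tlen h | h in attracted_set].

End Tree.

(** [H] acts on the metric tree [(V, E, len)] by automorphisms, [D] contains
    exactly one edge from each [H]-orbit of edges, and the sum of the lengths
    of the edges in [D] is [l]. *)
Definition orbit_length_sum (H : set G) (V : set X) (E : set (set X))
    (len : set X -> R) (l : R) :=
  [/\ (forall h v, H h -> V v -> V (act h v)),
      (forall h e, H h -> E e ->
         E (act h @` e) /\ len (act h @` e) = len e) &
      exists D : set (set X),
        [/\ D `<=` E, finite_set D,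
            (forall e, E e -> exists! e', D e' /\
               exists2 h, H h & e' = act h @` e) &
            \sum_(e \in D) len e = l]].

End Actions.

(* Main.v *)
Require Import Defs.
From HB Require Import structures.
From mathcomp Require Import all_boot all_order all_algebra finmap.
From mathcomp Require Import all_classical all_reals all_analysis.
From mathcomp Require Import ring lra zify.

Set Implicit Arguments.
Unset Strict Implicit.
Unset Printing Implicit Defensive.

Import Order.TTheory GRing.Theory Num.Theory.
Import numFieldNormedType.Exports.

Local Open Scope classical_set_scope.
Local Open Scope ring_scope.

(** The key notion is that of an element [h] of [G] that moves [rho t] to
    [rho (t + k)] for all large [t], in short that shifts [rho] by [k]. These
    elements form a group, and the possible [k] are distances between points of
    one orbit of [G]; such an orbit is locally finite, because the action is
    proper and point stabilizers are open, so the shifts are the multiples of a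
    number [l > 0] ([shifts_discrete]).

    The union [T] of the axes consists of the points [u (rho t)] with [u] of
    shift 0 ([axis_union_tree]). Then [t] is determined by the point, its height,
    and so is the ray that leads from it to the boundary point inside [T], since
    geodesics are unique. Any two of these rays merge. Hence [T] is a tree with a
    distinguished end: the heights at which rays merge satisfy an ultrametric
    inequality, so adding up the ways from two points to the place where their
    rays merge defines a metric. It agrees with the metric of [X] near every point
    ([tree_metric_local]), and therefore it is the path metric of [T]
    ([tree_distE]).

    A geodesic ray of [X] that lies in [T] and ends at the boundary point has to
    be one of these rays ([tree_ray]). So [H], the stabilizer of [T], is the group
    of all elements that shift [rho] ([tree_stabP]), the elements of [S] are those
    with a positive shift ([attracted_shifts]), and minus the shift is the
    homomorphism in the theorem. [H] is open in the stabilizer of the boundary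
    point because an element of the latter that fixes a sufficiently long initial
    segment of [rho] fixes the whole ray ([long_segment_fixes_ray]).

    The vertices of [T] are the points at the heights where branching occurs or
    that are multiples of [l]. A vertex has one neighbour above it, which excludes
    cycles. Elements of shift 0 are transitive on the points at a given height, so
    orbits of edges correspond to the gaps between the vertex heights in a period
    of length [l], and these add up to [l].

    For the scale of an element [h] of shift [k > 0] let [sigma] be the number of
    points of [T] at depth [k] below a given point. The stabilizer in [H] of
    [h x] acts on them transitively, which shows that [sigma] is the index for the
    compact open subgroup fixing [x]. For an arbitrary compact open subgroup with
    index [n], the powers [h ^+ j] produce orbits of [x] of size [sigma ^ j] that
    are covered by a constant times [n ^ j] points, so [sigma <= n]
    ([scale_lower_bound]). In [G] the same bound holds, and [sigma] is attained at
    the fixator of a long segment of [rho], which by compactness moves points like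
    elements of [H] do ([long_segment_orbit]). *)


(** * Real numbers *)

Lemma multiple_above (R : realType) (a k : R) : 0 < k ->
  exists n : nat, a <= n%:R * k.
Proof.
move=> k0; exists (Num.bound `|a / k|); rewrite -ler_pdivrMr //.
by apply: (le_trans (ler_norm _)); apply: ltW; apply: archi_boundP.
Qed.

Lemma finite_set_min (R : realType) (A : set R) : finite_set A -> A !=set0 ->
  exists2 m, A m & forall x, A x -> m <= x.
Proof.
case/finite_seqP => s -> [a /= sa].
have [m ms hm] : exists2 m, m \in s & {in s, forall x, m <= x}.
  elim: s a sa => // b s IH a _; case: s IH => [|c s] IH.
    by exists b => [|x]; rewrite ?mem_seq1 // => /eqP ->.
  have [m ms hm] := IH c (mem_head _ _).
  case: (leP b m) => bm; [exists b|exists m].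
  - exact: mem_head.
  - by move=> x; rewrite inE => /orP[/eqP -> //|/hm]; apply: le_trans.
  - by rewrite inE ms orbT.
  - by move=> x; rewrite inE => /orP[/eqP ->|/hm //]; apply: ltW.
by exists m.
Qed.

(** * Geodesics *)

Section Geodesics.
Variables (R : realType) (X : metricType R).
Local Notation d := (@mdist R X).

Lemma metric_reverse_triangle (x y z : X) : `|d x y - d x z| <= d y z.
Proof.
rewrite ler_norml; have := metric_triangle x y z; have := metric_triangle x z y.
rewrite (metric_sym z y); lra.
Qed.

Lemma geodesic_path_dist0 x y (c : R -> X) t :
  geodesic_path x y c -> 0 <= t <= d x y -> d x (c t) = t.
Proof.
case=> c0 _ ciso t01; rewrite -c0 ciso ?lexx ?mdist_ge0 //.
by rewrite sub0r normrN ger0_norm //; case/andP: t01.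
Qed.

Lemma geodesic_path_uniq x y (b c : R -> X) t : uniquely_geodesic X ->
  geodesic_path x y b -> geodesic_path x y c -> 0 <= t <= d x y -> b t = c t.
Proof.
move=> /(_ x y) [A [_ Auniq]] hb hc ht.
have Eb : b @` [set t | 0 <= t <= d x y] = A by apply/esym/Auniq; exists b.
have Ec : c @` [set t | 0 <= t <= d x y] = A by apply/esym/Auniq; exists c.
have : (c @` [set t | 0 <= t <= d x y]) (b t) by rewrite Ec -Eb; exists t.
case=> s hs es; rewrite -es; congr c.
by rewrite -(geodesic_path_dist0 hc hs) es (geodesic_path_dist0 hb ht).
Qed.

Lemma isometric_geodesic_path (c : R -> X) a b : a <= b ->
  (forall s t, a <= s <= b -> a <= t <= b -> d (c s) (c t) = `|s - t|) ->
  geodesic_path (c a) (c b) (fun u => c (a + u)).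
Proof.
move=> ab ciso; have dab : d (c a) (c b) = b - a.
  by rewrite ciso ?lexx ?ab // distrC ger0_norm // subr_ge0.
split; rewrite ?addr0 // dab ?subrKC // => s t hs ht.
by rewrite ciso; [congr `|_|; ring|lra|lra].
Qed.

(** The concatenation is 1-Lipschitz, and its ends are as far apart as the
    parameters, so by the triangle inequality no two of its points can be closer
    than their parameters. *)
Lemma geodesic_concat x z y (b c : R -> X) : d x z + d z y = d x y ->
  geodesic_path x z b -> geodesic_path z y c ->
  geodesic_path x y (fun t => if t <= d x z then b t else c (t - d x z)).
Proof.
move=> dxzy hb hc; case: (hb) => b0 bz biso; case: (hc) => c0 cy ciso.
have dxz := mdist_ge0 x z; have dzy := mdist_ge0 z y.
pose e t := if t <= d x z then b t else c (t - d x z).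
have ex t : 0 <= t <= d x y -> d x (e t) <= t /\ d (e t) y <= d x y - t.
  rewrite /e => ht; case: (leP t (d x z)) => h.
    have := geodesic_path_dist0 hb (t := t); have := biso t (d x z).
    rewrite bz lexx dxz => h1 h2.
    have := metric_triangle (b t) z y; rewrite h1; [|lra|by []].
    by rewrite h2 ?(distrC t) ?ger0_norm; [split; lra|lra..].
  have := geodesic_path_dist0 hc (t := t - d x z); have := ciso (t - d x z) (d z y).
  rewrite cy lexx dzy => -> //; last lra.
  move=> h2; have := metric_triangle x z (c (t - d x z)); rewrite h2; last lra.
  by rewrite distrC ger0_norm; [split; lra|lra].
have ele s t : 0 <= s <= t -> t <= d x y -> d (e s) (e t) <= t - s.
  rewrite /e => hs ht; case: (leP t (d x z)) => htz.
    have -> : s <= d x z by lra.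
    by rewrite biso; [rewrite distrC ger0_norm; lra|lra|lra].
  case: (leP s (d x z)) => hsz.
    have h1 := biso s (d x z); have h2 := ciso 0 (t - d x z).
    have := metric_triangle (b s) z (c (t - d x z)).
    rewrite bz in h1; rewrite c0 in h2; rewrite h1 ?h2; [|lra..].
    by rewrite sub0r normrN (ger0_norm (x := t - _)) ?ler0_norm; lra.
  by rewrite ciso; [rewrite distrC ger0_norm; lra|lra|lra].
have eeq s t : 0 <= s <= t -> t <= d x y -> d (e s) (e t) = t - s.
  move=> hs ht; apply/eqP; rewrite eq_le ele //=.
  have := metric_triangle x (e s) y; have := metric_triangle (e s) (e t) y.
  have [] := ex s; have [] := ex t; lra.
split.
- by rewrite dxz b0.
- case: (leP (d x y) (d x z)) => h; last by rewrite -[RHS]cy; congr c; lra.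
  have dzy0 : d z y = 0 by lra.
  by rewrite -[RHS](mdist_positivity _ _ dzy0) -[RHS]bz; congr b; lra.
move=> s t hs ht; rewrite -!/(e _); case: (leP s t) => st.
  by rewrite eeq; [rewrite distrC ger0_norm; lra|lra|lra].
by rewrite metric_sym eeq; [rewrite ger0_norm; lra|lra|lra].
Qed.

Lemma geodesic_path_through x y z (c : R -> X) :
  geodesic_space X -> uniquely_geodesic X ->
  geodesic_path x y c -> d x z + d z y = d x y -> c (d x z) = z.
Proof.
move=> geo ugeo hc dxzy.
have [_ [b hb _]] := geo x z; have [_ [b' hb' _]] := geo z y.
have dxz := mdist_ge0 x z; have dzy := mdist_ge0 z y.
rewrite (geodesic_path_uniq ugeo hc (geodesic_concat dxzy hb hb')); last lra.
by rewrite lexx; case: hb.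
Qed.

Lemma isometry_fixes_geodesic (f : X -> X) x y (c : R -> X) t :
  uniquely_geodesic X -> (forall a b, d (f a) (f b) = d a b) ->
  f x = x -> f y = y -> geodesic_path x y c -> 0 <= t <= d x y -> f (c t) = c t.
Proof.
move=> ugeo fiso fx fy hc ht.
apply: (geodesic_path_uniq (b := f \o c) ugeo _ hc ht); case: hc => c0 c1 ciso.
by split=> /=; rewrite ?c0 ?c1 // => s u hs hu; rewrite fiso ciso.
Qed.

Lemma geodesic_line_ray (c : R -> X) : geodesic_line c -> geodesic_ray c.
Proof. by move=> hc s t _ _; apply: hc. Qed.

Lemma geodesic_line_path (c : R -> X) a b : a <= b -> geodesic_line c ->
  geodesic_path (c a) (c b) (fun u => c (a + u)).
Proof. by move=> ab hc; apply: isometric_geodesic_path => // *; apply: hc. Qed.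

Lemma geodesic_ray_path (c : R -> X) a : 0 <= a -> geodesic_ray c ->
  geodesic_path (c 0) (c a) c.
Proof.
move=> a0 hc; have := @isometric_geodesic_path c 0 a a0.
under eq_fun do rewrite add0r; apply=> s t hs ht; apply: hc; lra.
Qed.

Lemma geodesic_ray_dist0 (c : R -> X) t : geodesic_ray c -> 0 <= t ->
  d (c 0) (c t) = t.
Proof. by move=> hc t0; rewrite hc // sub0r normrN ger0_norm. Qed.

End Geodesics.

(** * Asymptotic rays in NPC spaces *)

Section Boundary.
Variables (R : realType) (X : metricType R).
Local Notation d := (@mdist R X).

(** It is enough to compare with an isosceles triangle: the rays of a pencil
    are compared at equal distances from their common origin. *)
Lemma cat0_isosceles p q r (b c : R -> X) s t :
  geodesic_space X -> cat0 X -> geodesic_path p q b -> geodesic_path p r c ->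
  d p q = s -> d p r = s -> 0 < s -> 0 <= t <= s ->
  d (b t) (c t) <= t / s * d q r.
Proof.
move=> geo hcat hb hc dq dr s0 ht.
set D := d q r; have D0 : 0 <= D by apply: mdist_ge0.
have Ds : D <= 2 * s.
  have := metric_triangle q p r; rewrite (metric_sym q p) dq dr /D; lra.
pose h := Num.sqrt (s ^+ 2 - (D / 2) ^+ 2).
have hsq : h ^+ 2 = s ^+ 2 - (D / 2) ^+ 2 by rewrite sqr_sqrtr //; nra.
pose l := t / s.
have l0 : 0 <= l by rewrite /l divr_ge0; lra.
have l1 : l <= 1 by rewrite /l ler_pdivrMr //; lra.
have tl : t = l * s by rewrite /l divfK //; lra.
have sqrtE (a v : R) : 0 <= v -> a = v ^+ 2 -> Num.sqrt a = v.
  by move=> v0 ->; rewrite sqrtr_sqr ger0_norm.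
have [A [c' hc' EA]] := geo q r.
have -> : t / s * D = dist2 (- (l * (D / 2)), h * (1 - l)) (l * (D / 2), h * (1 - l)).
  by apply/esym/sqrtE; rewrite /= -/l; [nra|field].
have db := geodesic_path_dist0 hb; have dc := geodesic_path_dist0 hc.
have bq : d (b t) q = s - t.
  case: hb => b0 b1 biso; rewrite -{1}b1 biso ?dq ?lexx //; last lra.
  by rewrite distrC ger0_norm //; lra.
have cr : d (c t) r = s - t.
  case: hc => c0 c1 ciso; rewrite -[X in d _ X]c1 ciso ?dr ?lexx //; [|lra..].
  by rewrite distrC ger0_norm //; lra.
apply: (hcat p q r _ _ _ (0, h) (- (D / 2), 0) (D / 2, 0)).
- by exists b.
- by exists c.
- by exists c'.
- by apply: sqrtE => /=; [rewrite dq; lra|rewrite dq -[s ^+ 2](subrK ((D/2) ^+ 2)) -hsq; ring].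
- by apply: sqrtE => /=; [rewrite dr; lra|rewrite dr -[s ^+ 2](subrK ((D/2) ^+ 2)) -hsq; ring].
- by apply: sqrtE => /=; [|rewrite -/D; field].
- by exists t => //; rewrite /= dq.
- by exists t => //; rewrite /= dr.
- rewrite db ?dq //; apply: sqrtE => /=; first lra.
  by rewrite tl exprMn -[s ^+ 2](subrK ((D/2) ^+ 2)) -hsq; ring.
- rewrite bq; apply: sqrtE => /=; first lra.
  have -> : s - t = (1 - l) * s by rewrite tl; ring.
  by rewrite exprMn -[s ^+ 2](subrK ((D/2) ^+ 2)) -hsq; ring.
- rewrite dc ?dr //; apply: sqrtE => /=; first lra.
  by rewrite tl exprMn -[s ^+ 2](subrK ((D/2) ^+ 2)) -hsq; ring.
- rewrite cr; apply: sqrtE => /=; first lra.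
  have -> : s - t = (1 - l) * s by rewrite tl; ring.
  by rewrite exprMn -[s ^+ 2](subrK ((D/2) ^+ 2)) -hsq; ring.
Qed.

End Boundary.

Section BoundaryConvergence.
Variables (R : realType) (X : metricType R).
Local Notation d := (@mdist R X).

(** Rays with a common origin and endpoint may differ in the hyperbolic case, but
    a uniform bound on their distance is all that the finiteness arguments need.
    In a CAT(0) space, comparison bounds the distance at time [t] by [t / s] times
    the distance at a later time [s], and the latter is bounded. In a hyperbolic
    space, [c1 t] is close to the second ray, since the side that joins [c1 s] to
    [c2 s] is too far away. *)
Lemma asymptotic_rays_close : npc_space X ->
  exists M : R, forall c1 c2 : R -> X, geodesic_ray c1 -> geodesic_ray c2 ->
    c1 0 = c2 0 -> asymptotic c1 c2 ->
    forall t, 0 <= t -> d (c1 t) (c2 t) <= M.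
Proof.
case=> geo [[_ hcat]|[_ [delta delta0 thin]]].
  exists 0 => c1 c2 h1 h2 h0 [M hM] t t0; apply/ler_addgt0Pl => e e0; rewrite addr0.
  have M0 : 0 <= M by apply: le_trans (hM 0 (lexx _)); apply: mdist_ge0.
  (* large enough for the bound [t * M / s] to be at most [e] *)
  pose s := t + t * M / e + 1.
  have q0 : 0 <= t * M / e by rewrite divr_ge0 ?mulr_ge0 // ltW.
  have s0 : 0 < s by rewrite /s; lra.
  have p1 : geodesic_path (c1 0) (c1 s) c1 by apply: geodesic_ray_path => //; lra.
  have p2 : geodesic_path (c1 0) (c2 s) c2.
    by rewrite h0; apply: geodesic_ray_path => //; lra.
  have := cat0_isosceles (s := s) (t := t) geo hcat p1 p2.
  rewrite {2}h0 !geodesic_ray_dist0 ?(ltW s0) // => /(_ erefl erefl s0).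
  have -> : 0 <= t <= s by rewrite /s; lra.
  move=> /(_ isT) /le_trans; apply; rewrite mulrAC ler_pdivrMr //.
  apply: (@le_trans _ _ (t * M)).
    by apply: ler_wpM2l => //; apply: hM; lra.
  have -> : t * M = t * M / e * e by rewrite divfK // gt_eqF.
  by rewrite mulrC ler_wpM2l ?(ltW e0) // /s; lra.
exists (2 * delta) => c1 c2 h1 h2 h0 [M hM] t t0.
have M0 : 0 <= M by apply: le_trans (hM 0 (lexx _)); apply: mdist_ge0.
(* The side from [c1 s] to [c2 s] has length at most [M], so it stays farther
   than [delta] from [c1 t]. *)
pose s := t + M + delta + 1.
have s0 : 0 <= s by rewrite /s; lra.
have p1 : geodesic_path (c1 0) (c1 s) c1 by apply: geodesic_ray_path.
have p2 : geodesic_path (c1 0) (c2 s) c2.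
  by rewrite h0; apply: geodesic_ray_path.
have [B hB] := geo (c1 s) (c2 s).
have ts : t <= s by rewrite /s; lra.
have d1 : d (c1 0) (c1 s) = s by apply: geodesic_ray_dist0.
have d2 : d (c1 0) (c2 s) = s by rewrite h0; apply: geodesic_ray_dist0.
have [|y] := thin _ _ _ _ _ _ (ex_intro2 _ _ _ p1 erefl) (ex_intro2 _ _ _ p2 erefl) hB (c1 t).
  by exists t => //=; rewrite d1 t0 ts.
case=> [[u /= hu <-]|By] hy.
  have h3 := metric_triangle (c1 t) (c2 u) (c2 t).
  have h4 := metric_reverse_triangle (c1 0) (c1 t) (c2 u).
  rewrite d2 in hu.
  rewrite geodesic_ray_dist0 // {1}h0 geodesic_ray_dist0 // in h4; last lra.
  by rewrite (h2 u t) in h3; [move: h4; rewrite distrC; lra|lra|lra].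
exfalso; case: hB => b [b0 b1 biso] EB; rewrite EB in By.
case: By => u /= hu Ey; have h3 := metric_triangle (c1 t) y (c1 s).
have h4 : d y (c1 s) = u by rewrite -Ey -b0 metric_sym biso ?sub0r ?normrN ?ger0_norm //; lra.
rewrite h4 h1 // distrC ger0_norm in h3; last lra.
by have := hM s s0; move: h3; rewrite /s; lra.
Qed.

(** In the CAT(0) case, points of the ray and of the geodesic to [u n] at equal
    distance from the origin are compared in a long thin isosceles triangle. In
    the hyperbolic case, the Gromov products grow since the distances involved
    are known up to bounded errors. *)
Lemma fellow_boundary_cvg (c : R -> X) (u : nat -> X) (k M : R) :
  npc_space X -> geodesic_ray c -> 0 < k ->
  (forall n, d (u n) (c (n%:R * k)) <= M) -> boundary_cvg u (boundary_class c).
Proof.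
move=> [geo npc] hc k0 hu.
have M0 : 0 <= M by apply: le_trans (hu 0%N); apply: mdist_ge0.
have nk0 n : 0 <= n%:R * k by rewrite mulr_ge0 // ltW.
have fellow c' : boundary_class c c' -> exists2 M' : R, 0 <= M' &
    (forall n, d (u n) (c' (n%:R * k)) <= M').
  case=> hc' [M' hM']; exists (M + M').
    by rewrite addr_ge0 //; apply: le_trans (hM' 0 (lexx _)); apply: mdist_ge0.
  move=> n; apply: le_trans (metric_triangle _ (c (n%:R * k)) _) _.
  exact: lerD (hu n) (hM' _ (nk0 n)).
have large (A : R) : exists N : nat, forall n, (N <= n)%N -> A <= n%:R * k.
  have [N hN] := multiple_above A k0; exists N => n hn.
  by apply: le_trans hN _; rewrite ler_wpM2r ?(ltW k0) // ler_nat.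
case: npc => [[hcompl hcat]|[hproper hhyp]]; [left|right]; split=> //; split=> // c' hc'.
  have [M' M'0 hM'] := fellow _ hc'; case: hc' => hc' _ r e r0 e0.
  have [N hN] := large (r + 2 * M' * r / e + M' + 1).
  have q0 : 0 <= 2 * M' * r / e by rewrite divr_ge0 ?mulr_ge0 // ltW.
  exists N => // n /= /hN hn; have hnu := hM' n.
  have dc' : d (c' 0) (c' (n%:R * k)) = n%:R * k by apply: geodesic_ray_dist0.
  have h1 := metric_triangle (c' 0) (u n) (c' (n%:R * k)).
  have dun : r + 2 * M' * r / e + 1 <= d (c' 0) (u n) by lra.
  split; first lra.
  (* the length of the legs of the isosceles triangle *)
  move=> b hb; pose s := Num.min (d (c' 0) (u n)) (n%:R * k).
  have sr : r + 2 * M' * r / e + 1 <= s by rewrite /s le_min dun /=; lra.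
  have s0 : 0 < s by lra.
  have su : s <= d (c' 0) (u n) by rewrite /s ge_min lexx.
  have sk : s <= n%:R * k by rewrite /s ge_min lexx orbT.
  have [b0 b1 biso] := hb.
  have pb : geodesic_path (c' 0) (b s) b.
    have := @isometric_geodesic_path _ _ b 0 s (ltW s0).
    rewrite b0; under eq_fun do rewrite add0r; apply=> v w hv hw; apply: biso; lra.
  have pc : geodesic_path (c' 0) (c' s) c' by apply: geodesic_ray_path (ltW s0) hc'.
  have dbs : d (c' 0) (b s) = s by apply: (geodesic_path_dist0 hb); lra.
  have dcs : d (c' 0) (c' s) = s by apply: geodesic_ray_dist0 (ltW s0).
  have := cat0_isosceles (s := s) (t := r) geo hcat pb pc dbs dcs s0.
  have -> : 0 <= r <= s by lra.
  move=> /(_ isT) /le_lt_trans; apply; rewrite mulrAC ltr_pdivrMr //.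
  have hbc : d (b s) (c' s) <= 2 * M'.
    have h2 := metric_triangle (b s) (u n) (c' s).
    have h3 := metric_triangle (u n) (c' (n%:R * k)) (c' s).
    have h4 : d (b s) (u n) = d (c' 0) (u n) - s.
      rewrite -[X in d _ X = _]b1 biso; [|lra|lra].
      by rewrite distrC ger0_norm //; lra.
    have h5 : d (c' (n%:R * k)) (c' s) = n%:R * k - s.
      by rewrite hc' // ?ger0_norm //; lra.
    have h6 := metric_triangle (c' 0) (c' (n%:R * k)) (u n).
    rewrite metric_sym in hnu.
    rewrite h4 in h2; rewrite h5 (metric_sym (u n) (c' (n%:R * k))) in h3; rewrite dc' in h6.
    rewrite dc' (metric_sym (u n)) in h1.
    have : s = d (c' 0) (u n) \/ s = n%:R * k.
      by rewrite /s minEle; case: ifP => _; [left|right].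
    by case=> Es; lra.
  apply: (@le_lt_trans _ _ (r * (2 * M'))); first by rewrite ler_wpM2l // ltW.
  have -> : r * (2 * M') = e * (2 * M' * r / e) by field; rewrite gt_eqF.
  by rewrite ltr_pM2l //; lra.
have [M' M'0 hM'] := fellow _ hc'; case: hc' => hc' _ A.
have [N1 hN1] := large (A + M'); have N2P := archi_boundP (normr_ge0 (A + M')).
exists (maxn N1 (Num.bound `|A + M'|)) => n t; rewrite geq_max => /andP[/hN1 h1 _] ht.
have ht' : A + M' <= t.
  apply: le_trans (ler_norm _) _; apply: (le_trans (ltW N2P)).
  by apply: le_trans ht; rewrite ler_nat leq_maxr.
have t0 : 0 <= t by apply: le_trans ht.
have dt := geodesic_ray_dist0 hc' t0; have dn := geodesic_ray_dist0 hc' (nk0 n).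
have h2 := metric_triangle (c' 0) (u n) (c' (n%:R * k)).
have h3 := metric_triangle (u n) (c' (n%:R * k)) (c' t).
rewrite [d (c' (n%:R * k)) _]hc' // in h3; have h4 := hM' n; rewrite dn in h2.
rewrite /gromov_product dt ler_pdivlMr //.
case: (leP (n%:R * k) t) => hh; first by rewrite distrC ger0_norm in h3; lra.
by rewrite ger0_norm in h3; lra.
Qed.

(** The geodesics from [c 0] to these points run in the direction opposite to the
    ray, and the Gromov products with points of the ray vanish. *)
Lemma opposite_boundary_ncvg (c : R -> X) (k : R) :
  geodesic_line c -> 0 < k ->
  ~ boundary_cvg (fun n => c (- (n%:R * k))) (boundary_class c).
Proof.
move=> hc k0; have hr := geodesic_line_ray hc.
have cc : boundary_class c c by split=> //; exists 0 => t t0; rewrite mdistxx.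
case=> [[_ [_ /(_ c cc 1 1 ltr01 ltr01)]]|[_ [_ /(_ c cc 1)]]].
  case=> N _ /(_ N (leqnn N)) [h1 h2].
  have nk0 : 0 <= N%:R * k by rewrite mulr_ge0 // ltW.
  move: h1; rewrite hc sub0r opprK ger0_norm // => h1.
  have : geodesic_path (c 0) (c (- (N%:R * k))) (fun t => c (- t)).
    split; rewrite ?oppr0 // hc sub0r opprK ger0_norm // => s t _ _.
    by rewrite hc; rewrite -opprD normrN.
  by move=> /h2; rewrite hc -opprD normrN ger0_norm; lra.
case=> N /(_ N N%:R (leqnn N) (lexx _)).
have nk0 : 0 <= N%:R * k by rewrite mulr_ge0 // ltW.
have n0 : 0 <= N%:R :> R by [].
rewrite /gromov_product !hc !sub0r opprK normrN -opprD normrN !ger0_norm //; first lra.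
by rewrite addr_ge0.
Qed.

End BoundaryConvergence.

(** * Proper actions with open point stabilizers *)

(** Otherwise, the sets outside of which [f] takes finitely many values on [A]
    form a proper filter, and [f] is constant near a cluster point of it. *)
Lemma compact_locally_constant_image (T : topologicalType) (Y : Type)
    (f : T -> Y) (A : set T) : compact A ->
  (forall x, A x -> nbhs x [set y | A y -> f y = f x]) -> finite_set (f @` A).
Proof.
move=> cA fA; apply: contrapT => infA.
pose F := [set B : set T | finite_set (f @` (A `\` B))].
have FF : ProperFilter F.
  split; first by rewrite /F /= setD0.
  split.
  - by rewrite /F /= setDT image_set0.
  - by move=> B C; rewrite /F /= => hB hC; rewrite setDIr image_setU finite_setU.
  - by move=> B C BC; apply: sub_finite_set; apply: image_subset; apply: setDS.
have [|p [Ap clp]] := cA F FF.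
  by rewrite /F /= setDv image_set0.
have [||q [/= [Aq hq] hq']] :=
    clp (A `&` ~` [set y | f y = f p]) [set y | A y -> f y = f p].
- apply: (@sub_finite_set _ _ [set f p]); last exact: finite_set1.
  by move=> _ [y [Ay /= hy] <-]; apply: contrapT => ny; apply: hy.
- exact: fA.
- by apply: hq; apply: hq'.
Qed.

Record proper_isometric_action (R : realType) (X : metricType R)
    (G : topGroupType) (act : G -> X -> X) : Prop := ProperIsometricAction {
  pia_action : is_action act ;
  pia_isometry : acts_by_isometries act [set: G] [set: X] (@mdist R X) ;
  pia_proper : acts_properly act [set: G] [set: X] (@mdist R X) ;
  pia_open : forall x, open [set h | act h x = x]
}.

Section ProperActions.
Variables (R : realType) (X : metricType R) (G : topGroupType).
Variable act : G -> X -> X.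
Hypothesis PA : proper_isometric_action act.
Local Notation d := (@mdist R X).

Lemma act1 x : act 1%g x = x.
Proof. by have [] := pia_action PA. Qed.

Lemma actM g h x : act (g * h)%g x = act g (act h x).
Proof. by have [] := pia_action PA. Qed.

Lemma actK g x : act g^-1%g (act g x) = x.
Proof. by rewrite -actM mulVg act1. Qed.

Lemma actVK g x : act g (act g^-1%g x) = x.
Proof. by rewrite -actM mulgV act1. Qed.

Lemma act_inj g : injective (act g).
Proof. exact: can_inj (actK g). Qed.

Lemma act_dist g x y : d (act g x) (act g y) = d x y.
Proof. by have [_ ->] := pia_isometry PA (h := g) I. Qed.

Lemma act_expS h n x : act (h ^+ n.+1)%g x = act h (act (h ^+ n)%g x).
Proof. by rewrite expgS actM. Qed.

Lemma mulg_left_cts (a : G) : continuous (fun k : G => (a * k)%g).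
Proof.
move=> k; apply: (@cvg_comp _ _ _ (fun k => (a, k)) (fun p => (p.1 * p.2)%g) _ (nbhs (a, k))).
  by apply: cvg_pair; [exact: cvg_cst|exact: cvg_id].
exact: (mulg_cts (a, k)).
Qed.

Lemma open_transporter x y : open [set h | act h x = y].
Proof.
rewrite openE => h /= hx; rewrite /interior /=.
have -> : [set h | act h x = y] = (fun k => (h^-1 * k)%g) @^-1` [set k | act k x = x].
  apply/seteqP; split=> k /=; rewrite actM; first by move=> ->; rewrite -hx actK.
  by move=> e; rewrite -hx -[in RHS]e actVK.
have := @mulg_left_cts (h^-1)%g h [set k | act k x = x]; apply; apply: open_nbhs_nbhs.
by split; [exact: pia_open PA _|rewrite /= mulVg act1].
Qed.

Lemma nbhs_transporter h x : nbhs h [set k | act k x = act h x].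
Proof. by apply: open_nbhs_nbhs; split => //; exact: open_transporter. Qed.

Lemma closed_transporter x y : closed [set h | act h x = y].
Proof.
rewrite -openC openE => h /= hxy; rewrite /interior.
by apply: filterS (nbhs_transporter h x) => k /= ->.
Qed.

Lemma compact_displacement x r : 0 < r ->
  compact (closure [set h | d (act h x) x <= r]).
Proof.
move=> r0; have := pia_proper PA (x := x) I r0; rewrite setTI.
by rewrite (_ : [set h | _ /\ _] = [set h | d (act h x) x <= r]) //;
  apply/seteqP; split => h //= [].
Qed.

Lemma compact_stabilizer x : compact [set h | act h x = x].
Proof.
apply: (subclosed_compact _ (@compact_displacement x _ ltr01)).
  exact: closed_transporter.
by apply: subset_trans (@subset_closure _ _) => h /= ->; rewrite mdistxx.
Qed.

(** The orbit map is locally constant, and the group elements concerned lie in a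
    compact set by properness. *)
Lemma finite_orbit_ball x y r :
  finite_set [set z | (exists h, z = act h x) /\ d z y <= r].
Proof.
pose r' := `|r| + d x y + 1.
have r'0 : 0 < r'.
  by have := mdist_ge0 x y; have := normr_ge0 r; rewrite /r'; lra.
apply: (@sub_finite_set _ _ (act^~ x @` closure [set h | d (act h x) x <= r'])).
  move=> z [[h ->] hd]; exists h => //; apply: subset_closure => /=.
  have := metric_triangle (act h x) y x; rewrite (metric_sym y x).
  by have := ler_norm r; rewrite /r'; lra.
apply: (compact_locally_constant_image (@compact_displacement x _ r'0)).
by move=> h _; apply: filterS (nbhs_transporter h x) => k hk _.
Qed.

Lemma orbit_discrete x : exists2 e : R, 0 < e &
  forall h, d (act h x) x < e -> act h x = x.
Proof.
pose A := [set z | (exists h, z = act h x) /\ d z x <= 1] `\ x.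
have finA : finite_set A by apply: finite_setD; apply: finite_orbit_ball.
case: (eqVneq A set0) => [A0|/set0P A0].
  exists 1 => // h hd; apply: contrapT => hx.
  suff : A (act h x) by rewrite A0.
  by split => //; split; [exists h|apply: ltW].
have [|m [z Az <-] hm] := finite_set_min (finite_image (d^~ x) finA).
  by have [z Az] := A0; exists (d z x), z.
exists (d z x).
  by rewrite mdist_gt0; apply/eqP; case: Az.
move=> h hd; apply: contrapT => hx; suff : d z x <= d (act h x) x by lra.
apply: hm; exists (act h x) => //; split => //; split; first by exists h.
by have [[_ dz] _] := Az; lra.
Qed.

(** Displacements of all points under the powers of an isometry differ by a
    bounded amount, so one orbit determines the translation length. *)
Lemma tlen_orbit h x k : (forall n, d (act (h ^+ n)%g x) x = n%:R * k) ->
  tlen act h = k.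
Proof.
move=> hx; have k0 : 0 <= k.
  by have := mdist_ge0 (act (h ^+ 1)%g x) x; rewrite hx mul1r.
have lim y : limn_einf (fun n : nat => (d (act (h ^+ n)%g y) y / n%:R)%:E) = k%:E.
  suff /cvg_limn_einf_sup[-> //] :
      (fun n : nat => (d (act (h ^+ n)%g y) y / n%:R)%:E) @ \oo --> k%:E.
  apply: cvg_EFin; first by near=> n.
  apply/(@cvgrPdist_lt R R^o) => e e0.
  pose C := 2 * d x y; have C0 : 0 <= C by rewrite /C mulr_ge0 // mdist_ge0.
  exists (Num.bound (C / e)).+1 => // n /= hn.
  have n0 : 0 < n%:R :> R by rewrite ltr0n; apply: leq_trans hn.
  have Cn : C < e * n%:R.
    rewrite mulrC -ltr_pdivrMr //.
    apply: lt_le_trans (archi_boundP _) _; first by rewrite divr_ge0 // ltW.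
    by rewrite ler_nat ltnW.
  have := metric_triangle (act (h ^+ n)%g y) (act (h ^+ n)%g x) y.
  have := metric_triangle (act (h ^+ n)%g x) x y.
  have := metric_triangle (act (h ^+ n)%g x) y x.
  have := metric_triangle (act (h ^+ n)%g x) (act (h ^+ n)%g y) y.
  rewrite !act_dist hx (metric_sym y x) => h1 h2 h3 h4.
  have -> : k - d (act (h ^+ n)%g y) y / n%:R =
            (n%:R * k - d (act (h ^+ n)%g y) y) / n%:R.
    by field; rewrite gt_eqF.
  rewrite normrM normfV (gtr0_norm n0) ltr_pdivrMr //.
  by apply: le_lt_trans Cn; rewrite ler_norml /C; lra.
rewrite /tlen; apply: xget_unique => [|l hl]; first exact: lim.
by have := hl x; rewrite lim => -[].
Unshelve. all: by end_near. Qed.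

End ProperActions.

(** * The germs of translations at the endpoint of an axis *)

(** The generator is the least positive element: subtracting the right multiple
    of it from any other element leaves a smaller remainder. *)
Lemma discrete_real_subgroup (R : realType) (A : set R) (a : R) :
  A 0 -> (forall x y, A x -> A y -> A (x - y)) -> A a -> 0 < a ->
  finite_set (A `&` [set x | 0 < x <= a]) ->
  exists2 l, 0 < l & forall x, A x <-> exists z : int, x = z%:~R * l.
Proof.
move=> A0 AB Aa a0 finA.
have [|l [Al /andP[l0 la]] lmin] := finite_set_min finA.
  by exists a; split=> //=; rewrite a0 lexx.
exists l => // x.
have AN y : A y -> A (- y) by move=> /(AB 0 y A0); rewrite sub0r.
have AD y z : A y -> A z -> A (y + z) by move=> hy /AN hz; rewrite -[z]opprK; apply: AB.
have An n : A (n%:R * l).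
  by elim: n => [|n IH]; rewrite ?mul0r // -natr1 mulrDl mul1r; apply: AD.
have Az (z : int) : A (z%:~R * l).
  by case: z => n; [exact: An|rewrite NegzE mulrNz mulNr; apply: AN; exact: An].
split=> [Ax|[z ->]]; last exact: Az.
exists (Num.floor (x / l)); set z := Num.floor _.
have hz1 : z%:~R * l <= x by rewrite -ler_pdivlMr // floor_le_tmp.
have hz2 : x < z%:~R * l + l.
  by rewrite -[X in _ + X]mul1r -mulrDl -ltr_pdivrMr // -intrD1 floorD1_gt.
have Ay := AB _ _ Ax (Az z).
apply/eqP; rewrite -subr_eq0; apply/eqP; apply: contrapT => ne0.
have y0 : 0 < x - z%:~R * l.
  by rewrite lt_neqAle subr_ge0 hz1 andbT eq_sym; apply/eqP.
have : l <= x - z%:~R * l by apply: lmin; split => //=; lra.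
lra.
Qed.

Record axial_action (R : realType) (X : metricType R) (G : topGroupType)
    (act : G -> X -> X) (rho : R -> X) (g : G) : Prop := AxialAction {
  axa_npc : npc_space X ;
  axa_uniq : uniquely_geodesic X ;
  axa_action :> proper_isometric_action act ;
  axa_line : geodesic_line rho ;
  axa_pos : 0 < tlen act g ;
  axa_axis : forall t, act g (rho t) = rho (t + tlen act g)
}.

Section Germs.
Variables (R : realType) (X : metricType R) (G : topGroupType).
Variables (act : G -> X -> X) (rho : R -> X) (g : G).
Hypothesis W : axial_action act rho g.
Local Notation d := (@mdist R X).

(** Only the germ of [h] at the boundary point matters, so the subray on which it
    is a translation may start anywhere. *)
Definition shifts (h : G) (k : R) :=
  exists t0, forall t, t0 <= t -> act h (rho t) = rho (t + k).

Lemma line_inj : injective rho.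
Proof.
move=> s t e; have := axa_line W s t; rewrite e mdistxx => /esym/eqP.
by rewrite normr_eq0 subr_eq0 => /eqP.
Qed.

Lemma shifts_uniq h k k' : shifts h k -> shifts h k' -> k = k'.
Proof.
case=> t0 h0 [t1 h1]; pose t := Num.max t0 t1.
have := h0 t; have := h1 t; rewrite !le_max !lexx orbT => -> // /(_ isT).
by move=> /line_inj /addrI.
Qed.

Lemma shifts1 : shifts 1%g 0.
Proof. by exists 0 => t _; rewrite (act1 W) addr0. Qed.

Lemma shiftsM h k a b : shifts h a -> shifts k b -> shifts (h * k)%g (a + b).
Proof.
case=> t0 h0 [t1 h1]; exists (Num.max t1 (t0 - b)) => t.
rewrite ge_max => /andP[/h1 e1 ht]; rewrite (actM W) e1 h0; last lra.
by congr rho; ring.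
Qed.

Lemma shiftsV h a : shifts h a -> shifts (h^-1)%g (- a).
Proof.
case=> t0 h0; exists (t0 + a) => t ht; apply: (@act_inj _ _ _ _ W h).
by rewrite (actVK W) h0 ?subrK //; lra.
Qed.

Lemma shiftsX h a n : shifts h a -> shifts (h ^+ n)%g (n%:R * a).
Proof.
move=> ha; elim: n => [|n IH]; first by rewrite mul0r; apply: shifts1.
by rewrite expgS -natr1 mulrDl mul1r addrC; apply: shiftsM.
Qed.

Lemma shifts_axis : shifts g (tlen act g).
Proof. by exists 0 => t _; apply: axa_axis W t. Qed.

(** As [k] is not negative, the iterates stay in the part of [rho] where [h] is
    known. *)
Lemma act_expg_tail h k t0 n t : 0 <= k ->
  (forall t, t0 <= t -> act h (rho t) = rho (t + k)) -> t0 <= t ->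
  act (h ^+ n)%g (rho t) = rho (t + n%:R * k).
Proof.
move=> k0 hk ht; elim: n => [|n IH]; first by rewrite (act1 W) mul0r addr0.
rewrite (act_expS W) IH hk; first by congr rho; rewrite -natr1; ring.
by have := mulr_ge0 (ler0n R n) k0; lra.
Qed.

Lemma act_expg_axis n t :
  act (g ^+ n)%g (rho t) = rho (t + n%:R * tlen act g).
Proof.
apply: (@act_expg_tail g _ t) => //; first exact: ltW (axa_pos W).
by move=> u _; apply: axa_axis W u.
Qed.

(** The displacement of a point far out on [rho] under powers of [h] is exactly
    linear; for negative shifts, move to the inverse by symmetry. *)
Lemma tlen_shifts h k : shifts h k -> tlen act h = `|k|.
Proof.
case=> t0 h0; case: (leP 0 k) => k0.
  apply: (@tlen_orbit _ _ _ _ W h (rho t0)) => n.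
  rewrite (act_expg_tail _ k0 h0) // (axa_line W) addrAC subrr add0r.
  by rewrite normrM normr_nat.
have [t1 h1] := shiftsV (ex_intro _ t0 h0).
apply: (@tlen_orbit _ _ _ _ W h (rho t1)) => n.
have k1 : 0 <= - k by lra.
rewrite -(act_dist W (h^-1 ^+ n)%g) -(actM W) expVgn mulVg (act1 W) -expVgn.
rewrite (act_expg_tail _ k1 h1) // (axa_line W) opprD addNKr.
by rewrite normrN normrM normr_nat normrN.
Qed.

(** Conjugating by a power of [g] enlarges the part of [rho] on which [h] acts
    as a translation. *)
Lemma shifts_from t h k : shifts h k ->
  exists2 h', shifts h' k & forall s, t <= s -> act h' (rho s) = rho (s + k).
Proof.
move=> hk; have l0 := axa_pos W; have [t0 h0] := hk.
have [n hn] := multiple_above (t0 - t) l0.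
exists (g ^- n * h * g ^+ n)%g => [|s ts].
  have gn := shiftsX n shifts_axis.
  have := shiftsM (shiftsM (shiftsV gn) hk) gn; rewrite addrAC addNr add0r.
  by [].
rewrite !(actM W) act_expg_axis h0; last lra.
by rewrite addrAC -act_expg_axis (actK W).
Qed.

(** By [shifts_from], the possible shifts are distances between points of the
    orbit of [rho 0], which is locally finite. *)
Lemma shifts_discrete : exists2 l : R, 0 < l &
  forall k, (exists h, shifts h k) <-> exists z : int, k = z%:~R * l.
Proof.
apply: (@discrete_real_subgroup R [set k | exists h, shifts h k] (tlen act g)).
- by exists 1%g; apply: shifts1.
- by move=> x y [h hx] [k hy]; exists (h * k^-1)%g; apply: shiftsM hx (shiftsV hy).
- by exists g; apply: shifts_axis.
- exact: axa_pos W.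
have := @finite_orbit_ball _ _ _ _ W (rho 0) (rho 0) (tlen act g).
move/(finite_preimage (f := rho)) => fin; apply: sub_finite_set (fin _).
  move=> k [[h hk] /= k01].
  split; last by rewrite (axa_line W) subr0 ger0_norm; lra.
  by have [h' _ /(_ 0 (lexx 0))] := shifts_from 0 hk; rewrite add0r; exists h'.
by move=> s t _ _; apply: line_inj.
Qed.

End Germs.

Section BoundaryClasses.
Variables (R : realType) (X : metricType R).
Local Notation d := (@mdist R X).

Lemma asymptotic_refl (c : R -> X) : asymptotic c c.
Proof. by exists 0 => t t0; rewrite mdistxx. Qed.

Lemma asymptotic_sym (c c' : R -> X) : asymptotic c c' -> asymptotic c' c.
Proof. by case=> M h; exists M => t t0; rewrite metric_sym h. Qed.

Lemma asymptotic_trans (a b c : R -> X) :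
  asymptotic a b -> asymptotic b c -> asymptotic a c.
Proof.
case=> M h [N k]; exists (M + N) => t t0.
exact: le_trans (metric_triangle _ (b t) _) (lerD (h t t0) (k t t0)).
Qed.

Lemma boundary_class_eq (c c' : R -> X) : asymptotic c c' ->
  boundary_class c = boundary_class c'.
Proof.
move=> cc; apply/seteqP; split=> b [rb ab]; split => //.
  exact: asymptotic_trans (asymptotic_sym cc) ab.
exact: asymptotic_trans cc ab.
Qed.

Lemma eventually_bounded_asymptotic (c c' : R -> X) t0 M : geodesic_ray c ->
  geodesic_ray c' -> (forall t, t0 <= t -> d (c t) (c' t) <= M) ->
  asymptotic c c'.
Proof.
move=> hc hc' h; exists (M + 2 * `|t0|) => t tp.
pose s : R := Num.max t `|t0|.
have ts : t <= s by rewrite /s le_max lexx.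
have h0 : t0 <= s by rewrite /s le_max ler_norm orbT.
have st : s <= t + `|t0| by rewrite /s ge_max lerDl lerDr normr_ge0 tp.
have := metric_triangle (c t) (c s) (c' t).
have := metric_triangle (c s) (c' s) (c' t).
have := h s h0; rewrite (hc t s) // ?(hc' s t) //; [|lra..].
by rewrite (ler0_norm (x := t - s)) ?(ger0_norm (x := s - t)); lra.
Qed.

End BoundaryClasses.

(** * The tree swept out by the axes *)

Section Tree.
Variables (R : realType) (X : metricType R) (G : topGroupType).
Variables (act : G -> X -> X) (rho : R -> X).

(** This is the union of the axes, by [axis_union_tree] below. Elements fixing a
    terminal subray of [rho] preserve the height, which makes the description by
    translates of [rho] more convenient. *)
Definition horo_tree : set X :=
  [set x | exists u t, shifts act rho u 0 /\ x = act u (rho t)].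

(** The default value has shift 0 as well, so that [up] leads to the boundary
    point from every point of [X]. *)
Definition chart (x : X) : G * R :=
  xget (1%g, 0) [set p | shifts act rho p.1 0 /\ x = act p.1 (rho p.2)].

(** On the tree, this is minus the Busemann function of the endpoint of [rho],
    normalized to vanish at [rho 0]. *)
Definition height (x : X) : R := (chart x).2.

(** The point at height [s] on a translate of [rho] through [x]; it is only
    determined by [x] for [s] at least the height of [x]. *)
Definition up (x : X) (s : R) : X := act (chart x).1 (rho s).

End Tree.

Section TreeTheory.
Variables (R : realType) (X : metricType R) (G : topGroupType).
Variables (act : G -> X -> X) (rho : R -> X) (g : G).
Hypothesis W : axial_action act rho g.
Local Notation d := (@mdist R X).
Local Notation shifts := (shifts act rho).
Local Notation T := (horo_tree act rho).
Local Notation height := (height act rho).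
Local Notation up := (up act rho).
Local Notation lift x := (chart act rho x).1.

Lemma chart_shifts x : shifts (lift x) 0.
Proof.
by rewrite /chart; case: xgetP => [p _ []|_] //; apply: shifts1 W.
Qed.

Lemma act_line u : geodesic_line (act u \o rho).
Proof. by move=> s t /=; rewrite (act_dist W) (axa_line W). Qed.

(** Geodesics are unique, so a germ of translation is the translation on every
    subray whose origin it moves along [rho] by the right amount. *)
Lemma shifts_above h k t s : shifts h k -> act h (rho t) = rho (t + k) ->
  t <= s -> act h (rho s) = rho (s + k).
Proof.
case=> t0 h0 ht ts; pose w : R := Num.max s t0.
have sw : s <= w by rewrite /w le_max lexx.
have /h0 hw : t0 <= w by rewrite /w le_max lexx orbT.
have tw : t <= w by lra.
have p1 := geodesic_line_path tw (act_line h).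
have tkw : t + k <= w + k by lra.
have p2 := geodesic_line_path tkw (axa_line W).
rewrite /= ht hw in p1.
have := geodesic_path_uniq (t := s - t) (axa_uniq W) p1 p2.
rewrite (axa_line W) distrC ger0_norm; last lra.
have -> : t + (s - t) = s by ring.
by move=> /= ->; [congr rho; ring|lra].
Qed.

Lemma shifts_eq_above u v t s : shifts u 0 -> shifts v 0 ->
  act u (rho t) = act v (rho t) -> t <= s -> act u (rho s) = act v (rho s).
Proof.
move=> hu hv e ts; apply: (@act_inj _ _ _ _ W (v^-1)%g).
rewrite (actK W) -(actM W); have := shiftsM W (shiftsV W hv) hu.
rewrite oppr0 addr0 => huv.
rewrite (shifts_above huv _ ts); first by rewrite addr0.
by rewrite addr0 (actM W) e (actK W).
Qed.

Lemma height_uniq u v s t : shifts u 0 -> shifts v 0 ->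
  act u (rho s) = act v (rho t) -> s = t.
Proof.
move=> [t0 hu] [t1 hv] e; pose w : R := Num.max (Num.max s t) (Num.max t0 t1).
have [sw tw t0w t1w] : [/\ s <= w, t <= w, t0 <= w & t1 <= w].
  by rewrite /w !le_max !lexx !orbT.
have := act_dist W u (rho s) (rho w); have := act_dist W v (rho t) (rho w).
rewrite e (hu w) // (hv w) // !addr0 !(axa_line W) => -> /=.
by rewrite !ler0_norm; lra.
Qed.

Lemma chartP x : T x -> x = act (lift x) (rho (height x)).
Proof.
move=> [u [t [hu ex]]].
have : [set p | shifts p.1 0 /\ x = act p.1 (rho p.2)] (chart act rho x).
  by rewrite /chart; case: xgetP => [p ->|/(_ (u, t))] //; case.
by case.
Qed.

Lemma tree_act u t : shifts u 0 -> T (act u (rho t)).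
Proof. by exists u, t. Qed.

Lemma tree_line t : T (rho t).
Proof. by rewrite -(act1 W (rho t)); apply: tree_act (shifts1 W). Qed.

Lemma height_act u t : shifts u 0 -> height (act u (rho t)) = t.
Proof.
move=> hu; apply: (height_uniq (chart_shifts (act u (rho t))) hu).
by apply/esym/chartP; exists u, t.
Qed.

Lemma height_line t : height (rho t) = t.
Proof. by rewrite -{1}(act1 W (rho t)) height_act //; apply: shifts1 W. Qed.

Lemma up_act u s t : shifts u 0 -> t <= s ->
  up (act u (rho t)) s = act u (rho s).
Proof.
move=> hu ts; apply: (shifts_eq_above (chart_shifts _) hu _ ts).
by have := chartP (tree_act t hu); rewrite height_act.
Qed.

Lemma up_line s t : t <= s -> up (rho t) s = rho s.
Proof.
move=> ts; rewrite -{1}(act1 W (rho t)) up_act ?(act1 W) //.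
exact: shifts1 W.
Qed.

Lemma tree_up x s : T (up x s).
Proof. exact: tree_act (chart_shifts x). Qed.

Lemma height_up x s : height (up x s) = s.
Proof. exact: height_act (chart_shifts x). Qed.

Lemma up_height x : T x -> up x (height x) = x.
Proof. by move/chartP. Qed.

Lemma up_up x s t : s <= t -> up (up x s) t = up x t.
Proof. exact: up_act (chart_shifts x). Qed.

Lemma dist_up x s t : d (up x s) (up x t) = `|s - t|.
Proof. exact: act_line. Qed.

Lemma up_eventually x : exists t0, forall s, t0 <= s -> up x s = rho s.
Proof.
have [t0 h] := chart_shifts x; exists t0 => s /h.
by rewrite addr0.
Qed.

Lemma up_eq_above x y s t : up x s = up y s -> s <= t -> up x t = up y t.
Proof. by move=> e st; rewrite -(up_up x st) e up_up. Qed.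

(** For large [w], the height of [x] is [w - d x (rho w)]. *)
Lemma height_lipschitz x y : T x -> T y -> `|height x - height y| <= d x y.
Proof.
move=> Tx Ty; have [t0 hx] := up_eventually x; have [t1 hy] := up_eventually y.
pose w : R := Num.max (Num.max (height x) (height y)) (Num.max t0 t1).
have [xw yw t0w t1w] : [/\ height x <= w, height y <= w, t0 <= w & t1 <= w].
  by rewrite /w !le_max !lexx !orbT.
have := metric_reverse_triangle (rho w) x y.
have := dist_up x w (height x); have := dist_up y w (height y).
rewrite !up_height // hx // hy // => -> ->.
rewrite (ger0_norm (x := w - height x)) ?(ger0_norm (x := w - height y)); [|lra..].
have -> : w - height x - (w - height y) = - (height x - height y) by ring.
by rewrite normrN.
Qed.

(** If [x] is [u (rho t)], then composing [h * u] with the inverse of an element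
    that shifts [rho] by [k] from [t] on yields an element of shift 0 mapping
    [rho (t + k)] to [h x]. *)
Lemma tree_shifts h k x : shifts h k -> T x ->
  [/\ T (act h x), height (act h x) = height x + k &
      forall s, height x <= s -> up (act h x) (s + k) = act h (up x s)].
Proof.
move=> hk Tx; have [u [t [hu ->]]] := Tx.
have [h' h'k h't] := shifts_from W t hk.
have hv : shifts (h * u * h'^-1)%g 0.
  have := shiftsM W (shiftsM W hk hu) (shiftsV W h'k).
  by rewrite addr0 addrN.
have e s : t <= s -> act h (act u (rho s)) = act (h * u * h'^-1)%g (rho (s + k)).
  by move=> ts; rewrite -h't // !(actM W) (actK W).
rewrite height_act // e //; split=> [||s ts].
- exact: tree_act.
- exact: height_act.
- by rewrite !up_act ?lerD2r // e.
Qed.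

Lemma tree_transitive x y : T x -> T y -> height x = height y ->
  exists2 u, shifts u 0 & act u x = y.
Proof.
move=> Tx Ty e; exists (lift y * (lift x)^-1)%g.
  have := shiftsM W (chart_shifts y) (shiftsV W (chart_shifts x)).
  by rewrite oppr0 addr0.
by rewrite (actM W) {2}(chartP Tx) (actK W) e -chartP.
Qed.

Lemma shifts_stabilizer h k x : shifts h k -> T x -> act h x = x ->
  k = 0 /\ forall s, height x <= s -> act h (up x s) = up x s.
Proof.
move=> hk Tx hx; have [_ e1 e2] := tree_shifts hk Tx.
have k0 : k = 0 by move: e1; rewrite hx => e1; lra.
by split=> // s /e2; rewrite hx k0 addr0.
Qed.

(** Two points close to each other are comparable: points of one orbit do not
    accumulate, and [x] and [up y (height x)] lie in one orbit. *)
Lemma tree_local x : T x -> exists2 e : R, 0 < e & forall y, T y -> d x y < e ->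
  (height x <= height y /\ up x (height y) = y) \/
  (height y <= height x /\ up y (height x) = x).
Proof.
move=> Tx; have [e e0 he] := orbit_discrete W x.
exists (e / 2); first by rewrite divr_gt0.
move=> y Ty dxy; have hl := height_lipschitz Tx Ty.
have ez : up y (height x) = x.
  rewrite {1}/up; have -> : rho (height x) = act (lift x)^-1%g x.
    by apply: (@act_inj _ _ _ _ W (lift x)); rewrite (actVK W) -chartP.
  rewrite -(actM W); apply: he; rewrite (actM W).
  have -> : act (lift x)^-1%g x = rho (height x).
    by apply: (@act_inj _ _ _ _ W (lift x)); rewrite (actVK W) -chartP.
  have := metric_triangle (up y (height x)) y x.
  have := dist_up y (height x) (height y); rewrite up_height // => ->.
  by rewrite (metric_sym y x) -/(up y (height x)); lra.
case: (leP (height x) (height y)) => h; [left|right]; split=> //.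
  by rewrite -ez up_up // up_height.
exact: ltW.
Qed.

End TreeTheory.

(** * Axes ending at the boundary point *)

Section Axes.
Variables (R : realType) (X : metricType R) (G : topGroupType).
Variables (act : G -> X -> X) (rho : R -> X) (g : G).
Hypothesis W : axial_action act rho g.
Local Notation d := (@mdist R X).
Local Notation shifts := (shifts act rho).
Local Notation T := (horo_tree act rho).
Local Notation height := (height act rho).
Local Notation up := (up act rho).

(** The slope [e] is read off between [t0] and [t0 + 1]: a value on the wrong side
    of [f t0] would be too far from [f (t0 + 1)]. *)
Lemma half_line_isometry (f : R -> R) t0 :
  (forall s t, t0 <= s -> t0 <= t -> `|f s - f t| = `|s - t|) ->
  exists2 e : R, e = 1 \/ e = -1 &
    forall t, t0 <= t -> f t = f t0 + e * (t - t0).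
Proof.
move=> fiso; pose t1 := t0 + 1.
have t01 : t0 <= t1 by rewrite /t1; lra.
exists (f t1 - f t0).
  have := fiso t1 t0 t01 (lexx _); rewrite /t1 addrAC subrr add0r normr1.
  by case: (ger0P (f (t0 + 1) - f t0)) => _ h; [left|right]; lra.
move=> t ht; have h1 := fiso t1 t0 t01 (lexx _).
have h2 := fiso t t0 ht (lexx _); have h3 := fiso t t1 ht t01.
move: h1 h2 h3; rewrite /t1 addrAC subrr add0r normr1 (ger0_norm (x := t - t0)); last lra.
case: (ger0P (f (t0 + 1) - f t0)) => h1 h1'; case: (ger0P (f t - f t0)) => h2 h2';
  case: (ger0P (f t - f (t0 + 1))) => h3; case: (ger0P (t - (t0 + 1))) => h4 h3'; nra.
Qed.

(** The axis may run towards the boundary point or away from it. It is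
    parametrized like [rho], and then [k] is negative in the second case. *)
Lemma axis_parametrization h A : axis act h A ->
  (exists t0, forall t, t0 <= t -> A (rho t)) ->
  exists c k, [/\ geodesic_line c, A = range c, k != 0,
    forall t, act h (c t) = c (t + k) &
    exists t0, forall t, t0 <= t -> c t = rho t].
Proof.
case=> c hc [[k k0 hk] ->] [t0 ht0].
have /choice[f hf] : forall t, exists s, t0 <= t -> c s = rho t.
  move=> t; case: (leP t0 t) => [/ht0 [s _ e]|_]; first by exists s.
  by exists 0.
have [|e e1 fe] := @half_line_isometry f t0.
  move=> s t hs ht; rewrite -hc hf // hf //; exact: axa_line W s t.
have ee : e * e = 1 by case: e1 => ->; ring.
pose c' t := c (f t0 + e * (t - t0)).
have ne (x : R) : `|e * x| = `|x|.
  by rewrite normrM; case: e1 => ->; rewrite ?normrN normr1 mul1r.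
exists c', (e * k); split.
- by move=> s t; rewrite /c' hc -(ne (s - t)); congr `|_|; ring.
- apply/seteqP; split=> x [t _ <-]; last by exists (f t0 + e * (t - t0)).
  exists (t0 + e * (t - f t0)) => //; rewrite /c'; congr c.
  have -> : e * (t0 + e * (t - f t0) - t0) = e * e * (t - f t0) by ring.
  by rewrite ee; ring.
- rewrite mulf_neq0 // ?(gt_eqF k0) //; apply/eqP => e0.
  by move: ee; rewrite e0 mul0r => /esym/eqP; rewrite oner_eq0.
- move=> t; rewrite /c' hk; congr c.
  have -> : e * (t + e * k - t0) = e * (t - t0) + e * e * k by ring.
  by rewrite ee; ring.
- by exists t0 => t ht; rewrite /c' -fe // hf.
Qed.

(** The translates of a terminal subray of [rho] by the negative powers of [h]
    increase, and their union is the axis. *)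
Lemma shifts_axis_exists h k : shifts h k -> 0 < k ->
  exists2 A, axis act h A & axis_set act rho A.
Proof.
move=> [t0 ht0] k0.
have kn n : 0 <= n%:R * k by rewrite mulr_ge0 // ltW.
have /choice[N NP] : forall t, exists n : nat, t0 <= t + n%:R * k.
  by move=> t; have [n hn] := multiple_above (t0 - t) k0; exists n; lra.
pose c t := act (h ^- N t)%g (rho (t + (N t)%:R * k)).
have step t n m : (n <= m)%N -> t0 <= t + n%:R * k ->
    act (h ^- m)%g (rho (t + m%:R * k)) = act (h ^- n)%g (rho (t + n%:R * k)).
  move=> nm ht; apply: (@act_inj _ _ _ _ W (h ^+ m)%g); rewrite (actVK W).
  rewrite -(subnK nm) expgnDr (actM W) (actVK W).
  rewrite (act_expg_tail W _ (ltW k0) ht0) //; congr rho.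
  by rewrite natrD; ring.
have cE t n : t0 <= t + n%:R * k -> c t = act (h ^- n)%g (rho (t + n%:R * k)).
  move=> ht; rewrite /c; have [nm|/ltnW nm] := leqP n (N t); first exact: step.
  by rewrite (step t (N t) n).
have big s t : exists n, t0 <= s + n%:R * k /\ t0 <= t + n%:R * k.
  exists (N s + N t)%N; rewrite natrD mulrDl.
  by have := NP s; have := NP t; have := kn (N s); have := kn (N t); lra.
have hc : geodesic_line c.
  move=> s t; have [n [hs ht]] := big s t.
  rewrite (cE s n) // (cE t n) // (act_dist W) (axa_line W); congr `|_|; ring.
have ct t : t0 <= t -> c t = rho t.
  move=> ht; rewrite (cE t 0%N) ?mul0r ?addr0 //.
  by rewrite expg0 invg1 (act1 W).
have hk t : act h (c t) = c (t + k).
  have [n [hs ht]] := big t (t + k).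
  have hs' : t0 <= t + n.+1%:R * k by rewrite -natr1 mulrDl; have := kn n; lra.
  rewrite (cE t n.+1) // (cE (t + k) n) //; apply: (@act_inj _ _ _ _ W (h ^+ n)%g).
  rewrite (actVK W) -!(actM W) ?mulgA -expgSr mulgV (act1 W).
  by congr rho; rewrite -natr1; ring.
have ax : axis act h (range c) by exists c => //; split => //; exists k.
exists (range c) => //; split; first by exists h.
by exists t0 => t ht; exists t => //; apply: ct.
Qed.

(** A point [c s] on an axis of [h] is reached from [rho s] by shifting along
    [rho] until the axis is met and coming back with a power of [h]. *)
Lemma axis_in_tree A : axis_set act rho A -> A `<=` T.
Proof.
move=> [[h hA] At]; have [c [k [hc -> k0 hk [t0 ct]]]] := axis_parametrization hA At.
have [h' [k' [k'0 hk']]] : exists h' k', 0 < k' /\ forall t, act h' (c t) = c (t + k').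
  case: (ltrgtP k 0) => [kn|kp|e]; last by rewrite e eqxx in k0.
    exists (h^-1)%g, (- k); split; first by rewrite oppr_gt0.
    by move=> t; apply: (@act_inj _ _ _ _ W h); rewrite (actVK W) hk subrK.
  by exists h, k.
move=> _ [s _ <-].
have hn n t : act (h' ^+ n)%g (c t) = c (t + n%:R * k').
  elim: n => [|n IH]; first by rewrite (act1 W) mul0r addr0.
  by rewrite (act_expS W) IH hk' -natr1; congr c; ring.
have [n hns] : exists n : nat, t0 <= s + n%:R * k'.
  by have [m hm] := multiple_above (t0 - s) k'0; exists m; lra.
have sn : shifts (h' ^+ n)%g (n%:R * k').
  exists t0 => t ht; rewrite -ct // hn ct //.
  by have := mulr_ge0 (ler0n R n) (ltW k'0); lra.
have [v vs hv] := shifts_from W s sn.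
exists (h' ^- n * v)%g, s; split.
  by have := shiftsM W (shiftsV W sn) vs; rewrite addNr.
rewrite (actM W) hv // -ct // -hn (actK W) //.
Qed.

Lemma axis_union_tree : axis_union act rho = T.
Proof.
apply/seteqP; split=> [x [A hA Ax]|_ [u [t [hu ->]]]].
  exact: axis_in_tree hA _ Ax.
exists (range (act u \o rho)); last by exists t.
split.
  exists (u * g * u^-1)%g; exists (act u \o rho); first exact: act_line W u.
  split=> //; exists (tlen act g); first exact: axa_pos W.
  by move=> s /=; rewrite !(actM W) (actK W) (axa_axis W).
by have [t0 h0] := hu; exists t0 => s hs; exists s => //=; rewrite h0 // addr0.
Qed.

(** An axis along which [h] moves away from the boundary point is excluded by
    [opposite_boundary_ncvg]. *)
Lemma attracted_shifts h :
  attracted_set act rho h <-> exists2 k, 0 < k & shifts h k.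
Proof.
split=> [[att [A hA [_ At]]]|[k k0 hk]].
  have [c [k [hc _ k0 ck [t0 ct]]]] := axis_parametrization hA At.
  exists k; last first.
    exists (Num.max t0 (t0 - k)) => t; rewrite ge_max => /andP[h1 h2].
    by rewrite -ct // ck ct //; lra.
  rewrite ltNge; apply/negP => kn.
  have kp : 0 < - k by rewrite oppr_gt0 lt_neqAle k0.
  have := @opposite_boundary_ncvg _ _ c (- k) hc kp; apply.
  have -> : boundary_class c = boundary_class rho.
    apply: boundary_class_eq; have hr := axa_line W.
    apply: (@eventually_bounded_asymptotic _ _ _ _ t0 0).
    - exact: geodesic_line_ray.
    - exact: geodesic_line_ray.
    - by move=> t /ct ->; rewrite mdistxx.
  have := att (c 0).
  rewrite (_ : (fun n => act (h ^+ n)%g (c 0)) = (fun n => c (- (n%:R * - k)))) //.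
  apply/funext => n; elim: n => [|n IH].
    by rewrite mul0r oppr0 (act1 W).
  by rewrite (act_expS W) IH ck -natr1; congr c; ring.
split; last exact: shifts_axis_exists hk k0.
move=> x; have [t0 h0] := hk.
apply: (@fellow_boundary_cvg _ _ rho _ k (d x (rho t0) + `|t0|)) => //.
- exact: axa_npc W.
- exact: geodesic_line_ray (axa_line W).
move=> n; apply: le_trans (metric_triangle _ (rho (t0 + n%:R * k)) _) _.
rewrite -(act_expg_tail W n (ltW k0) h0 (lexx _)) (act_dist W) lerD2l.
by rewrite (act_expg_tail W n (ltW k0) h0 (lexx _)) (axa_line W) addrK.
Qed.

End Axes.

(** * Lengths of paths *)

(** The sums that define [path_length], with a variable left end in order to
    allow inductions on the partition. *)
Definition chord_sum (R : realType) (X : metricType R) (p : R -> X) a (s : seq R) :=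
  \sum_(0 <= i < size s) mdist (p (nth 1 (a :: s) i)) (p (nth 1 (a :: s) i.+1)).

Lemma chord_sum_cons (R : realType) (X : metricType R) (p : R -> X) a b s :
  chord_sum p a (b :: s) = mdist (p a) (p b) + chord_sum p b s.
Proof. by rewrite /chord_sum /= big_nat_recl. Qed.

Lemma chord_sum_nil (R : realType) (X : metricType R) (p : R -> X) a :
  chord_sum p a [::] = 0.
Proof. by rewrite /chord_sum /= big_geq. Qed.

Lemma chord_sum_rcons (R : realType) (X : metricType R) (p : R -> X) a b s :
  chord_sum p a (rcons s b) = chord_sum p a s + mdist (p (last a s)) (p b).
Proof.
elim: s a => [|c s IH] a /=; first by rewrite chord_sum_cons !chord_sum_nil addr0 add0r.
by rewrite !chord_sum_cons IH addrA.
Qed.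

Lemma path_length_chord (R : realType) (X : metricType R) (p : R -> X) :
  path_length p = ereal_sup [set (chord_sum p 0 s)%:E | s in itv_partition 0 1].
Proof. by []. Qed.

Lemma lipschitz_continuous (R : realType) (X : metricType R) (p : R -> X) L :
  (forall u v, mdist (p u) (p v) <= L * `|u - v|) -> continuous p.
Proof.
move=> hp u; apply/metricType_numDomainType.cvgrPdist_lt => e e0.
have L1 : 0 < `|L| + 1 by rewrite ltr_wpDl.
exists (e / (`|L| + 1)); first by rewrite /= divr_gt0.
move=> v /= uv; apply: le_lt_trans (hp u v) _.
apply: le_lt_trans (_ : _ <= (`|L| + 1) * `|u - v|) _.
  by rewrite ler_wpM2r //; have := ler_norm L; lra.
by rewrite mulrC -ltr_pdivlMr.
Qed.

Lemma geodesic_line_continuous (R : realType) (X : metricType R) (c : R -> X) :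
  geodesic_line c -> continuous c.
Proof. by move=> hc; apply: (@lipschitz_continuous _ _ _ 1) => u v; rewrite hc mul1r. Qed.

Lemma chord_sum_lipschitz (R : realType) (X : metricType R) (p : R -> X) L a b s :
  (forall u v, mdist (p u) (p v) <= L * `|u - v|) ->
  itv_partition a b s -> chord_sum p a s <= L * (b - a).
Proof.
move=> hp; elim: s a => [|c s IH] a.
  by move/itv_partition_nil => ->; rewrite chord_sum_nil subrr mulr0.
move=> hs; have ac : a < c by case: hs => /= /andP[].
rewrite chord_sum_cons; have := IH c (itv_partition_cons hs).
by have := hp a c; rewrite distrC gtr0_norm ?subr_gt0 //; lra.
Qed.

(** If distances are locally given by another metric [m], then no path is
    shorter than the [m]-distance of its endpoints: the times up to which this
    holds form an open and closed set. *)
Lemma path_length_ge (R : realType) (X : metricType R) (T : set X)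
    (m : X -> X -> R) (p : R -> X) x y :
  (forall a b, m a b = m b a) -> (forall a, m a a = 0) ->
  (forall a b c, m a c <= m a b + m b c) ->
  (forall a, T a -> exists2 e : R, 0 < e &
     forall b, T b -> mdist a b < e -> m a b = mdist a b) ->
  path_in T x y p -> exists2 s, itv_partition 0 1 s & m x y <= chord_sum p 0 s.
Proof.
move=> mC mxx mtri mloc [pcts p0 p1 pT].
pose P t := 0 <= t <= 1 /\
  exists s, [/\ path <%O 0 s, last 0 s = t & m x (p t) <= chord_sum p 0 s].
have Pbase : P 0.
  by split; [rewrite lexx ler01|exists [::]; rewrite chord_sum_nil p0 mxx].
have Pnext t u : P t -> t < u -> u <= 1 -> m (p t) (p u) = mdist (p t) (p u) -> P u.
  move=> [t01 [s [ps ls hs]]] tu u1 e; split; first lra.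
  exists (rcons s u); rewrite rcons_path last_rcons chord_sum_rcons ls; split=> //.
    by rewrite ps.
  by rewrite -e; apply: le_trans (mtri _ (p t) _) _; rewrite lerD2r.
have near_time t : 0 <= t <= 1 -> exists2 e : R, 0 < e & forall u, 0 <= u <= 1 ->
    `|t - u| < e -> m (p t) (p u) = mdist (p t) (p u).
  move=> t01; have [e e0 he] := mloc _ (pT t t01).
  have t01' : `[0, 1]%classic t by rewrite /= in_itv.
  have := (subspace_continuousP _ _).1 pcts t t01' _ (nbhsx_ballx (p t) e e0).
  rewrite ballEmdist => -[r r0 hr]; exists r => // u u01 ut.
  by apply: he; [exact: pT|apply: hr => //=; rewrite in_itv].
have supP : has_sup P by split; [exists 0|exists 1 => t [/andP[]]].
pose S := sup P; have S01 : 0 <= S <= 1.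
  rewrite ub_le_sup //=; last by case: supP.
  by apply: ge_sup; [case: supP|move=> t [/andP[]]].
have [e e0 he] := near_time S S01.
have [t Pt St] := sup_adherent e0 supP.
have tS : t <= S by apply: ub_le_sup => //; case: supP.
have t01 : 0 <= t <= 1 by case: Pt.
have PS : P S.
  case: (eqVneq t S) => [<- //|tnS]; apply: (Pnext t) => //.
  - by rewrite lt_neqAle tnS.
  - by case/andP: S01.
  - by rewrite mC metric_sym he // ger0_norm; rewrite -/S in St; lra.
have S1 : S = 1.
  apply/eqP; rewrite eq_le; have /andP[S0 -> /=] := S01.
  rewrite leNgt; apply/negP => S1; pose u : R := Num.min 1 (S + e / 2).
  have u1 : u <= 1 by rewrite /u ge_min lexx.
  have uS : S < u by rewrite /u lt_min; lra.
  have ue : u <= S + e / 2 by rewrite /u ge_min lexx orbT.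
  suff : u <= S by lra.
  apply: ub_le_sup; first by case: supP.
  by apply: (Pnext S) => //; apply: he; [|rewrite ltr0_norm]; lra.
move: PS; rewrite S1 => -[_ [s [ps ls hs]]]; exists s; last by rewrite -p1.
by split=> //; rewrite ls.
Qed.

(** * The metric of the tree *)

Section TreeMetric.
Variables (R : realType) (X : metricType R) (G : topGroupType).
Variables (act : G -> X -> X) (rho : R -> X).

(** The height at which the rays to the boundary point from [x] and [y] merge. *)
Definition join_height (x y : X) : R :=
  inf [set s | [/\ height act rho x <= s, height act rho y <= s &
                   up act rho x s = up act rho y s]].

(** The distance along the path that climbs from [x] to the merging point and
    descends to [y]. *)
Definition tree_metric (x y : X) : R :=
  2 * join_height x y - height act rho x - height act rho y.

End TreeMetric.

Section TreeMetricTheory.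
Variables (R : realType) (X : metricType R) (G : topGroupType).
Variables (act : G -> X -> X) (rho : R -> X) (g : G).
Hypothesis W : axial_action act rho g.
Local Notation d := (@mdist R X).
Local Notation shifts := (shifts act rho).
Local Notation T := (horo_tree act rho).
Local Notation height := (height act rho).
Local Notation up := (up act rho).
Local Notation join_height := (join_height act rho).
Local Notation tm := (tree_metric act rho).

Let merge_has_inf x y : has_inf [set s | [/\ height x <= s, height y <= s &
                                        up x s = up y s]].
Proof.
split; last by exists (height x) => s [].
have [t0 hx] := up_eventually W x; have [t1 hy] := up_eventually W y.
exists (Num.max (Num.max (height x) (height y)) (Num.max t0 t1)).
by split; rewrite ?hx ?hy // !le_max !lexx ?orbT.
Qed.

Lemma merge_min x y s : height x <= s -> height y <= s -> up x s = up y s ->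
  join_height x y <= s.
Proof. by move=> h1 h2 h3; apply: ge_inf; [case: (merge_has_inf x y)|]. Qed.

Lemma height_merge_l x y : height x <= join_height x y.
Proof. by apply: lb_le_inf => [|s []//]; case: (merge_has_inf x y). Qed.

Lemma height_merge_r x y : height y <= join_height x y.
Proof. by apply: lb_le_inf => [|s []//]; case: (merge_has_inf x y). Qed.

(** The infimum is attained, since the rays are continuous. *)
Lemma up_merge x y s : join_height x y <= s -> up x s = up y s.
Proof.
move=> hs; apply: mdist_positivity; apply/eqP; rewrite eq_le mdist_ge0 andbT.
apply/ler_addgt0Pl => e e0; rewrite addr0.
have [|t [h1 h2 h3] ht] := inf_adherent (E := [set s | [/\ height x <= s, height y <= s &
    up x s = up y s]]) (eps := e / 2) _ (merge_has_inf x y).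
  by rewrite divr_gt0.
pose w : R := Num.max s t.
have sw : s <= w by rewrite /w le_max lexx.
have wt : w <= s + e / 2.
  by rewrite /w ge_max; apply/andP; split; move: ht; rewrite -/(join_height x y); lra.
have hw : up x w = up y w by apply: (up_eq_above W h3); rewrite /w le_max lexx orbT.
have := metric_triangle (up x s) (up x w) (up y s).
rewrite {2}hw !(dist_up W) distrC ger0_norm; lra.
Qed.

Lemma mergeC x y : join_height x y = join_height y x.
Proof.
apply/eqP; rewrite eq_le !merge_min ?height_merge_l ?height_merge_r //.
  by apply/esym/up_merge.
by apply/esym/up_merge.
Qed.

Lemma mergexx x : join_height x x = height x.
Proof. by apply/eqP; rewrite eq_le height_merge_l merge_min. Qed.

(** From the larger of the two heights on, all three rays coincide. This is the
    reason for [tree_metric] to satisfy the triangle inequality. *)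
Lemma merge_ultra x y z :
  join_height x z <= Num.max (join_height x y) (join_height y z).
Proof.
apply: merge_min; rewrite ?le_max ?height_merge_l ?height_merge_r ?orbT //.
rewrite (@up_merge x y) ?le_max ?lexx // (@up_merge y z) //.
by rewrite le_max lexx orbT.
Qed.

Lemma merge_up x s : height x <= s -> join_height x (up x s) = s.
Proof.
move=> hs; apply/eqP; rewrite eq_le -{3}(height_up W x s) height_merge_r andbT.
by apply: merge_min; rewrite ?(height_up W) // (up_up W).
Qed.

Lemma tree_metric_ge0 x y : 0 <= tm x y.
Proof.
by have := height_merge_l x y; have := height_merge_r x y; rewrite /tree_metric; lra.
Qed.

Lemma tree_metricC x y : tm x y = tm y x.
Proof. by rewrite /tree_metric mergeC; ring. Qed.

Lemma tree_metricxx x : tm x x = 0.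
Proof. by rewrite /tree_metric mergexx; ring. Qed.

Lemma tree_metric_triangle x y z : tm x z <= tm x y + tm y z.
Proof.
rewrite /tree_metric; have := merge_ultra x y z; rewrite le_max.
have := height_merge_r x y; have := height_merge_l y z.
by move=> h1 h2 /orP[] h3; lra.
Qed.

Lemma tree_metric_up x s t : height x <= s -> height x <= t ->
  tm (up x s) (up x t) = `|s - t|.
Proof.
wlog st : s t / s <= t.
  move=> H hs ht; case: (leP s t) => [|/ltW] st; first exact: H.
  by rewrite tree_metricC distrC H.
move=> hs ht; rewrite /tree_metric -(up_up W x st) merge_up ?(height_up W) //.
by rewrite distrC ger0_norm; lra.
Qed.

Lemma dist_le_tree_metric x y : T x -> T y -> d x y <= tm x y.
Proof.
move=> Tx Ty; have := metric_triangle x (up x (join_height x y)) y.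
have := dist_up W x (height x) (join_height x y).
have := dist_up W y (height y) (join_height x y).
rewrite !up_height // -(@up_merge x y (join_height x y)) // (metric_sym y) => -> ->.
have := height_merge_l x y; have := height_merge_r x y => h1 h2.
by rewrite /tree_metric !ler0_norm; lra.
Qed.

Lemma tree_metric_local x : T x -> exists2 e : R, 0 < e &
  forall y, T y -> d x y < e -> tm x y = d x y.
Proof.
move=> Tx; have [e e0 he] := tree_local W Tx; exists e => // y Ty dxy.
case: (he y Ty dxy) => -[h1 h2].
  have := tree_metric_up (lexx (height x)) h1; rewrite -(dist_up W x).
  by rewrite h2 up_height.
have := tree_metric_up h1 (lexx (height y)); rewrite -(dist_up W y).
by rewrite h2 up_height.
Qed.

Lemma tree_metric_shifts h k x y : shifts h k -> T x -> T y ->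
  tm (act h x) (act h y) = tm x y.
Proof.
have H h' k' a b : shifts h' k' -> T a -> T b ->
    join_height (act h' a) (act h' b) <= join_height a b + k'.
  move=> hk Ta Tb; have [_ ea ua] := tree_shifts W hk Ta.
  have [_ eb ub] := tree_shifts W hk Tb.
  have h1 := height_merge_l a b; have h2 := height_merge_r a b.
  by apply: merge_min; rewrite ?ea ?eb ?lerD2r // ua // ub // (@up_merge a b).
move=> hk Tx Ty; have [Tx' ex _] := tree_shifts W hk Tx.
have [Ty' ey _] := tree_shifts W hk Ty.
have := H _ _ _ _ (shiftsV W hk) Tx' Ty'; rewrite !(actK W).
by have := H _ _ _ _ hk Tx Ty; rewrite /tree_metric ex ey; lra.
Qed.

End TreeMetricTheory.

(** * The tree as a subspace *)

Section TreeSubspace.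
Variables (R : realType) (X : metricType R) (G : topGroupType).
Variables (act : G -> X -> X) (rho : R -> X) (g : G).
Hypothesis W : axial_action act rho g.
Local Notation d := (@mdist R X).
Local Notation shifts := (shifts act rho).
Local Notation T := (horo_tree act rho).
Local Notation height := (height act rho).
Local Notation up := (up act rho).
Local Notation join_height := (join_height act rho).
Local Notation tm := (tree_metric act rho).

Lemma tree_path_length_ge p x y : path_in T x y p ->
  exists2 s, itv_partition 0 1 s & tm x y <= chord_sum p 0 s.
Proof.
apply: path_length_ge.
- exact: tree_metricC W.
- exact: tree_metricxx W.
- exact: tree_metric_triangle W.
- exact: tree_metric_local W.
Qed.

Lemma tree_shortest_path x y : T x -> T y ->
  exists2 p, path_in T x y p & forall u v, d (p u) (p v) <= tm x y * `|u - v|.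
Proof.
move=> Tx Ty; set L := tm x y; pose A := join_height x y - height x.
have hx := height_merge_l W x y; have hy := height_merge_r W x y.
have EL : L = A + (join_height x y - height y) by rewrite /L /A /tree_metric; ring.
(* climb to the merging point, which is reached at time [A / L], and descend *)
pose p u := if u * L <= A then up x (height x + u * L)
            else up y (height y + (L - u * L)).
have L0 : 0 <= L by apply: tree_metric_ge0 W x y.
have pz u : A <= u * L -> p u = up y (height y + (L - u * L)).
  move=> h2; rewrite /p; case: (leP (u * L) A) => // h1.
  have e1 : height x + u * L = join_height x y by rewrite /A in h1 h2; lra.
  have e2 : height y + (L - u * L) = join_height x y by rewrite /A in EL; lra.
  by rewrite e1 e2; apply: (up_merge W).
have plip u v : u <= v -> d (p u) (p v) <= L * (v - u).
  move=> uv; have uvL : u * L <= v * L by apply: ler_wpM2r.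
  case: (leP (v * L) A) => hv.
    rewrite /p hv (le_trans uvL hv) (dist_up W) distrC ger0_norm; last lra.
    by have -> : height x + v * L - (height x + u * L) = L * (v - u) by ring.
  case: (leP A (u * L)) => hu.
    rewrite !pz ?(le_trans hu) // (dist_up W) ger0_norm; last lra.
    have -> // : height y + (L - u * L) - (height y + (L - v * L)) = L * (v - u).
    by ring.
  rewrite (pz v) ?(ltW hv) // /p (ltW hu).
  have := metric_triangle (up x (height x + u * L)) (up x (join_height x y))
    (up y (height y + (L - v * L))).
  rewrite {2}(up_merge W (lexx (join_height x y))) !(dist_up W).
  rewrite (ler0_norm (x := height x + u * L - _)); last by rewrite /A in hu; lra.
  rewrite (ger0_norm (x := join_height x y - _)); last by rewrite /A in EL hv; lra.
  by move/le_trans; apply; rewrite /A in EL; lra.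
have plip' u v : d (p u) (p v) <= L * `|u - v|.
  case: (leP u v) => uv; first by rewrite distrC ger0_norm ?subr_ge0 // plip.
  by rewrite metric_sym gtr0_norm ?subr_gt0 // plip // ltW.
exists p => //; split.
- by apply: continuous_subspaceT => u; apply: (lipschitz_continuous plip').
- by rewrite /p mul0r /A subr_ge0 hx addr0 up_height.
- by rewrite pz mul1r ?subrr ?addr0 ?up_height // EL; lra.
- by move=> u _; rewrite /p; case: ifP => _; apply: (tree_up W).
Qed.

Lemma tree_shortest_length x y : T x -> T y -> shortest_length T x y (tm x y).
Proof.
move=> Tx Ty; have lower p : path_in T x y p -> ((tm x y)%:E <= path_length p)%E.
  move=> /tree_path_length_ge[s hs hl]; rewrite path_length_chord.
  apply: le_trans (_ : (chord_sum p 0 s)%:E <= _)%E; first by rewrite lee_fin.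
  by apply: ereal_sup_ubound; exists s.
split=> //; have [p hp plip] := tree_shortest_path Tx Ty; exists p => //.
apply/eqP; rewrite eq_le lower // andbT path_length_chord.
apply: ge_ereal_sup => _ [s hs <-]; rewrite lee_fin.
by have := chord_sum_lipschitz plip hs; rewrite subr0 mulr1.
Qed.

Lemma tree_distE x y : T x -> T y -> tree_dist act rho x y = tm x y.
Proof.
move=> Tx Ty; rewrite /tree_dist (axis_union_tree W) /length_dist.
have [h1 h2] := tree_shortest_length Tx Ty.
apply: xget_unique => // l [[p hp pl] hl].
apply/eqP; rewrite eq_le -!lee_fin.
by case: h1 => q hq pq; rewrite -{1}pq hl //= -pl h2.
Qed.

Lemma tree_path_connected : path_connected_set T.
Proof. by move=> x y Tx Ty; have [p hp _] := tree_shortest_path Tx Ty; exists p. Qed.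

(** The height extends to a 1-Lipschitz function on [X]. A limit point [x] of
    [T] is a limit of points of [T] at the extended height of [x]; these lie in
    one orbit, so they do not accumulate. *)
Lemma tree_closed : closed T.
Proof.
move=> x clx.
have near e : 0 < e -> exists2 y, T y & d x y < e.
  move=> e0; have [y [Ty]] := clx _ (nbhsx_ballx x e e0).
  by rewrite ballEmdist => hy; exists y.
pose A := [set height y + d x y | y in T].
have lb y z : T y -> T z -> height y - d x y <= height z + d x z.
  move=> Ty Tz; have := height_lipschitz W Ty Tz; rewrite ler_norml.
  by have := metric_triangle y x z; rewrite (metric_sym y x); lra.
have infA : has_inf A.
  have [y Ty _] := near 1 ltr01; split; first by exists (height y + d x y), y.
  by exists (height y - d x y) => _ [z Tz <-]; apply: lb.
pose t := inf A.
have ht y : T y -> `|t - height y| <= d x y.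
  move=> Ty; rewrite ler_norml; apply/andP; split.
    suff : height y - d x y <= t by lra.
    by apply: lb_le_inf => [|_ [z Tz <-]]; [case: infA|apply: lb].
  suff : t <= height y + d x y by lra.
  by apply: ge_inf; [case: infA|exists y].
have close y : T y -> d (up y t) x <= 2 * d x y.
  move=> Ty; have := ht y Ty; have := metric_triangle (up y t) y x.
  have := dist_up W y t (height y); rewrite up_height // => ->.
  by rewrite (metric_sym y x); lra.
pose B := [set z | (exists h, z = act h (rho t)) /\ d z x <= 2].
have [||m [z [Bz Tz] <-] hm] := finite_set_min (A := [set d z x | z in B `&` T]).
- by apply/finite_image/finite_setIl/finite_orbit_ball; exact: W.
- have [y Ty dy] := near 1 ltr01; exists (d (up y t) x), (up y t) => //.
  split; last exact: (tree_up W).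
  split; first by exists (chart act rho y).1.
  by have := close y Ty; lra.
suff : d z x = 0 by move/mdist_positivity => <-.
apply/eqP; rewrite eq_le mdist_ge0 andbT leNgt; apply/negP => z0.
have [|y Ty] := near (Num.min 1 (d z x / 2)); first by rewrite lt_min ltr01 divr_gt0.
rewrite lt_min => /andP[y1 y2]; have := close y Ty.
suff : d z x <= d (up y t) x by lra.
apply: hm; exists (up y t) => //; split; last exact: (tree_up W).
split; first by exists (chart act rho y).1.
by have := close y Ty; lra.
Qed.

Lemma tree_metrizes : metrizes_subspace T (tree_dist act rho).
Proof.
move=> x Tx A; split=> [|[e e0 he]].
  rewrite /within => /nbhs_ballP [e e0 he]; exists e => // y [Ty].
  rewrite tree_distE // => hy; apply: he => //; rewrite ballEmdist /=.
  exact: le_lt_trans (dist_le_tree_metric W Tx Ty) hy.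
have [e' e'0 he'] := tree_metric_local W Tx.
apply/nbhs_ballP; exists (Num.min e e'); first by rewrite /= lt_min e0.
move=> y; rewrite ballEmdist /= lt_min => /andP[h1 h2] Ty.
by apply: he; split => //; rewrite tree_distE // he'.
Qed.

(** A ray in [T] is a geodesic for the tree metric as well, so it climbs to the
    merging point of its ends and then descends. It cannot descend for long,
    since its height grows like that of [rho]. *)
Lemma tree_ray c : boundary_class rho c -> (forall t, 0 <= t -> T (c t)) ->
  forall t, 0 <= t -> c t = up (c 0) (height (c 0) + t).
Proof.
move=> [rc [M hM]] cT t t0; set h0 := height (c 0).
pose s : R := t + `|h0| + `|M|.
have n1 := ler_norm h0; have n2 := ler_norm M.
have n3 := normr_ge0 h0; have n4 := normr_ge0 M.
have s0 : 0 <= s by rewrite /s; lra.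
pose p (u : R) := c (s * `|u|).
have plip u v : d (p u) (p v) <= s * `|u - v|.
  rewrite /p rc ?mulr_ge0 // -mulrBr normrM (ger0_norm s0).
  by apply: ler_wpM2l => //; apply: ler_dist_dist.
have pin : path_in T (c 0) (c s) p.
  split; rewrite /p ?normr0 ?normr1 ?mulr0 ?mulr1 //.
    by apply: continuous_subspaceT => u; apply: (lipschitz_continuous plip).
  by move=> u _; apply: cT; rewrite mulr_ge0.
have [q hq tml] := tree_path_length_ge pin.
have := chord_sum_lipschitz plip hq; rewrite subr0 mulr1 => /(le_trans tml) {q hq}tml.
have T0 := cT 0 (lexx _); have Ts := cT s s0.
pose m := join_height (c 0) (c s); pose z := up (c 0) m.
have h1 : h0 <= m by apply: height_merge_l W _ _.
have h2 : height (c s) <= m by apply: height_merge_r W _ _.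
have d1 : d (c 0) z = m - h0.
  have := dist_up W (c 0) h0 m; rewrite up_height // => ->.
  by rewrite distrC ger0_norm // subr_ge0.
have d2 : d z (c s) = m - height (c s).
  have := dist_up W (c s) m (height (c s)); rewrite up_height //.
  by rewrite ger0_norm ?subr_ge0 // => <-; rewrite /z (up_merge W (lexx _)).
have ds : d (c 0) (c s) = s by apply: geodesic_ray_dist0.
have tmE : tm (c 0) (c s) = 2 * m - h0 - height (c s) by [].
have dz : d (c 0) z + d z (c s) = d (c 0) (c s).
  by have := metric_triangle (c 0) z (c s); rewrite ds d1 d2; lra.
have pc := geodesic_ray_path s0 rc.
have [geo _] := axa_npc W.
have cz := geodesic_path_through geo (axa_uniq W) pc dz; rewrite d1 in cz.
have hs : s - M <= height (c s).
  have := height_lipschitz W (tree_line W s) Ts; rewrite (height_line W) ler_norml.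
  by have := hM s s0; lra.
have tm' : t <= m - h0.
  by move: dz; rewrite ds d1 d2; rewrite /s in hs *; lra.
have m0 : 0 <= m - h0 by lra.
have pcz := geodesic_ray_path m0 rc; rewrite cz in pcz.
have pu := @isometric_geodesic_path _ _ (up (c 0)) h0 m h1 (fun s t _ _ => dist_up W _ s t).
rewrite up_height // in pu.
by apply: (geodesic_path_uniq (axa_uniq W) pcz pu); rewrite d1 t0.
Qed.

Lemma tree_leP x y : T x -> T y ->
  tree_le act rho x y <-> height x <= height y /\ up x (height y) = y.
Proof.
move=> Tx Ty; split=> [[c hc [c0 cT [t t0 ct]]]|[h1 h2]].
  rewrite (axis_union_tree W) in cT.
  have := tree_ray hc cT t0; rewrite ct c0 => ->.
  by rewrite (height_up W) lerDl.
exists (fun t => up x (height x + t)).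
  split=> [s t s0 t0|].
    by rewrite (dist_up W); congr `|_|; ring.
  have [t0 ht0] := up_eventually W x.
  apply: (@eventually_bounded_asymptotic _ _ _ _ (t0 - height x) `|height x|).
  - exact: geodesic_line_ray (axa_line W).
  - by move=> s t s0 t1; rewrite (dist_up W); congr `|_|; ring.
  - move=> t ht; rewrite ht0; last lra.
    by rewrite (axa_line W) opprD addrA addrAC subrr add0r normrN.
rewrite (axis_union_tree W); split.
- by rewrite addr0 up_height.
- by move=> t _; apply: (tree_up W).
- by exists (height y - height x); rewrite ?subr_ge0 // subrKC.
Qed.

End TreeSubspace.

(** * The stabilizer of the tree *)

Lemma uniq_map_finer (T U V : eqType) (f : T -> U) (h : T -> V) (s : seq T) :
  {in s &, forall x y, h x = h y -> f x = f y} ->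
  uniq (map f s) -> uniq (map h s).
Proof.
elim: s => //= x s IH fh /andP[fx us]; apply/andP; split.
  apply: contra fx => /mapP[y ys e]; apply/mapP; exists y => //.
  by apply: fh e; rewrite inE ?eqxx ?ys ?orbT.
by apply: IH us => y z ys zs; apply: fh; rewrite inE ?ys ?zs orbT.
Qed.

Section TreeStabilizer.
Variables (R : realType) (X : metricType R) (G : topGroupType).
Variables (act : G -> X -> X) (rho : R -> X) (g : G).
Hypothesis W : axial_action act rho g.
Local Notation d := (@mdist R X).
Local Notation shifts := (shifts act rho).
Local Notation T := (horo_tree act rho).
Local Notation Gxi := (boundary_stab act (boundary_class rho)).
Local Notation l := (tlen act g).

Lemma act_ray h c : geodesic_ray c -> geodesic_ray (act h \o c).
Proof. by move=> hc s t s0 t0; rewrite /= (act_dist W) hc. Qed.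

Lemma act_asymptotic h c c' :
  asymptotic (act h \o c) (act h \o c') <-> asymptotic c c'.
Proof.
by split=> -[M hM]; exists M => t t0; have := hM t t0; rewrite /= (act_dist W).
Qed.

Lemma boundary_stabP h : Gxi h <-> asymptotic rho (act h \o rho).
Proof.
have rr := geodesic_line_ray (axa_line W).
split=> [e|hr].
  have : boundary_act act h (boundary_class rho) (act h \o rho).
    by exists rho => //; split => //; apply: asymptotic_refl.
  by rewrite e => -[].
apply/seteqP; split=> [_ [c [rc ac] <-]|c [rc ac]].
  split; first exact: act_ray.
  by apply: asymptotic_trans hr _; apply/act_asymptotic.
have e : act h \o (act h^-1%g \o c) = c.
  by apply/funext => t /=; rewrite (actVK W).
exists (act h^-1%g \o c) => //; split; first exact: act_ray.
apply/(act_asymptotic h); rewrite e.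
exact: asymptotic_trans (asymptotic_sym hr) ac.
Qed.

Lemma shifts_boundary_stab h k : shifts h k -> Gxi h.
Proof.
move=> [t0 ht]; apply/boundary_stabP.
apply: (@eventually_bounded_asymptotic _ _ _ _ t0 `|k|).
- exact: geodesic_line_ray (axa_line W).
- exact: act_ray (geodesic_line_ray (axa_line W)).
- by move=> t /ht /= ->; rewrite (axa_line W) opprD addrA subrr add0r normrN.
Qed.

(** An element of the stabilizer maps [rho] to a ray in [T] with the same
    endpoint, so by [tree_ray] the image merges with [rho]. *)
Lemma tree_stabP h : tree_stab act rho h <-> exists k, shifts h k.
Proof.
rewrite /tree_stab (axis_union_tree W); split=> [[/boundary_stabP ha hT]|[k hk]].
  have hc : boundary_class rho (act h \o rho).
    by split => //; apply: act_ray (geodesic_line_ray (axa_line W)).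
  have cT t : 0 <= t -> T ((act h \o rho) t).
    by move=> _; rewrite -hT; exists (rho t) => //; apply: (tree_line W).
  have := tree_ray W hc cT; set x := (act h \o rho) 0 => hx.
  have [t0 h0] := up_eventually W x.
  exists (height act rho x); exists (Num.max 0 (t0 - height act rho x)) => t.
  rewrite ge_max => /andP[t1 t2].
  have := hx t t1; rewrite /= => ->; rewrite h0 1?addrC //; lra.
split; first exact: shifts_boundary_stab hk.
apply/seteqP; split=> [_ [x Tx <-]|x Tx]; first by case: (tree_shifts W hk Tx).
exists (act h^-1%g x); last by rewrite (actVK W).
by case: (tree_shifts W (shiftsV W hk) Tx).
Qed.

Lemma act_fixes_line_segment u a b t : a <= t <= b ->
  act u (rho a) = rho a -> act u (rho b) = rho b -> act u (rho t) = rho t.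
Proof.
move=> /andP[at_ tb] ha hb; have ab := le_trans at_ tb.
have := isometry_fixes_geodesic (axa_uniq W) (act_dist W u) ha hb
  (geodesic_line_path ab (axa_line W)) (t := t - a).
rewrite /= (axa_line W) distrC ger0_norm ?subr_ge0 // subrKC; apply.
by lra.
Qed.

(** The elements of the stabilizer of the boundary point that fix [rho 0] move
    the points of [rho] by a bounded amount. Hence their orbits of the points
    [g ^+ n (rho 0)] have bounded size, and so the subgroups fixing longer and
    longer initial segments of the ray cannot decrease for ever. *)
Lemma long_segment_fixes_ray : exists2 N : R, 0 <= N & forall u, Gxi u ->
  act u (rho 0) = rho 0 -> act u (rho N) = rho N ->
  forall t, 0 <= t -> act u (rho t) = rho t.
Proof.
have l0 : 0 < l := axa_pos W.
have nl (n : nat) : 0 <= n%:R * l by rewrite mulr_ge0 // ltW.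
have nml (n m : nat) : (n <= m)%N -> n%:R * l <= m%:R * l.
  by move=> nm; rewrite ler_wpM2r ?(ltW l0) // ler_nat.
have [M hM] := asymptotic_rays_close (axa_npc W).
have rr := geodesic_line_ray (axa_line W).
pose U := [set u | Gxi u /\ act u (rho 0) = rho 0].
have UM u t : U u -> 0 <= t -> d (act u (rho t)) (rho t) <= M.
  move=> [/boundary_stabP hu u0] t0.
  by apply: (hM (act u \o rho) rho _ rr u0 (asymptotic_sym hu)) => //; apply: act_ray.
have Umono u v n m : (n <= m)%N -> U u -> U v ->
    act u (rho (m%:R * l)) = act v (rho (m%:R * l)) ->
    act u (rho (n%:R * l)) = act v (rho (n%:R * l)).
  move=> nm [_ u0] [_ v0] e; apply: (@act_inj _ _ _ _ W (v^-1)%g).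
  rewrite (actK W) -(actM W); apply: (@act_fixes_line_segment _ 0 (m%:R * l)).
  - by rewrite nl nml.
  - by rewrite (actM W) u0 -[in LHS]v0 (actK W).
  - by rewrite (actM W) e (actK W).
apply: contrapT => hN.
(* [u] fixes the segment up to [n * l], but not the one up to [m * l]. *)
have step n : exists u m, [/\ U u, (n <= m)%N, act u (rho (n%:R * l)) = rho (n%:R * l)
    & act u (rho (m%:R * l)) <> rho (m%:R * l)].
  apply: contrapT => hn; apply: hN; exists (n%:R * l) => // u hu u0 un t t0.
  have [m mt] : exists m : nat, t <= m%:R * l.
    exact: multiple_above.
  pose m' := maxn n m.
  apply: (@act_fixes_line_segment _ 0 (m'%:R * l)) => //.
    by rewrite t0 (le_trans mt) // nml // leq_maxr.
  apply: contrapT => um; apply: hn; exists u, m'; split=> //.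
  exact: leq_maxl.
(* Adding such elements one by one yields arbitrarily many distinct points in
   the orbit of some [rho (n * l)]. *)
pose F n u := act u (rho (n%:R * l)).
have distinct k : exists n (s : seq G), [/\ forall u, u \in s -> U u, size s = k
    & uniq (map (F n) (1%g :: s))].
  elim: k => [|k [n [s [sU ss sn]]]]; first by exists 0%N, [::].
  have [u [m [Uu nm un um]]] := step n.
  exists m, (u :: s); split=> [v||]; rewrite ?inE /= ?ss //.
    by move=> /orP[/eqP ->|/sU].
  have U1 : U 1%g.
    by split; [apply: (shifts_boundary_stab (shifts1 W))|rewrite (act1 W)].
  have sU1 v : v \in 1%g :: s -> U v by rewrite inE => /orP[/eqP ->|/sU].
  have sm : uniq (map (F m) (1%g :: s)).
    by apply: uniq_map_finer sn => v w /sU1 Uv /sU1 Uw; apply: Umono nm Uv Uw.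
  have um' : F m u \notin map (F m) (1%g :: s).
    apply/mapP => -[v]; rewrite inE => /orP[/eqP ->|vs] e.
      by apply: um; rewrite -[RHS](act1 W).
    move: sn => /= /andP[/mapP s1 _]; apply: s1; exists v => //.
    have := Umono u v n m nm Uu (sU v vs) e; rewrite /F => <-.
    by rewrite un (act1 W).
  move: sm um'; rewrite /= !inE !negb_or => /andP[s1 -> /=] /andP[um1 ->].
  by rewrite eq_sym um1 s1.
pose B := [set z | (exists h, z = act h (rho 0)) /\ d z (rho 0) <= M].
have finB : finite_set B by apply: finite_orbit_ball W _ _ _.
have [n [s [sU ss sn]]] := distinct (size (fset_set B)).
have sn' : uniq (map (act (g ^- n)%g) (map (F n) (1%g :: s))).
  by rewrite map_inj_uniq //; apply: act_inj W _.
have : (size (map (act (g ^- n)%g) (map (F n) (1%g :: s))) <= size (fset_set B))%N.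
  apply: uniq_leq_size sn' _ => z /mapP[_ /mapP[u us ->] ->].
  have Uu : U u.
    move: us; rewrite inE => /orP[/eqP ->|/sU //].
    by split; [apply: (shifts_boundary_stab (shifts1 W))|rewrite (act1 W)].
  have e0 : rho 0 = act (g ^- n)%g (rho (n%:R * l)).
    by rewrite -[n%:R * l]add0r -(act_expg_axis W) (actK W).
  rewrite in_fset_set // inE; split.
    exists (g ^- n * u * g ^+ n)%g.
    by rewrite !(actM W) (act_expg_axis W) add0r.
  by rewrite e0 (act_dist W) UM.
by rewrite !size_map /= ss ltnn.
Qed.

(** An element of the stabilizer of the boundary point that moves the ends of a
    long initial segment of [rho] like [h] in [H] does differs from [h] by an
    element fixing the ray. *)
Lemma tree_stab_open : open_in Gxi (tree_stab act rho).
Proof.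
have [N N0 hN] := long_segment_fixes_ray.
pose Wh h := [set k | act k (rho 0) = act h (rho 0)] `&`
             [set k | act k (rho N) = act h (rho N)].
exists (\bigcup_(h in tree_stab act rho) Wh h).
  apply: bigcup_open => h _.
  by apply: openI; apply: open_transporter W _ _.
apply/seteqP; split=> [h hh|k [kG [h hh [/= k0 kN]]]].
  by split; [case: hh|exists h].
have /tree_stabP[a ha] := hh; apply/tree_stabP; exists a.
have -> : k = (h * (h^-1 * k))%g by rewrite mulgA mulgV mul1g.
rewrite -[a]addr0; apply: (shiftsM W ha); exists 0 => t t0; rewrite addr0.
apply: hN t0.
- have kh : Gxi k := kG.
  apply/boundary_stabP; apply/(act_asymptotic h).
  have -> : act h \o (act (h^-1 * k)%g \o rho) = act k \o rho.
    by apply/funext => s /=; rewrite (actM W) (actVK W).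
  apply: asymptotic_trans (asymptotic_sym _) ((boundary_stabP k).1 kh).
  by apply/boundary_stabP; case: hh.
- by rewrite (actM W) k0 (actK W).
- by rewrite (actM W) kN (actK W).
Qed.

Lemma tree_stab_subgroup : is_subgroup (tree_stab act rho).
Proof.
split=> [|h k /tree_stabP[a ha] /tree_stabP[b hb]|h /tree_stabP[a ha]].
- by apply/tree_stabP; exists 0; apply: shifts1 W.
- by apply/tree_stabP; exists (a + b); apply: (shiftsM W ha hb).
- by apply/tree_stabP; exists (- a); apply: (shiftsV W ha).
Qed.

(** An element of [H] that fixes [x] has shift 0 and so fixes the ray from [x].
    The condition on the ray is a closed one, although [H] itself is described by
    what happens at the boundary point. *)
Lemma tree_stabilizerP x u : T x -> (tree_stab act rho u /\ act u x = x) <->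
  forall s, height act rho x <= s -> act u (up act rho x s) = up act rho x s.
Proof.
move=> Tx; split=> [[/tree_stabP[k hk] ux]|h].
  by have [_] := shifts_stabilizer W hk Tx ux.
split; last by have := h _ (lexx _); rewrite up_height.
apply/tree_stabP; exists 0; have [t0 h0] := up_eventually W x.
exists (Num.max t0 (height act rho x)) => t; rewrite ge_max => /andP[h1 h2].
by rewrite addr0 -h0 // h.
Qed.

Lemma tree_stabilizer_compact x : T x ->
  compact [set u | tree_stab act rho u /\ act u x = x].
Proof.
move=> Tx; have -> : [set u | tree_stab act rho u /\ act u x = x] =
    \bigcap_(s in [set s | height act rho x <= s])
      [set u | act u (up act rho x s) = up act rho x s].
  by apply/seteqP; split=> u; have := tree_stabilizerP u Tx => -[h1 h2].
apply: (subclosed_compact _ (@compact_stabilizer _ _ _ _ W x)).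
  by apply: closed_bigI => s _; apply: closed_transporter W _ _.
by move=> u /(_ _ (lexx _)) /=; rewrite up_height.
Qed.

(** A limit [h] of elements of [H] moves [rho 0] like some [k] in [H] does, and
    [k^-1 * h] is a limit of elements of [H] that fix [rho 0]. These fix the ray
    from [rho 0]. *)
Lemma tree_stab_closed : closed (tree_stab act rho).
Proof.
move=> h hcl.
have [k [hk /= ek]] := hcl _ (nbhs_transporter W h (rho 0)).
have [s1 sM sV] := tree_stab_subgroup.
have -> : h = (k * (k^-1 * h))%g by rewrite mulgA mulgV mul1g.
have Tx := tree_line W 0; apply: (sM) => //.
suff : [set u | tree_stab act rho u /\ act u (rho 0) = rho 0] (k^-1 * h)%g by case.
rewrite (_ : [set u | _] = \bigcap_(s in [set s : R | 0 <= s])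
      [set u | act u (rho s) = rho s]); last first.
  apply/seteqP; split=> u; have [h1 h2] := tree_stabilizerP u Tx.
    move=> /h1 hu s /= s0; have := hu s; rewrite (height_line W) (up_line W) //.
    by apply.
  move=> hu; apply: h2 => s; rewrite (height_line W) => s0.
  by rewrite (up_line W) //; apply: hu.
move=> s /= s0; rewrite (actM W); apply: (@act_inj _ _ _ _ W k); rewrite (actVK W).
have hnb : nbhs h ([set m | act m (rho 0) = act h (rho 0)] `&`
    [set m | act m (rho s) = act h (rho s)]).
  by apply: filterI; apply: nbhs_transporter W _ _.
have [m [hm [/= m0 ms]]] := hcl _ hnb; rewrite -ms.
have mk0 : act (k^-1 * m)%g (rho 0) = rho 0.
  by rewrite (actM W) m0 -ek (actK W).
have hmk : tree_stab act rho (k^-1 * m)%g by apply: sM => //; apply: sV.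
have [/(_ (conj hmk mk0)) hfix _] := tree_stabilizerP (k^-1 * m)%g Tx.
have := hfix s; rewrite (height_line W) (up_line W) // => /(_ s0).
by rewrite (actM W) => /(congr1 (act k)); rewrite (actVK W).
Qed.

End TreeStabilizer.

(** * The heights of the vertices *)

Section VertexHeights.
Variables (R : realType) (X : metricType R) (G : topGroupType).
Variables (act : G -> X -> X) (rho : R -> X).

(** The heights at which some translate of [rho] joins [rho]. *)
Definition branch_height (s : R) := exists2 u, shifts act rho u 0 &
  act u (rho s) = rho s /\ forall r, r < s -> act u (rho r) <> rho r.

(** The multiples of [l] provide vertices when the tree is a line, and they make
    it evident that there is a next vertex height. *)
Definition vertex_height (l s : R) :=
  (exists z : int, s = z%:~R * l) \/ branch_height s.

Definition next_height (l s : R) : R :=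
  inf [set r | vertex_height l r /\ s < r].

End VertexHeights.

Section VertexHeightTheory.
Variables (R : realType) (X : metricType R) (G : topGroupType).
Variables (act : G -> X -> X) (rho : R -> X) (g : G).
Hypothesis W : axial_action act rho g.
Variable l : R.
Hypothesis l0 : 0 < l.
Hypothesis lP : forall k, (exists h, shifts act rho h k) <->
  exists z : int, k = z%:~R * l.
Local Notation d := (@mdist R X).
Local Notation shifts := (shifts act rho).
Local Notation T := (horo_tree act rho).
Local Notation height := (height act rho).
Local Notation up := (up act rho).
Local Notation B := (branch_height act rho).
Local Notation D := (vertex_height act rho l).
Local Notation next := (next_height act rho l).

Lemma vertex_height_int (z : int) : D (z%:~R * l).
Proof. by left; exists z. Qed.

Lemma branch_height_shifts h k s : shifts h k -> B s -> B (s + k).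
Proof.
move=> hk [u u0 [us ulow]]; have [h' h'k hs] := shifts_from W (s - 1) hk.
have u'0 : shifts (h' * u * h'^-1)%g 0.
  by have := shiftsM W (shiftsM W h'k u0) (shiftsV W h'k); rewrite addr0 addrN.
exists (h' * u * h'^-1)%g => //; split.
  by rewrite !(actM W) -hs ?gerBl ?ler01 // (actK W) us.
(* a height below [s + k] where the conjugate of [u] is known to act like [u] *)
move=> r rs e; pose w : R := Num.max r (s + k - 1).
have rw : r <= w by rewrite /w le_max lexx.
have ws : w < s + k by rewrite /w gt_max rs; lra.
have sw : s - 1 <= w - k by rewrite lerBrDr /w le_max; apply/orP; right; lra.
have := shifts_above W u'0 (t := r) (s := w); rewrite !addr0 e => /(_ erefl rw).
rewrite !(actM W) -{1}(subrK k w) -hs // (actK W) -{2}(subrK k w) -hs //.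
by move/(@act_inj _ _ _ _ W h'); apply: ulow; lra.
Qed.

Lemma vertex_height_shifts h k s : shifts h k -> D s -> D (s + k).
Proof.
move=> hk [[z ->]|Bs]; last by right; apply: branch_height_shifts hk Bs.
have [z' ->] := (lP k).1 (ex_intro _ h hk).
by left; exists (z + z'); rewrite intrD mulrDl.
Qed.

(** Distinct branch heights [s] between [a] and [b] are witnessed by distinct
    points in the orbit of [rho a], at distance at most [2 * (b - a)]. *)
Lemma finite_vertex_heights a b : finite_set (D `&` [set s | a <= s <= b]).
Proof.
have Rfin : finite_set ([set s | exists z : int, s = z%:~R * l] `&`
    [set s | a <= s <= b]).
  have := @finite_orbit_ball _ _ _ _ W (rho 0) (rho a) (b - a).
  move/(finite_preimage (f := rho)) => fin; apply: sub_finite_set (fin _).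
    move=> s [/lP[h hs] /= sab]; split.
      by have [h' _ /(_ 0 (lexx _))] := shifts_from W 0 hs; rewrite add0r; exists h'.
    by rewrite (axa_line W) ger0_norm; lra.
  by move=> s t _ _; apply: line_inj W _ _.
have Bfin : finite_set (B `&` [set s | a <= s <= b]).
  have /choice[u hu] : forall s, exists u, B s -> shifts u 0 /\
      (act u (rho s) = rho s /\ forall r, r < s -> act u (rho r) <> rho r).
    by move=> s; case: (pselect (B s)) => [[u u0 us]|nB]; [exists u|exists 1%g].
  have uinj : {in B `&` [set s | a <= s <= b] &, injective (fun s => act (u s) (rho a))}.
    move=> s t; rewrite !inE => -[Bs /= sab] [Bt /= tab] e.
    wlog st : s t Bs Bt sab tab e / s < t.
      move=> H; case: (ltrgtP s t) => // [st|ts]; first exact: H.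
      by apply/esym/H.
    have [us0 [us _]] := hu s Bs; have [ut0 [_ ut]] := hu t Bt.
    have [as_ _] := andP sab; have := shifts_eq_above W us0 ut0 e as_.
    by rewrite us => /esym /(ut s st).
  rewrite -(eq_finite_set (inj_card_eq uinj)).
  apply: sub_finite_set (@finite_orbit_ball _ _ _ _ W (rho a) (rho a) (2 * (b - a))).
  move=> _ [s [Bs /= sab] <-]; split; first by exists (u s).
  have [us0 [us _]] := hu s Bs.
  have := metric_triangle (act (u s) (rho a)) (act (u s) (rho s)) (rho a).
  by rewrite (act_dist W) us !(axa_line W) ler0_norm ?ger0_norm; lra.
have := conj Rfin Bfin; rewrite -finite_setU; apply: sub_finite_set.
by move=> s [[Zs|Bs] sab]; [left|right].
Qed.

Let above s : exists2 r, D r & s < r <= s + l.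
Proof.
exists ((Num.floor (s / l) + 1)%:~R * l); first exact: vertex_height_int.
have h1 : (Num.floor (s / l))%:~R * l <= s by rewrite -ler_pdivlMr // floor_le_tmp.
have h2 : s < (Num.floor (s / l) + 1)%:~R * l by rewrite -ltr_pdivrMr // floorD1_gt.
by rewrite h2 intrD mulrDl mul1r lerD2r.
Qed.

Lemma next_heightP s :
  [/\ D (next s), s < next s & forall r, D r -> s < r -> next s <= r].
Proof.
have [r Dr sr] := above s.
have fin : finite_set (D `&` [set t | s < t <= s + l]).
  apply: sub_finite_set (finite_vertex_heights s (s + l)) => t [Dt /= ht].
  by split => //=; lra.
have [|m [Dm /= sm] hm] := finite_set_min fin; first by exists r.
have mmin t : D t -> s < t -> m <= t.
  move=> Dt st; case: (leP t (s + l)) => tl; last by lra.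
  by apply: hm; split => //=; rewrite st.
have -> : next s = m; last by split=> //; case/andP: sm.
apply/eqP; rewrite eq_le; apply/andP; split.
  by apply: ge_inf; [exists s => t [_ /ltW]|split=> //; case/andP: sm].
by apply: lb_le_inf; [exists m; split=> //; case/andP: sm|move=> t [Dt /(mmin t Dt)]].
Qed.

Lemma next_height_gt s : s < next s. Proof. by have [] := next_heightP s. Qed.

Lemma next_height_vertex s : D (next s). Proof. by have [] := next_heightP s. Qed.

Lemma next_height_min s r : D r -> s < r -> next s <= r.
Proof. by have [_ _] := next_heightP s; apply. Qed.

Lemma next_height_shifts h k s : shifts h k -> next (s + k) = next s + k.
Proof.
move=> hk; apply/eqP; rewrite eq_le; apply/andP; split.
  apply: next_height_min; last by rewrite ltrD2r next_height_gt.
  exact: vertex_height_shifts hk (next_height_vertex s).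
rewrite -lerBrDr; apply: next_height_min; last by rewrite ltrBrDr next_height_gt.
exact: vertex_height_shifts (shiftsV W hk) (next_height_vertex _).
Qed.

Lemma next_height_inj s t r : D s -> D t -> s < r < next s -> t < r < next t ->
  s = t.
Proof.
move=> Ds Dt hs ht; case: (ltrgtP s t) => // h.
  by have := next_height_min Dt h; lra.
by have := next_height_min Ds h; lra.
Qed.

Lemma prev_height s : exists2 r, D r & r <= s < next r.
Proof.
pose A := D `&` [set t | s - l <= t <= s].
have finA : finite_set A by apply: finite_vertex_heights.
have [|_ [r [Dr /= rs] <-] hr] := finite_set_min (finite_image (fun t => s - t) finA).
  have [r Dr rl] := above (s - l); exists (s - r), r => //.
  by split => //=; lra.
exists r => //; have [-> _] : r <= s /\ true by split => //; lra.
rewrite /= ltNge; apply/negP => hn.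
have := next_height_gt r => h1.
have : s - r <= s - next r.
  by apply: hr; exists (next r) => //; split; [exact: next_height_vertex|rewrite /=; lra].
lra.
Qed.

(** Climbing from one vertex height to the next stops at [t], because there are
    finitely many of them below [t]. *)
Lemma next_height_ind (P : R -> Prop) t :
  (forall s, s <= t -> (next s <= t -> P (next s)) -> P s) ->
  forall s, s <= t -> P s.
Proof.
move=> step s st.
pose A s := D `&` [set r | s < r <= t].
have finA s' : finite_set (A s').
  apply: sub_finite_set (finite_vertex_heights s' t) => r [Dr /= hr].
  by split => //=; lra.
have [n] := ubnP #|` fset_set (A s)|; elim: n s st => // n IH s st An.
apply: step => // nt; apply: IH => //; rewrite -ltnS; apply: leq_trans An.
rewrite ltnS; apply: fproper_ltn_card; rewrite fproperE; apply/andP; split.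
  apply/fsubsetP => r; rewrite !in_fset_set // !inE => -[Dr /= hr]; split=> //=.
  by have := next_height_gt s; lra.
apply/negP => /fsubsetP/(_ (next s)); rewrite !in_fset_set // !inE /= => H.
have [|_] := H; first by split; [exact: next_height_vertex|rewrite /= next_height_gt nt].
by rewrite /= ltxx.
Qed.

(** Translates of [rho] through [x] and [y] that differ at the height [s] would
    join at a branch height between [s] and [t]. *)
Lemma no_branch_up x y s t : s <= t -> (forall r, s < r <= t -> ~ B r) ->
  up x t = up y t -> up x s = up y s.
Proof.
move=> st noB e; set m := join_height act rho (up x s) (up y s).
have em r : s <= r -> (up (up x s) r = up (up y s) r) = (up x r = up y r).
  by move=> sr; rewrite !(up_up W).
have sm : s <= m by rewrite -{1}(height_up W x s) (height_merge_l W).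
have mt : m <= t by apply: (merge_min W); rewrite ?(height_up W) // em.
have := up_merge W (lexx m); rewrite em // => exm.
have [/eqP ms|ms] := boolP (m == s); first by rewrite -ms.
case: (noB m); first by rewrite mt andbT lt_neqAle eq_sym ms.
pose u := ((chart act rho y).1^-1 * (chart act rho x).1)%g.
have u0 : shifts u 0.
  by have := shiftsM W (shiftsV W (chart_shifts W y)) (chart_shifts W x); rewrite oppr0 addr0.
have uE r : act u (rho r) = rho r <-> up x r = up y r.
  rewrite /u (actM W); split=> [e'|e'].
    by rewrite /up -[in RHS]e' (actVK W).
  by rewrite -/(up x r) e' (actK W).
exists u => //; split=> [|r rm /uE er]; first exact/uE.
pose w : R := Num.max r s.
have wm : w < m by rewrite /w gt_max rm lt_neqAle eq_sym ms.
have sw : s <= w by rewrite /w le_max lexx orbT.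
suff : m <= w by lra.
apply: (merge_min W); rewrite ?(height_up W) // em //.
by apply: (up_eq_above W er); rewrite /w le_max lexx.
Qed.

End VertexHeightTheory.

(** * The combinatorial tree *)

Section Vertices.
Variables (R : realType) (X : metricType R) (G : topGroupType).
Variables (act : G -> X -> X) (rho : R -> X) (l : R).

Definition vertices : set X :=
  [set x | horo_tree act rho x /\ vertex_height act rho l (height act rho x)].

Definition parent (x : X) : X :=
  up act rho x (next_height act rho l (height act rho x)).

Definition edges : set (set X) :=
  [set e | exists2 x, vertices x & e = [set x; parent x]].

(** An edge is an unordered pair, so its length is recovered from its lower end;
    this is unique by [edge_lower_inj]. *)
Definition edge_length (e : set X) : R :=
  xget 0 [set a | exists x, [/\ vertices x, e = [set x; parent x] &
    a = next_height act rho l (height act rho x) - height act rho x]].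

(** The lower end of the edge is a point from which [up] runs along it. *)
Definition edge_point (v w : X) (t : R) : X :=
  if height act rho v < height act rho w then up act rho v (height act rho v + t)
  else up act rho w (height act rho v - t).

End Vertices.

Section CombinatorialTree.
Variables (R : realType) (X : metricType R) (G : topGroupType).
Variables (act : G -> X -> X) (rho : R -> X) (g : G).
Hypothesis W : axial_action act rho g.
Variable l : R.
Hypothesis l0 : 0 < l.
Hypothesis lP : forall k, (exists h, shifts act rho h k) <->
  exists z : int, k = z%:~R * l.
Local Notation d := (@mdist R X).
Local Notation shifts := (shifts act rho).
Local Notation T := (horo_tree act rho).
Local Notation height := (height act rho).
Local Notation up := (up act rho).
Local Notation B := (branch_height act rho).
Local Notation D := (vertex_height act rho l).
Local Notation next := (next_height act rho l).
Local Notation V := (vertices act rho l).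
Local Notation par := (parent act rho l).
Local Notation E := (edges act rho l).
Local Notation len := (edge_length act rho l).
Local Notation adj := (edge_rel E).
Local Notation next_gt := (next_height_gt W l0 lP).
Local Notation next_vertex := (next_height_vertex W l0 lP).
Local Notation next_min := (next_height_min W l0 lP).

Lemma height_parent x : height (par x) = next (height x).
Proof. exact: height_up W x _. Qed.

Lemma height_lt_parent x : height x < height (par x).
Proof. by rewrite height_parent next_gt. Qed.

Lemma parent_neq x : x <> par x.
Proof. by move=> e; have := height_lt_parent x; rewrite -e ltxx. Qed.

Lemma parent_vertex x : V (par x).
Proof. by split; [exact: tree_up W _ _|rewrite height_parent; exact: next_vertex]. Qed.

Lemma edge_pair_inj x v w : [set v; w] = [set x; par x] ->
  (v = x /\ w = par x) \/ (v = par x /\ w = x).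
Proof.
move=> e; have := @parent_neq x => nx.
have hv : [set x; par x] v by rewrite -e; left.
have hw : [set x; par x] w by rewrite -e; right.
have hx : [set v; w] x by rewrite e; left.
have hp : [set v; w] (par x) by rewrite e; right.
case: hv => /= ev; case: hw => /= ew; [|by left|by right|].
  by case: hp => /= ep; case: nx; rewrite ep ?ev ?ew.
by case: hx => /= ex; case: nx; rewrite {1}ex ?ev ?ew.
Qed.

Lemma edge_lower_inj x y : [set x; par x] = [set y; par y] -> x = y.
Proof.
move/edge_pair_inj => -[[//]|[e1 e2]].
have := height_lt_parent x; have := height_lt_parent y.
by rewrite e2 -e1 => h1 h2; have := lt_trans h1 h2; rewrite ltxx.
Qed.

Lemma edgeP v w : E [set v; w] <-> (V v /\ w = par v) \/ (V w /\ v = par w).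
Proof.
split=> [[x Vx /edge_pair_inj[[-> ->]|[-> ->]]]|[[Vv ->]|[Vw ->]]].
- by left.
- by right.
- by exists v.
- by exists w => //; rewrite setUC.
Qed.

Lemma adjP v w : reflect ((V v /\ w = par v) \/ (V w /\ v = par w)) (adj v w).
Proof. by apply: (iffP (asboolP _)) => /edgeP. Qed.

Lemma adjC v w : adj v w = adj w v.
Proof. by rewrite /edge_rel setUC. Qed.

Lemma edge_lengthE x : V x -> len [set x; par x] = next (height x) - height x.
Proof.
move=> Vx; apply: xget_unique; first by exists x.
by move=> a [y [Vy /edge_lower_inj -> ->]].
Qed.

Lemma edge_length_gt0 e : E e -> 0 < len e.
Proof. by case=> x Vx ->; rewrite edge_lengthE // subr_gt0 next_gt. Qed.

Local Notation reach v w := (exists2 s, path adj v s & last v s = w).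

Let reach_trans v w z : reach v w -> reach w z -> reach v z.
Proof.
move=> [s ps ls] [t pt lt]; exists (s ++ t); first by rewrite cat_path ps ls pt.
by rewrite last_cat ls.
Qed.

Let reach_sym v w : reach v w -> reach w v.
Proof.
move=> [s]; elim: s v => [|a s IH] v /= => [_ ->|/andP[va ps] lw]; first by exists [::].
apply: reach_trans (IH a ps lw) _; exists [:: v] => //=.
by rewrite adjC va.
Qed.

Let reach_up t : D t -> forall s, s <= t -> forall v, V v -> height v = s ->
  reach v (up v t).
Proof.
move=> Dt; apply: (next_height_ind W l0 lP) => s st IH v Vv hv.
have [e|nst] := eqVneq s t.
  by exists [::] => //; rewrite -e -hv up_height //; case: Vv.
have snt : next s <= t by apply: next_min => //; rewrite lt_neqAle nst.
apply: (@reach_trans _ (par v)).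
  by exists [:: par v] => //=; rewrite andbT; apply/adjP; left.
have := IH snt (par v) (parent_vertex v); rewrite height_parent hv => /(_ erefl).
have -> // : up (par v) t = up v t by rewrite /parent hv (up_up W).
Qed.

(** Every vertex has a unique neighbour above it. In a cycle, both neighbours of
    a lowest vertex would be this one. *)
Lemma vertices_tree : combinatorial_tree V E.
Proof.
split.
- exists (rho 0); split; first exact: tree_line W 0.
  by rewrite (height_line W); left; exists 0; rewrite mul0r.
- move=> e [x Vx ->]; exists x, (par x); split=> //.
  + exact: parent_vertex.
  + exact: parent_neq.
- move=> v w Vv Vw.
  have [t0 hv] := up_eventually W v; have [t1 hw] := up_eventually W w.
  pose m : R := Num.max (Num.max (height v) (height w)) (Num.max t0 t1).
  have mn : m < next m := next_gt m.
  have [h1 h2 h3 h4] : [/\ height v <= next m, height w <= next m,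
      t0 <= next m & t1 <= next m].
    by split; apply: le_trans (ltW mn); rewrite /m !le_max !lexx ?orbT.
  apply: reach_trans (reach_up (next_vertex m) h1 Vv erefl) _.
  rewrite hv // -hw //.
  exact: reach_sym (reach_up (next_vertex m) h2 Vw erefl).
move=> s /andP[cs us]; rewrite ltnNge; apply/negP => s3.
have [x xs xmin] : exists2 x, x \in s & forall y, y \in s -> height x <= height y.
  have [||_ [x xs <-] hx] := @finite_set_min _ [set height x | x in [set` s]].
  - exact/finite_image/finite_seq.
  - by case: s s3 {cs us} => // x s _; exists (height x), x => //=; rewrite mem_head.
  - by exists x => // y ys; apply: hx; exists y.
have up_adj y : y \in s -> adj x y -> y = par x.
  move=> ys /adjP[[_ -> //]|[_ xy]].
  by have := xmin y ys; rewrite xy leNgt height_lt_parent.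
have [i s' es] := rot_to xs.
have mem_s y : y \in x :: s' -> y \in s by rewrite -es mem_rot.
move: cs us s3; rewrite -(rot_cycle i) -(rot_uniq i) -(size_rot i) es.
case: s' es mem_s => [|y [|z s']] // _ mem_s; rewrite [cycle _ _]/= rcons_path.
move=> /and3P[xy _ /andP[_ zx]] /= /and4P[_ yz _ _] _.
have ey : y = par x by apply: up_adj xy; apply: mem_s; rewrite !inE eqxx orbT.
have ez : last z s' = par x.
  apply: up_adj; first by apply: mem_s; rewrite 2!in_cons mem_last !orbT.
  by rewrite adjC.
by move: yz; rewrite ey -ez mem_last.
Qed.

Let next_inj v w : V v -> V w -> next (height v) = next (height w) ->
  height v = height w.
Proof.
move=> [Tv Dv] [Tw Dw] e; pose r := Num.max (height v) (height w).
have := next_gt (height v); have := next_gt (height w) => h1 h2.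
case: (ltrgtP (height v) (height w)) => // h.
  by have := next_min Dw h; lra.
by have := next_min Dv h; lra.
Qed.

(** The vertices below [v] are at one height, so they lie in one orbit, at a
    common distance from [v]. *)
Lemma vertices_locally_finite : locally_finite_graph V E.
Proof.
move=> v Vv; pose C := [set w | V w /\ v = par w].
suff finC : finite_set C.
  have := conj (finite_set1 (par v)) finC; rewrite -finite_setU.
  apply: sub_finite_set => w /adjP[[_ ->]|[Vw vw]]; first by left.
  by right.
case: (eqVneq C set0) => [-> //|/set0P [w0 [Vw0 e0]]].
have := @finite_orbit_ball _ _ _ _ W w0 v (height v - height w0).
apply: sub_finite_set => w [Vw e].
have hw : height w = height w0.
  by apply: next_inj => //; rewrite -!height_parent -e -e0.
have [Tw _] := Vw; have [Tw0 _] := Vw0.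
split.
  have [u _ <-] := tree_transitive W Tw0 Tw (esym hw).
  by exists u.
have hwv : height w < height v by rewrite e; apply: height_lt_parent.
rewrite -{1}(up_height Tw) [in X in d _ X]e /parent (dist_up W).
by rewrite -height_parent -e distrC ger0_norm ?hw // subr_ge0 -hw ltW.
Qed.

Lemma shifts_into_period t : exists h k, shifts h k /\ 0 <= t + k < l.
Proof.
have [h hz] := (lP (- ((Num.floor (t / l))%:~R * l))).2
  (ex_intro _ (- Num.floor (t / l)) (esym (etrans (congr1 ( *%R^~ l) (mulrNz _ _)) (mulNr _ _)))).
exists h, (- ((Num.floor (t / l))%:~R * l)); split=> //.
have h1 : (Num.floor (t / l))%:~R * l <= t by rewrite -ler_pdivlMr // floor_le_tmp.
have h2 : t < (Num.floor (t / l) + 1)%:~R * l by rewrite -ltr_pdivrMr // floorD1_gt.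
by move: h2; rewrite intrD mulrDl mul1r; lra.
Qed.

Lemma vertices_shifts h k x : shifts h k -> V x -> V (act h x).
Proof.
move=> hk [Tx Dx]; have [Thx e _] := tree_shifts W hk Tx.
by split=> //; rewrite e; apply: (vertex_height_shifts W lP hk).
Qed.

Lemma parent_shifts h k x : shifts h k -> T x -> par (act h x) = act h (par x).
Proof.
move=> hk Tx; have [_ e ue] := tree_shifts W hk Tx.
by rewrite /parent e (next_height_shifts W l0 lP _ hk) ue // ltW // next_gt.
Qed.

Lemma act_edge h k x : shifts h k -> T x ->
  act h @` [set x; par x] = [set act h x; par (act h x)].
Proof. by move=> hk Tx; rewrite image_setU !image_set1 (parent_shifts hk). Qed.

Lemma edge_shifts h k e : shifts h k -> E e ->
  E (act h @` e) /\ len (act h @` e) = len e.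
Proof.
move=> hk [x Vx ->]; have [Tx _] := Vx; have Vhx := vertices_shifts hk Vx.
rewrite (act_edge hk) //; split; first by exists (act h x).
have [_ e' _] := tree_shifts W hk Tx.
by rewrite !edge_lengthE // e' (next_height_shifts W l0 lP _ hk); ring.
Qed.

Lemma edge_lengths_finite : finite_set (len @` E).
Proof.
apply: (@sub_finite_set _ _ [set next s - s | s in D `&` [set s | 0 <= s <= l]]).
  move=> _ [_ [x [Tx Dx] ->] <-]; rewrite edge_lengthE //.
  have [h [k [hk hxk]]] := shifts_into_period (height x).
  exists (height x + k); last by rewrite (next_height_shifts W l0 lP _ hk); ring.
  by split; [exact: (vertex_height_shifts W lP hk)|rewrite /=; lra].
by apply/finite_image/(finite_vertex_heights W lP).
Qed.

Let sum_gaps b : D b -> forall a, a <= b -> D a ->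
  \sum_(s \in D `&` [set s | a <= s < b]) (next s - s) = b - a.
Proof.
move=> Db; apply: (next_height_ind W l0 lP) => a ab IH Da.
have [e|nab] := eqVneq a b.
  rewrite e subrr (_ : _ `&` _ = set0) ?fsbig_set0 //.
  by apply/seteqP; split => // s [_ /=]; lra.
have nb : next a <= b by apply: next_min => //; rewrite lt_neqAle nab.
have an := next_gt a.
rewrite (fsbigD1 a) /=; last by split => //=; lra.
  rewrite (_ : _ `\ a = D `&` [set s | next a <= s < b]); last first.
    apply/seteqP; split=> s.
      move=> [[Ds /= sb] /eqP sa]; split => //=.
      have -> : s < b by lra.
      by rewrite andbT next_min // lt_neqAle eq_sym sa; case/andP: sb.
    move=> [Ds /= sb]; split; first by split => //=; lra.
    by move=> e; lra.
  by rewrite IH //; [ring|exact: next_vertex].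
apply: sub_finite_set (finite_vertex_heights W lP a b) => s [Ds /= sb].
by split => //=; lra.
Qed.

(** The edges with lower end on [rho] at a height in a fundamental domain for
    the translations by [l] represent all orbits, and their lengths are the gaps
    between the vertex heights in this domain. *)
Lemma tree_orbit_length_sum :
  orbit_length_sum act (tree_stab act rho) V E len l.
Proof.
pose P := D `&` [set s | 0 <= s < l]; pose e s := [set rho s; rho (next s)].
have finP : finite_set P.
  by apply: sub_finite_set (finite_vertex_heights W lP 0 l) => s [Ds /= hs];
    split => //=; lra.
have Vrho s : D s -> V (rho s).
  by move=> Ds; split; [exact: tree_line W s|rewrite (height_line W)].
have par_rho s : par (rho s) = rho (next s).
  by rewrite /parent (height_line W) (up_line W) // ltW // next_gt.
have eE s : e s = [set rho s; par (rho s)] by rewrite par_rho.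
split.
- by move=> h v /(tree_stabP W)[k hk]; apply: vertices_shifts hk.
- by move=> h a /(tree_stabP W)[k hk]; apply: edge_shifts hk.
exists (e @` P); split.
- by move=> _ [s [Ds _] <-]; rewrite eE; exists (rho s) => //; apply: Vrho.
- exact: finite_image.
- move=> a [x [Tx Dx] ->].
  have [h [k [hk hxk]]] := shifts_into_period (height x).
  have [Thx hhx _] := tree_shifts W hk Tx.
  have [|u u0 ux] := tree_transitive W Thx (tree_line W (height x + k)).
    by rewrite (height_line W).
  have uhk := shiftsM W u0 hk; rewrite add0r in uhk.
  exists (e (height x + k)); split.
    split; first by exists (height x + k) => //; split => //; apply: (vertex_height_shifts W lP hk).
    exists (u * h)%g; first by apply/(tree_stabP W); exists k.
    by rewrite (act_edge uhk) // (actM W) ux eE.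
  move=> b [[s [Ds /= sl] <-] [h' /(tree_stabP W)[k' hk'] es]].
  rewrite (act_edge hk') // eE in es.
  have sk : s = height x + k'.
    have [_ hh' _] := tree_shifts W hk' Tx; rewrite -hh'.
    by rewrite -(edge_lower_inj es) (height_line W).
  have [z zk] := (lP k).1 (ex_intro _ h hk).
  have [z' zk'] := (lP k').1 (ex_intro _ h' hk').
  rewrite sk; suff -> : k = k' by [].
  rewrite zk zk'; congr (_%:~R * _); apply/eqP; rewrite eq_le -!ltzD1.
  rewrite sk in sl.
  by apply/andP; split; rewrite -(ltr_int R) intrD -(ltr_pM2r l0) mulrDl mul1r -zk -zk'; lra.
rewrite fsbig_image; last first.
  move=> s t /set_mem[Ds _] /set_mem[Dt _] est; rewrite !eE in est.
  exact: line_inj W _ _ (edge_lower_inj est).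
have -> : \sum_(s \in P) len (e s) = \sum_(s \in P) (next s - s).
  apply: eq_fsbigr => s /set_mem[Ds _]; rewrite eE edge_lengthE ?(height_line W) //.
  exact: Vrho.
rewrite sum_gaps ?subr0 // ?(ltW l0) //.
- by left; exists 1; rewrite mul1r.
- by left; exists 0; rewrite mul0r.
Qed.


Local Notation ept := (edge_point act rho).

Lemma edge_pointE x t : V x ->
  ept x (par x) t = up x (height x + t) /\
  ept (par x) x t = up x (next (height x) - t).
Proof.
move=> Vx; have h := height_lt_parent x.
by rewrite /edge_point h ltNge (ltW h) /= height_parent.
Qed.

(** Inside an edge, a point determines the edge: the heights of its ends are the
    vertex heights next to it, and no branching happens between them. *)
Lemma edge_interior_inj x y s t : V x -> V y ->
  height x < s < next (height x) -> height y < t < next (height y) ->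
  up x s = up y t -> x = y /\ s = t.
Proof.
move=> [Tx Dx] [Ty Dy] hs ht e.
have st : s = t by rewrite -(height_up W x s) e (height_up W).
subst t; split=> //.
have hxy := next_height_inj W l0 lP Dx Dy hs ht.
rewrite -(up_height Tx) -(up_height Ty) hxy.
apply: (no_branch_up W (t := s)) => //; first by rewrite ltW //; case/andP: ht.
move=> r /andP[r1 r2] Br; have := next_min (or_intror Br) r1; lra.
Qed.

Local Notation pl := (pl_path T E len ept).

Let pl_trans x y z a b : pl x y a -> pl y z b -> pl x z (a + b).
Proof.
elim=> [v _|v w s t v' a' Evw hs ht _ IH yz]; first by rewrite add0r.
by rewrite -addrA; apply: pl_cons => //; apply: IH.
Qed.

Let pl_edge x s t : V x -> height x <= s <= next (height x) ->
  height x <= t <= next (height x) -> pl (up x s) (up x t) `|s - t|.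
Proof.
move=> Vx hs ht.
have := @pl_cons _ _ T E len ept x (par x) (s - height x) (t - height x) (up x t) 0.
have [-> _] := edge_pointE (s - height x) Vx.
have [-> _] := edge_pointE (t - height x) Vx.
rewrite !subrKC addr0 edge_lengthE //.
have -> : s - height x - (t - height x) = s - t by ring.
apply; [by exists x|lra|lra|].
exact: pl_nil (tree_up W _ _).
Qed.

Let pl_climb t s : s <= t -> forall x, T x -> height x = s ->
  pl x (up x t) (t - s) /\ pl (up x t) x (t - s).
Proof.
move: s; apply: (next_height_ind W l0 lP) => s st IH x Tx hx.
(* the height of the lower end of the edge that leads upwards from [x] *)
have [r Dr rs] := prev_height W l0 lP s.
have er : next r = next s.
  apply/eqP; rewrite eq_le; apply/andP; split.
    by apply: next_min; [exact: next_vertex|have := next_gt s; lra].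
  by apply: next_min; [exact: next_vertex|lra].
have Vr : V (up x r) by split; [exact: tree_up W _ _|rewrite (height_up W)].
have rr : r <= s by case/andP: rs.
have upr a : s <= a -> up (up x r) a = up x a.
  by move=> sa; rewrite (up_up W) //; lra.
have ex : up (up x r) s = x by rewrite upr // -hx up_height.
case: (leP (next s) t) => nt.
  have ns := next_gt s.
  have [|h1 h2] := IH nt (up x (next s)) (tree_up W _ _); first exact: height_up W _ _.
  rewrite (up_up W) // in h1 h2.
  have e1 := @pl_edge _ s (next s) Vr; have e2 := @pl_edge _ (next s) s Vr.
  rewrite ex (height_up W) er upr ?(ltW ns) // in e1 e2.
  have -> : t - s = (next s - s) + (t - next s) by ring.
  split.
    apply: pl_trans h1; have := e1; rewrite distrC gtr0_norm ?subr_gt0 //.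
    by apply; lra.
  rewrite addrC; apply: pl_trans h2 _; have := e2; rewrite gtr0_norm ?subr_gt0 //.
  by apply; lra.
have e1 := @pl_edge _ s t Vr; have e2 := @pl_edge _ t s Vr.
rewrite ex (height_up W) er upr // in e1 e2.
split.
  by move: e1; rewrite distrC ger0_norm ?subr_ge0 //; apply; lra.
by move: e2; rewrite ger0_norm ?subr_ge0 //; apply; lra.
Qed.

Let pl_ge x y a : pl x y a -> T x /\ tree_metric act rho x y <= a.
Proof.
elim=> [v Tv|v w s t y' a' Evw hs ht _ [Ty' IH]].
  by rewrite (tree_metricxx W).
have [z [Vz [p [q [hp hq ep eq pq]]]]] : exists z, V z /\ exists p q,
    [/\ height z <= p, height z <= q, ept v w s = up z p, ept v w t = up z q &
        `|p - q| = `|s - t| ].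
  case/edgeP: Evw => -[Vx ew]; subst.
    rewrite edge_lengthE // in hs ht.
    exists v; split => //; exists (height v + s), (height v + t).
    have [-> _] := edge_pointE s Vx; have [-> _] := edge_pointE t Vx.
    by split=> //; [lra|lra|congr `|_|; ring].
  rewrite setUC edge_lengthE // in hs ht.
  exists w; split => //; exists (next (height w) - s), (next (height w) - t).
  have [_ ->] := edge_pointE s Vx; have [_ ->] := edge_pointE t Vx.
  by split=> //; [lra|lra|rewrite -normrN; congr `|_|; ring].
split; first by rewrite ep; apply: (tree_up W).
apply: le_trans (tree_metric_triangle W _ (ept v w t) _) _.
by rewrite lerD // ep eq (tree_metric_up W) // pq.
Qed.

(** A piecewise linear path through the merging point attains the tree metric,
    and no such path is shorter by the triangle inequality. *)
Lemma tree_realization : geometric_realization T (tree_dist act rho) V E len.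
Proof.
split; first exact: edge_length_gt0.
exists ept; split.
- move=> v w /edgeP[] [Vx ->].
    have h := height_lt_parent v; rewrite edge_lengthE //.
    have [e0 _] := edge_pointE 0 Vx.
    have [e1 _] := edge_pointE (next (height v) - height v) Vx.
    have [Tv _] := Vx; rewrite e0 e1 addr0 up_height // subrKC; split=> // t ht.
    have [_ ->] := edge_pointE t Vx.
    have [-> _] := edge_pointE (next (height v) - height v - t) Vx.
    by congr up; ring.
  rewrite setUC edge_lengthE //.
  have [_ e0] := edge_pointE 0 Vx.
  have [_ e1] := edge_pointE (next (height w) - height w) Vx.
  have [Tw _] := Vx; rewrite e0 e1 subr0 subKr up_height //; split=> // t ht.
  have [-> _] := edge_pointE t Vx.
  have [_ ->] := edge_pointE (next (height w) - height w - t) Vx.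
  by congr up; ring.
- move=> x; split=> [Tx|[[] //|[v [w [t [Evw _ ->]]]]]]; last first.
    by rewrite /edge_point; case: ifP => _; apply: (tree_up W).
  right; have [r Dr rx] := prev_height W l0 lP (height x).
  have Vr : V (up x r) by split; [exact: tree_up W _ _|rewrite (height_up W)].
  exists (up x r), (par (up x r)), (height x - r); split.
  + by exists (up x r).
  + by rewrite edge_lengthE // (height_up W); lra.
  + have [-> _] := edge_pointE (height x - r) Vr.
    by rewrite (height_up W) subrKC (up_up W) ?up_height //; case/andP: rx.
- have noV x s : V x -> height x < s < next (height x) -> ~ V (up x s).
    move=> [Tx Dx] /andP[s1 s2] [_]; rewrite (height_up W) => Ds.
    by have := next_min Ds s1; lra.
  move=> v w t /edgeP[] [Vx ->].
    rewrite edge_lengthE // => ht; have [-> _] := edge_pointE t Vx.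
    by apply: noV => //; lra.
  rewrite setUC edge_lengthE // => ht; have [_ ->] := edge_pointE t Vx.
  by apply: noV => //; lra.
- move=> v w s v' w' s' /edgeP[] [Vx ->] /edgeP[] [Vy ->].
  + rewrite !edge_lengthE // => hs hs'.
    have [-> _] := edge_pointE s Vx; have [-> _] := edge_pointE s' Vy.
    move/(edge_interior_inj Vx Vy) => [||-> e]; [lra|lra|].
    by left; split=> //; lra.
  + rewrite edge_lengthE // (setUC [set _]) edge_lengthE // => hs hs'.
    have [-> _] := edge_pointE s Vx; have [_ ->] := edge_pointE s' Vy.
    move/(edge_interior_inj Vx Vy) => [||e1 e]; [lra|lra|].
    by right; split; rewrite ?e1 //; rewrite e1 in e *; lra.
  + rewrite (setUC [set par w]) !edge_lengthE // => hs hs'.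
    have [_ ->] := edge_pointE s Vx; have [-> _] := edge_pointE s' Vy.
    move/(edge_interior_inj Vx Vy) => [||e1 e]; [lra|lra|].
    by right; split; rewrite ?e1 //; rewrite e1 in e *; lra.
  + rewrite (setUC [set par w]) (setUC [set par w']) !edge_lengthE // => hs hs'.
    have [_ ->] := edge_pointE s Vx; have [_ ->] := edge_pointE s' Vy.
    move/(edge_interior_inj Vx Vy) => [||e1 e]; [lra|lra|].
    by left; split; rewrite ?e1 //; rewrite e1 in e; lra.
move=> x y Tx Ty; rewrite (tree_distE W) //; apply/esym.
have hx := height_merge_l W x y; have hy := height_merge_r W x y.
have tmin : pl x y (tree_metric act rho x y).
  have -> : tree_metric act rho x y = (join_height act rho x y - height x) +
      (join_height act rho x y - height y) by rewrite /tree_metric; ring.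
  apply: pl_trans (proj1 (pl_climb hx Tx erefl)) _.
  rewrite (up_merge W (lexx _)).
  exact: (proj2 (pl_climb hy Ty erefl)).
have lb : lbound [set a | pl x y a] (tree_metric act rho x y).
  by move=> a /pl_ge[].
apply/eqP; rewrite eq_le; apply/andP; split.
  by apply: ge_inf => //; exists (tree_metric act rho x y).
by apply: lb_le_inf => //; exists (tree_metric act rho x y).
Qed.

End CombinatorialTree.

(** * Indices and coverings by cosets *)

Lemma card_eq_images (T U V : Type) (f : T -> U) (h : T -> V) (A : set T) :
  (forall a b, A a -> A b -> f a = f b <-> h a = h b) ->
  (f @` A #= h @` A)%card.
Proof.
move=> fh; case: (eqVneq A set0) => [->|/set0P[a0 Aa0]].
  by rewrite !image_set0.
have /choice[s sP] : forall u, exists a, (f @` A) u -> A a /\ f a = u.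
  move=> u; case: (pselect ((f @` A) u)) => [[a Aa <-]|nu]; first by exists a.
  by exists a0.
have -> : h @` A = (h \o s) @` (f @` A).
  apply/seteqP; split=> [_ [a Aa <-]|_ [_ [a Aa <-] <-]].
    exists (f a); first by exists a.
    have [As e] := sP (f a) (ex_intro2 _ _ a Aa erefl).
    by apply/(fh _ _ As Aa).
  by have [As _] := sP (f a) (ex_intro2 _ _ a Aa erefl); exists (s (f a)).
rewrite card_eq_sym; apply: inj_card_eq => u v /set_mem hu /set_mem hv /= e.
have [Au <-] := sP u hu; have [Av <-] := sP v hv.
exact/(fh _ _ Au Av).
Qed.

Lemma finite_image_reps (T : eqType) (U : choiceType) (f : T -> U) (A : set T) :
  finite_set (f @` A) ->
  exists s : seq T, (forall a, a \in s -> A a) /\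
    forall a, A a -> exists2 b, b \in s & f b = f a.
Proof.
case/finite_seqP => s es.
have : forall u, u \in s -> exists2 a, A a & f a = u.
  by move=> u us; have : (f @` A) u by rewrite es.
have : forall a, A a -> f a \in s.
  by move=> a Aa; have : [set` s] (f a) by rewrite -es; exists a.
clear es => h1 h2.
suff [t [tA ht]] : exists t : seq T, (forall a, a \in t -> A a) /\
    forall u, u \in s -> exists2 b, b \in t & f b = u.
  by exists t; split=> // a /h1 /ht.
clear h1; elim: s h2 => [|u s IH] h2; first by exists [::].
have [|t [tA ht]] := IH; first by move=> v vs; apply: h2; rewrite inE vs orbT.
have [a Aa fa] := h2 u (mem_head _ _); exists (a :: t); split.
  by move=> b; rewrite inE => /orP[/eqP ->|/tA].
move=> v; rewrite inE => /orP[/eqP ->|/ht [b bt fb]].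
  by exists a; rewrite ?mem_head.
by exists b; rewrite // inE bt orbT.
Qed.

(** If [b < a], then Bernoulli's inequality for [b.+1 ^ m] contradicts the bound
    at [m = c * b]. *)
Lemma exp_growth (a b c : nat) : (forall m, a ^ m <= c * b ^ m)%N -> (a <= b)%N.
Proof.
move=> h; rewrite leqNgt; apply/negP => ba.
have [b0|b0] := posnP b.
  by have := h 1%N; rewrite b0 !expn1 muln0 leqn0 => /eqP a0; rewrite a0 b0 in ba.
have bern m : (b ^ m * (b + m) <= b.+1 ^ m * b)%N.
  elim: m => [|m IH]; first by rewrite addn0.
  apply: (@leq_trans (b.+1 * (b ^ m * (b + m)))); last first.
    by rewrite expnS -mulnA leq_mul2l IH orbT.
  rewrite expnS (mulnC b) -mulnA [leqRHS]mulnCA leq_mul2l; apply/orP; right; nia.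
have h1 := bern (c * b)%N; have h2 := h (c * b)%N.
have h3 : (b.+1 ^ (c * b) <= a ^ (c * b))%N by case: (c * b)%N => // i; rewrite leq_exp2r.
have p0 : (0 < b ^ (c * b))%N by rewrite expn_gt0 b0.
nia.
Qed.

Section Index.
Variable G : topGroupType.
Implicit Types (h : G) (U K : set G).

Lemma scale_unique K h n : scale_value K h n ->
  (forall m, scale_value K h m -> (n <= m)%N) -> scale K h = n.
Proof.
move=> hn nmin; apply: xget_unique => // m [hm mmin].
by apply/eqP; rewrite eqn_leq mmin // nmin.
Qed.

Lemma has_index_cover (A B : set G) n : has_index A B n ->
  exists s : seq G, size s = n /\
    forall a, A a -> B 1%g -> exists2 f, f \in s & exists2 b, B b & a = (f * b)%g.
Proof.
rewrite /has_index card_eq_sym => /card_set_bijP[c [cA _ csurj]].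
have /choice[r rP] : forall i, exists a, (i < n)%N -> A a /\ c i = [set (a * b)%g | b in B].
  move=> i; case: (ltnP i n) => hi; last by exists 1%g.
  by have [a Aa <-] := cA i hi; exists a.
exists [seq r i | i <- iota 0 n]; split; first by rewrite size_map size_iota.
move=> a Aa B1.
have [|i hi ci] := csurj [set (a * b)%g | b in B]; first by exists a.
have [_ e] := rP i hi.
have : [set (a * b)%g | b in B] a by exists 1%g; rewrite ?mulg1.
rewrite -ci e => -[b Bb <-]; exists (r i); last by exists b.
by apply/mapP; exists i; rewrite // mem_iota add0n.
Qed.

(** Conjugating the covering of [h U h^-1] by [n] cosets of [U] with a power of
    [h], and covering the resulting conjugates of [U] in turn, multiplies the
    number of cosets by [n]. *)
Lemma conj_power_cover U h n : is_subgroup U ->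
  has_index (conj_set h U) (U `&` conj_set h U) n ->
  forall m, exists s : seq G, (size s <= n ^ m)%N /\
    forall u, U u -> exists2 f, f \in s & exists2 v, U v &
      (h ^+ m * u * h ^- m)%g = (f * v)%g.
Proof.
move=> [U1 UM UV] /has_index_cover[r [sr hr]].
have hr' u : U u -> exists2 f, f \in r & exists2 v, U v & (h * u * h^-1)%g = (f * v)%g.
  move=> Uu; have [||f fr [b [Ub _] e]] := hr (h * u * h^-1)%g.
  - by exists u.
  - by split => //; exists 1%g => //; rewrite mulg1 mulgV.
  - by exists f => //; exists b.
elim=> [|m [s [ss hs]]].
  exists [:: 1%g]; split=> // u Uu; exists 1%g; rewrite ?mem_head //.
  by exists u => //; rewrite expg0 invg1 mulg1 !mul1g.
exists [seq (h ^+ m * a * h ^- m * b)%g | a <- r, b <- s]; split.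
  by rewrite size_allpairs sr expnS leq_mul2l ss orbT.
move=> u /hr'[a ar [v /hs[b bs [w Uw e]] e']].
exists (h ^+ m * a * h ^- m * b)%g; first exact: allpairs_f.
exists w => //; rewrite -[RHS]mulgA -e.
transitivity (h ^+ m * (h * u * h^-1) * h ^- m)%g.
  by rewrite expgSr invgM !mulgA.
by rewrite e' !mulgA; congr (_ * _)%g; rewrite -!mulgA mulKg.
Qed.

End Index.

(** * The scale function of the stabilizer of the tree *)

Section TreeScale.
Variables (R : realType) (X : metricType R) (G : topGroupType).
Variables (act : G -> X -> X) (rho : R -> X) (g : G).
Hypothesis W : axial_action act rho g.
Local Notation d := (@mdist R X).
Local Notation shifts := (shifts act rho).
Local Notation T := (horo_tree act rho).
Local Notation height := (height act rho).
Local Notation up := (up act rho).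
Local Notation H := (tree_stab act rho).

Definition descendants (y : X) (a : R) : set X :=
  [set x | [/\ T x, height x = height y - a & up x (height y) = y]].

Lemma descendants_finite y a : T y -> finite_set (descendants y a).
Proof.
move=> Ty; case: (eqVneq (descendants y a) set0) => [-> //|/set0P[x0 [Tx0 h0 _]]].
apply: sub_finite_set (@finite_orbit_ball _ _ _ _ W x0 y `|a|) => x [Tx hx xy].
split.
  by have [u _ <-] := tree_transitive W Tx0 Tx (etrans h0 (esym hx)); exists u.
have := dist_up W x (height x) (height y); rewrite xy up_height // hx => ->.
by rewrite addrAC subrr add0r normrN.
Qed.

Lemma descendants_shifts h k y a : shifts h k -> T y -> 0 <= a ->
  act h @` descendants y a = descendants (act h y) a.
Proof.
have sub h' k' y' x : shifts h' k' -> T y' -> 0 <= a -> descendants y' a x ->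
    descendants (act h' y') a (act h' x).
  move=> hk Ty' a0 [Tx hx xy]; have [Thx ex ux] := tree_shifts W hk Tx.
  have [Thy ey _] := tree_shifts W hk Ty'.
  by split=> //; [rewrite ex ey hx; ring|rewrite ey ux ?xy // hx gerBl].
move=> hk Ty a0; apply/seteqP; split=> [_ [x hx <-]|x hx]; first exact: sub hk Ty a0 hx.
exists (act h^-1%g x); last by rewrite (actVK W).
have [Thy _ _] := tree_shifts W hk Ty.
by have := sub _ _ _ _ (shiftsV W hk) Thy a0 hx; rewrite (actK W).
Qed.

Lemma card_descendants_shifts h k y a : shifts h k -> T y -> 0 <= a ->
  #|` fset_set (descendants (act h y) a)| = #|` fset_set (descendants y a)|.
Proof.
move=> hk Ty a0; have [n hn] := descendants_finite a Ty.
rewrite (card_fset_set hn) -(descendants_shifts hk) //; apply: card_fset_set.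
apply: card_eq_trans hn; apply: inj_card_eq => u v _ _.
exact: act_inj W _ _ _.
Qed.

(** The stabilizer of [y] acts transitively on the descendants at a given depth,
    since an element of shift 0 that moves one to the other fixes [y]. *)
Lemma descendants_orbit y a x : T y -> 0 <= a -> descendants y a x ->
  [set act w x | w in [set w | H w /\ act w y = y]] = descendants y a.
Proof.
move=> Ty a0 [Tx hx xy]; apply/seteqP; split=> [_ [w [hw wy] <-]|z [Tz hz zy]].
  have /(tree_stabP W)[k hk] := hw.
  rewrite -{1}wy -(descendants_shifts hk) //; first by exists x.
have [u u0 uz] := tree_transitive W Tx Tz (etrans hx (esym hz)).
exists u => //; split; first by apply/(tree_stabP W); exists 0.
have [_ _ ux] := tree_shifts W u0 Tx.
have := ux (height y); rewrite addr0 xy uz zy => <- //.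
by rewrite hx gerBl.
Qed.

(** The tree below a descendant at depth [k] is a copy of the tree below [y]. *)
Lemma descendants_power h k y j : shifts h k -> 0 <= k -> T y ->
  exists s : seq X, [/\ uniq s, size s = (#|` fset_set (descendants y k)| ^ j)%N &
    forall x, x \in s -> descendants y (j%:R * k) x].
Proof.
move=> hk k0 Ty; elim: j => [|j [s [us ss hs]]].
  exists [:: y]; split=> // x; rewrite mem_seq1 => /eqP ->.
  by split; rewrite ?mul0r ?subr0 ?up_height.
have finD := descendants_finite k Ty.
have /choice[w hw] : forall x, exists w, descendants y k x ->
    shifts w (- k) /\ act w y = x.
  move=> x; case: (pselect (descendants y k x)) => [[Tx hx xy]|nx]; last by exists 1%g.
  have hV := shiftsV W hk; have [Tz ez _] := tree_shifts W hV Ty.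
  have [u u0 uz] := tree_transitive W Tz Tx (etrans ez (esym hx)).
  exists (u * h^-1)%g => _; split; last by rewrite (actM W).
  by have := shiftsM W u0 hV; rewrite add0r.
have jk0 : 0 <= j%:R * k by rewrite mulr_ge0.
have wD x z : descendants y k x -> z \in s -> descendants x (j%:R * k) (act (w x) z).
  move=> xD zs; have [wk wy] := hw x xD.
  by rewrite -wy -(descendants_shifts wk) // wy; exists z => //; apply: hs.
exists [seq act (w x) z | x <- fset_set (descendants y k), z <- s]; split.
- apply: allpairs_uniq => //; first exact: fset_uniq.
  move=> [x z] [x' z'] /allpairsP[[a b] [/= ha hb [-> ->]]].
  move=> /allpairsP[[a' b'] [/= ha' hb' [-> ->]]] /= e.
  rewrite !in_fset_set // !inE in ha ha'.
  have [_ h1 h2] := wD a b ha hb; have [_ h3 h4] := wD a' b' ha' hb'.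
  have [_ e1 _] := ha; have [_ e2 _] := ha'.
  have aa : a = a' by rewrite -h2 -h4 e e1 e2.
  by move: e; rewrite aa => /(@act_inj _ _ _ _ W _) ->.
- by rewrite size_allpairs ss expnS.
move=> _ /allpairsP[[x z] [/= xD zs ->]]; rewrite in_fset_set // inE in xD.
have [Tz h1 h2] := wD x z xD zs; have [Tx h3 h4] := xD.
split=> //; first by rewrite h1 h3 -natr1; ring.
have hxy : height x <= height y by rewrite h3 gerBl.
by rewrite -(up_up W _ hxy) h2.
Qed.

Lemma tree_level_up y t0 : T y ->
  exists w k s, [/\ shifts w k, t0 <= s & act w y = rho s].
Proof.
move=> Ty; have l0 := axa_pos W.
have [n hn] := multiple_above (t0 - height y) l0.
have gn := shiftsX W n (shifts_axis W).
have [Tz ez _] := tree_shifts W gn Ty.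
have [|u u0 uz] := tree_transitive W Tz (tree_line W (height y + n%:R * tlen act g)).
  by rewrite ez (height_line W).
exists (u * g ^+ n)%g, (0 + n%:R * tlen act g), (height y + n%:R * tlen act g).
by split; [exact: (shiftsM W u0 gn)|lra|rewrite (actM W)].
Qed.

Lemma finite_subgroup_orbit (U : set G) x : compact U ->
  finite_set [set act u x | u in U].
Proof.
move=> cU; apply: compact_locally_constant_image cU _ => h _.
by apply: filterS (nbhs_transporter W h x) => k hk _.
Qed.

(** As [h U h^-1] is covered by [n] cosets of [U], the conjugates by [h ^+ j] of
    the stabilizer of [x] have orbits of [x] of size at most [c * n ^ j]. These
    orbits consist of the descendants of [h ^+ j x] at depth [j * k], and their
    size is the [j]-th power of the number of descendants at depth [k]. *)
Lemma scale_lower_bound (K : set G) h k y n : is_subgroup K -> H `<=` K ->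
  shifts h k -> 0 <= k -> T y -> scale_value K h n ->
  (#|` fset_set (descendants y k)| <= n)%N.
Proof.
move=> [K1 KM KV] HK hk k0 Ty [U [UK sU cU [U' oU' eU] hn]].
have [U1 UM UV] := sU; have [t0 ht0] := hk.
have [w [k' [s [wk st wy]]]] := tree_level_up t0 Ty.
rewrite -(card_descendants_shifts wk) // wy.
set x := rho s; have Tx : T x := tree_line W s.
pose C := [set u | H u /\ act u x = x].
have cC : compact C := tree_stabilizer_compact W Tx.
have [L [_ hL]] : exists L : seq G, (forall a, a \in L -> C a) /\
    forall a, C a -> exists2 b, b \in L &
      [set (b * u)%g | u in U] = [set (a * u)%g | u in U].
  apply: finite_image_reps; apply: (compact_locally_constant_image cC) => v [Hv _].
  have : nbhs v ((fun a => (v^-1 * a)%g) @^-1` U').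
    have := @mulg_left_cts _ (v^-1)%g v U'; apply; apply: open_nbhs_nbhs; split=> //.
    by rewrite mulVg; have : U 1%g := U1; rewrite eU => -[].
  apply: filterS => a /= va [Ha _].
  have Uva : U (v^-1 * a)%g.
    by rewrite eU; split => //; apply: KM; [apply: KV; apply: HK|apply: HK].
  apply/seteqP; split=> _ [b Ub <-].
    by exists (v^-1 * a * b)%g; [exact: UM|rewrite !mulgA mulgV mul1g].
  exists ((v^-1 * a)^-1 * b)%g; first by apply: UM => //; apply: UV.
  by rewrite invgM invgK !mulgA mulgV mul1g.
have /finite_seqP[Q hQ] := finite_subgroup_orbit x cU.
apply: (@exp_growth _ _ (size L * size Q)) => j.
have [F [sF hF]] := conj_power_cover sU hn j.
have jk0 : 0 <= j%:R * k by rewrite mulr_ge0.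
have hj := shiftsX W j hk.
have hjx : act (h ^+ j)%g x = rho (s + j%:R * k).
  by apply: (act_expg_tail W _ k0 ht0).
have [Tj _ _] := tree_shifts W hj Tx.
have [M [uM sM hM]] := descendants_power j hk k0 Tj.
rewrite (card_descendants_shifts hj) // in sM.
have : (size M <= size [seq act (h ^+ j * p.1 * h ^- j * p.2)%g q |
    p <- [seq (e, f) | e <- L, f <- F], q <- Q])%N.
  apply: uniq_leq_size uM _ => z zM.
  have xD : descendants (act (h ^+ j)%g x) (j%:R * k) x.
    have [_ e1 _] := tree_shifts W hj Tx; split=> //; first by rewrite e1 addrK.
    by rewrite hjx (height_line W) (up_line W) // lerDl.
  have := hM z zM; rewrite -(descendants_orbit Tj jk0 xD) => -[v [Hv vx] ez].
  have [_ SM SV] := tree_stab_subgroup W.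
  have Hhj : H (h ^+ j)%g by apply/(tree_stabP W); exists (j%:R * k).
  have Cv : C (h ^- j * v * h ^+ j)%g.
    split; first by apply: (SM) => //; apply: (SM) => //; apply: (SV).
    by rewrite !(actM W) vx (actK W).
  have [e eL ev] := hL _ Cv.
  have : [set (h ^- j * v * h ^+ j * u)%g | u in U] (h ^- j * v * h ^+ j)%g.
    by exists 1%g; rewrite ?mulg1.
  rewrite -ev => -[u Uu eu]; have [f fF [u' Uu' e']] := hF u Uu.
  have xQ : act u' x \in Q by have : [set` Q] (act u' x) by rewrite -hQ; exists u'.
  apply/allpairsP; exists ((e, f), act u' x); split=> //=.
    by apply/allpairsP; exists (e, f).
  rewrite -ez -(actM W); congr act.
  rewrite -mulgA -e'; transitivity (h ^+ j * (h ^- j * v * h ^+ j) * h ^- j)%g.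
    by rewrite !mulgA mulgV mul1g mulgK.
  by rewrite -eu !mulgA; congr (_ * _ * _)%g; rewrite mulgVK.
rewrite sM !size_allpairs => /leq_trans; apply.
by rewrite mulnAC leq_mul2l sF orbT.
Qed.

Lemma has_index_orbit (A : set G) x n : is_subgroup A ->
  ([set act a x | a in A] #= `I_n)%card ->
  has_index A [set a | A a /\ act a x = x] n.
Proof.
move=> [A1 AM AV]; apply: card_eq_trans; apply: card_eq_images => a b Aa Ab.
split=> [e|e].
  have : [set (a * c)%g | c in [set a | A a /\ act a x = x]] a.
    by exists 1%g; rewrite ?mulg1 //; split => //; apply: act1 W x.
  by rewrite e => -[c [_ cx] <-]; rewrite (actM W) cx.
have sub a' b' : A a' -> A b' -> act a' x = act b' x ->
    [set (a' * c)%g | c in [set a | A a /\ act a x = x]] `<=`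
    [set (b' * c)%g | c in [set a | A a /\ act a x = x]].
  move=> Aa' Ab' e' _ [c [Ac cx] <-]; exists (b'^-1 * (a' * c))%g.
    split; first by apply: (AM); [exact: AV|exact: AM].
    by rewrite !(actM W) cx e' (actK W).
  by rewrite mulgA mulgV mul1g.
by apply/seteqP; split; apply: sub.
Qed.

Lemma conj_setE h (A B : set G) : (forall u, A u -> B (h * u * h^-1)%g) ->
  (forall u, B u -> A (h^-1 * u * h)%g) -> conj_set h A = B.
Proof.
move=> AB BA; apply/seteqP; split=> [_ [u /AB Bu <-] //|u Bu].
exists (h^-1 * u * h)%g; first exact: BA.
by rewrite !mulgA mulgV mul1g mulgK.
Qed.

Lemma act_conj_fix h u x :
  act (h * u * h^-1)%g (act h x) = act h x <-> act u x = x.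
Proof. by rewrite !(actM W) (actK W); split=> [/(@act_inj _ _ _ _ W h)|->]. Qed.

Lemma act_conj_fixV h u x :
  act (h^-1 * u * h)%g x = x <-> act u (act h x) = act h x.
Proof.
rewrite !(actM W); split=> [e|->]; last exact: actK W h x.
by rewrite -[in RHS]e (actVK W).
Qed.

Let stab x : set G := [set u | H u /\ act u x = x].

Lemma stab_subgroup x : is_subgroup (stab x).
Proof.
have [H1 HM HV] := tree_stab_subgroup W; split.
- by split => //; apply: act1 W x.
- by move=> u v [Hu ux] [Hv vx]; split; [exact: HM|rewrite (actM W) vx].
- by move=> u [Hu ux]; split; [exact: HV|rewrite -{1}ux (actK W)].
Qed.

Lemma stab_conj h x : H h -> conj_set h (stab x) = stab (act h x).
Proof.
have [H1 HM HV] := tree_stab_subgroup W => Hh.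
apply: conj_setE => u [Hu ux]; split.
- by apply: (HM); [exact: HM|exact: HV].
- exact/act_conj_fix.
- by apply: (HM) => //; apply: (HM) => //; apply: HV.
- exact/act_conj_fixV.
Qed.

Lemma stab_scale_value h x n : H h -> T x ->
  ([set act w x | w in stab (act h x)] #= `I_n)%card -> scale_value H h n.
Proof.
move=> Hh Tx hn; exists (stab x); split.
- by move=> u [].
- exact: stab_subgroup.
- exact: (tree_stabilizer_compact W Tx).
- by exists [set u | act u x = x] => //; exact: (open_transporter W x x).
rewrite (stab_conj _ Hh).
have -> : stab x `&` stab (act h x) = [set a | stab (act h x) a /\ act a x = x].
  by apply/seteqP; split=> u [[]]; rewrite /stab /=; tauto.
by apply: has_index_orbit hn; apply: stab_subgroup.
Qed.

Lemma scale_value_gt0 (K : set G) h n : scale_value K h n -> (0 < n)%N.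
Proof.
case=> U [_ [U1 _ _] _ _]; rewrite /has_index lt0n => hn; apply/eqP => n0.
move: hn; rewrite n0 II0 card_eq0 => /eqP e.
have : conj_set h U 1%g by exists 1%g; rewrite ?mulg1 ?mulgV.
move=> h1; suff : set0 [set (1 * b)%g | b in U `&` conj_set h U] by [].
by rewrite -e; exists 1%g.
Qed.

Lemma stab_mono x y : T x -> height x <= height y -> up x (height y) = y ->
  stab x `<=` stab y.
Proof.
move=> Tx hxy xy u /(tree_stabilizerP W u Tx) hu.
split; first by case: ((tree_stabilizerP W u Tx).2 hu).
by rewrite -xy hu.
Qed.

(** An element that does not move towards the boundary point conjugates the
    stabilizer of a point far out on [rho] into itself. *)
Lemma scale_tree_stab_le0 h k : shifts h k -> k <= 0 -> scale H h = 1%N.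
Proof.
move=> hk k0; have Hh : H h by apply/(tree_stabP W); exists k.
apply: scale_unique => [|m]; last exact: scale_value_gt0.
have [t0 ht0] := hk; apply: (@stab_scale_value _ (rho t0)) => //.
  exact: tree_line W t0.
rewrite (_ : [set act w _ | w in _] = [set rho t0]); first exact: card_set1.
have hx : act h (rho t0) = rho (t0 + k) by apply: ht0.
have sub : stab (act h (rho t0)) `<=` stab (rho t0).
  rewrite hx; apply: stab_mono; rewrite ?(height_line W) ?(up_line W) //.
  - exact: tree_line W _.
  - by rewrite gerDl.
  - by rewrite gerDl.
apply/seteqP; split=> [_ [w /sub[_ wx] <-]|_ ->] //.
have [H1 _ _] := tree_stab_subgroup W.
by exists 1%g; [split => //|]; exact: act1 W _.
Qed.

(** For [x] far out on [rho], the conjugate by [h] of the stabilizer of [x] is that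
    of [h x], and the index is the size of its orbit of [x]. *)
Lemma scale_tree_stab_ge0 h k y : shifts h k -> 0 <= k -> T y ->
  scale H h = #|` fset_set (descendants y k)|.
Proof.
move=> hk k0 Ty; have Hh : H h by apply/(tree_stabP W); exists k.
apply: scale_unique => [|n hn]; last first.
  exact: (scale_lower_bound (tree_stab_subgroup W) _ hk k0 Ty hn).
have [t0 ht0] := hk.
have [w [k' [s [wk st wy]]]] := tree_level_up (t0 + k) Ty.
have [n hn] := descendants_finite k (tree_line W s).
rewrite -(card_descendants_shifts wk) // wy (card_fset_set hn).
have hx : act h (rho (s - k)) = rho s by rewrite ht0 ?subrK //; lra.
apply: (@stab_scale_value _ (rho (s - k))) => //; first exact: tree_line W _.
rewrite hx (@descendants_orbit _ k) //; first exact: tree_line W s.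
by split; rewrite ?(height_line W) ?(up_line W) ?gerBl //; apply: tree_line W _.
Qed.

Lemma branchingE y k : T y -> branching act rho y k =
  if 0 < k then #|` fset_set (descendants y k)| else 1%N.
Proof.
move=> Ty; rewrite /branching; case: ifP => // k0; congr #|` fset_set _|.
rewrite (axis_union_tree W); apply/seteqP; split=> x.
  move=> [Tx /(tree_leP W Tx Ty)[hxy xy]]; rewrite (tree_distE W) // => e.
  have jE : join_height act rho x y = height y by rewrite -{1}xy (merge_up W).
  by split=> //; move: e; rewrite (tree_metricC W) /tree_metric jE; lra.
move=> [Tx hx xy]; have hxy : height x <= height y by rewrite hx gerBl ltW.
split=> //; first exact/(tree_leP W Tx Ty).
have jE : join_height act rho x y = height y by rewrite -{1}xy (merge_up W).
by rewrite (tree_distE W) // (tree_metricC W) /tree_metric jE hx; ring.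
Qed.

Lemma scale_branching h k y : shifts h k -> T y ->
  scale H h = branching act rho y k.
Proof.
move=> hk Ty; rewrite branchingE //; case: ltP => k0.
  exact: scale_tree_stab_ge0 hk (ltW k0) Ty.
exact: scale_tree_stab_le0 hk k0.
Qed.

(** * The scale function of the whole group *)

(** Elements fixing a long enough segment of [rho] above [rho s] move points
    below it like elements of [H] do: otherwise, by compactness, some element
    would fix the whole ray and not be like that. *)
Lemma long_segment_orbit s a : 0 <= a -> exists N : R, s <= N /\
  forall u, act u (rho s) = rho s -> act u (rho N) = rho N ->
    descendants (rho s) a (act u (rho (s - a))).
Proof.
move=> a0; apply: contrapT => hN.
pose Dn := descendants (rho s) a; pose x := rho (s - a).
pose F (N : R) := [set u | [/\ act u (rho s) = rho s, act u (rho N) = rho N &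
  ~ Dn (act u x)]].
have F0 N : s <= N -> F N !=set0.
  move=> sN; apply: contrapT => F0; apply: hN; exists N; split=> // u us uN.
  by apply: contrapT => un; apply: F0; exists u.
have Fmono N M : s <= N -> N <= M -> F M `<=` F N.
  move=> sN NM u [us uM un]; split=> //.
  by apply: (act_fixes_line_segment W (a := s) (b := M)) => //; rewrite sN.
pose FF := filter_from [set N | s <= N] F.
have PF : ProperFilter FF.
  apply: filter_from_proper; last exact: F0.
  apply: filter_from_filter; first by exists s => /=.
  move=> N M /= sN sM; exists (Num.max N M); first by rewrite /= le_max sN.
  move=> u hu; have h1 : N <= Num.max N M by rewrite le_max lexx.
  have h2 : M <= Num.max N M by rewrite le_max lexx orbT.
  by split; [exact: Fmono h1 _ hu|exact: Fmono h2 _ hu].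
have [|p [/= ps clp]] := @compact_stabilizer _ _ _ _ W (rho s) FF PF.
  by exists s => //= u [].
have pF N : s <= N -> act p (rho N) = rho N /\ ~ Dn (act p x).
  move=> sN; have nb : nbhs p ([set k | act k (rho N) = act p (rho N)] `&`
      [set k | act k x = act p x]).
    by apply: filterI; apply: nbhs_transporter W _ _.
  have [|k [[_ kN kn] [/= kp kx]]] := clp (F N) _ _ nb; first by exists N.
  by rewrite -kp -kx.
have Hp : H p.
  by apply/(tree_stabP W); exists 0, s => t /pF[-> _]; rewrite addr0.
have [_] := pF s (lexx _); apply.
have xD : Dn x.
  by split; rewrite ?(height_line W) ?(up_line W) ?gerBl //; apply: tree_line W _.
by rewrite /Dn -(descendants_orbit (tree_line W s) a0 xD); exists p.
Qed.

(** The fixator of [x] and [rho N] is conjugated to the fixator of [h x] and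
    [rho (N + k)]. If [N] is large, the orbit of [x] under the latter consists of
    the descendants of [h x], as for the stabilizer of [h x] in [H]. *)
Lemma scale_group h k y : shifts h k -> 0 <= k -> T y ->
  scale [set: G] h = #|` fset_set (descendants y k)|.
Proof.
move=> hk k0 Ty; apply: scale_unique => [|n hn]; last first.
  by apply: (scale_lower_bound _ _ hk k0 Ty hn).
have [t0 ht0] := hk.
have [w [k' [s [wk st wy]]]] := tree_level_up (t0 + k) Ty.
have Ts := tree_line W s.
have [n hn] := descendants_finite k Ts.
rewrite -(card_descendants_shifts wk) // wy (card_fset_set hn).
set x := rho (s - k).
have hx : act h x = rho s by rewrite ht0 ?subrK //; lra.
have [N [sN hN]] := long_segment_orbit s k0.
have hNk : act h (rho N) = rho (N + k) by apply: ht0; lra.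
have fixN z u : z <= s -> act u (rho z) = rho z -> act u (rho (N + k)) = rho (N + k) ->
    act u (rho s) = rho s /\ act u (rho N) = rho N.
  move=> zs uz uN; split; apply: (act_fixes_line_segment W (a := z) (b := N + k)) => //.
    by rewrite zs; lra.
  by apply/andP; split; lra.
pose A := [set u | act u (rho s) = rho s /\ act u (rho (N + k)) = rho (N + k)].
pose U := [set u | act u x = x /\ act u (rho N) = rho N].
have AU : conj_set h U = A.
  apply: conj_setE => u [u1 u2]; split.
  - by rewrite -hx; apply/act_conj_fix.
  - by rewrite -hNk; apply/act_conj_fix.
  - by apply/act_conj_fixV; rewrite hx.
  - by apply/act_conj_fixV; rewrite hNk.
have subA x1 x2 : is_subgroup [set u | act u x1 = x1 /\ act u x2 = x2].
  split=> [|u v [u1 u2] [v1 v2]|u [u1 u2]].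
  - by split; apply: act1 W _.
  - by split; rewrite (actM W) ?v1 ?v2.
  - by split; [rewrite -{1}u1|rewrite -{1}u2]; apply: actK W _ _.
exists U; split=> //.
- exact: subA.
- apply: (subclosed_compact _ (@compact_stabilizer _ _ _ _ W x)); last by move=> u [].
  by apply: closedI; apply: closed_transporter W _ _.
- exists U; last by rewrite setTI.
  by apply: openI; apply: open_transporter W _ _.
rewrite AU (_ : U `&` A = [set u | A u /\ act u x = x]); last first.
  apply/seteqP; split=> u; first by move=> [[? _] ?].
  move=> [[u1 u2] u3]; have [|_ uN] := fixN (s - k) u _ u3 u2; first by rewrite gerBl.
  by [].
apply: has_index_orbit; first exact: subA.
suff -> : [set act a x | a in A] = descendants (rho s) k by [].
have xD : descendants (rho s) k x.
  by split; rewrite ?(height_line W) ?(up_line W) ?gerBl //; apply: tree_line W _.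
apply/seteqP; split=> [_ [u [u1 u2] <-]|z].
  by have [_ uN] := fixN s u (lexx _) u1 u2; apply: hN.
rewrite -(descendants_orbit Ts k0 xD) => -[u [Hu us] <-]; exists u => //; split=> //.
have [/(_ (conj Hu us)) /(_ (N + k)) + _] := tree_stabilizerP W u Ts.
by rewrite (height_line W) (up_line W); [apply; lra|lra].
Qed.

End TreeScale.

(** * The action of the stabilizer on the tree *)

Section Conclusion.
Variables (R : realType) (X : metricType R) (G : topGroupType).
Variables (act : G -> X -> X) (rho : R -> X) (g : G).
Hypothesis W : axial_action act rho g.
Variable l : R.
Hypothesis l0 : 0 < l.
Hypothesis lP : forall k, (exists h, shifts act rho h k) <->
  exists z : int, k = z%:~R * l.
Local Notation d := (@mdist R X).
Local Notation shifts := (shifts act rho).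
Local Notation T := (horo_tree act rho).
Local Notation height := (height act rho).
Local Notation H := (tree_stab act rho).
Local Notation S := (attracted_set act rho).

(** The sign makes it negative on the elements that move towards the boundary
    point. *)
Definition busemann_character (h : G) : R := - xget 0 [set k | shifts h k].

Lemma busemann_characterE h k : shifts h k -> busemann_character h = - k.
Proof.
move=> hk; congr (- _); apply: xget_unique => // k' hk'.
exact: shifts_uniq W _ _ _ hk' hk.
Qed.

Lemma min_tlenE : min_tlen act rho = l.
Proof.
have [h hl] := (lP l).2 (ex_intro _ 1 (esym (mul1r l))).
have lmin : lbound [set tlen act h | h in S] l.
  move=> _ [k /(attracted_shifts W)[a a0 ka] <-]; rewrite (tlen_shifts W ka).
  have [z az] := (lP a).1 (ex_intro _ k ka); rewrite gtr0_norm // az.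
  rewrite ler_peMl ?(ltW l0) //; rewrite az pmulr_lgt0 // ltr0z in a0.
  by rewrite ler1z.
have lin : [set tlen act h | h in S] l.
  exists h; first by apply/(attracted_shifts W); exists l.
  by rewrite (tlen_shifts W hl) gtr0_norm.
apply/eqP; rewrite eq_le; apply/andP; split.
  by apply: ge_inf => //; exists l.
by apply: lb_le_inf => //; exists l.
Qed.

Lemma attracted_sub_stab : S `<=` H.
Proof. by move=> h /(attracted_shifts W)[k _ hk]; apply/(tree_stabP W); exists k. Qed.

Lemma attracted_scale h : S h -> scale H h = scale [set: G] h.
Proof.
move=> /(attracted_shifts W)[k /ltW k0 hk]; have T0 := tree_line W 0.
by rewrite (scale_tree_stab_ge0 W hk k0 T0) (scale_group W hk k0 T0).
Qed.

Lemma bounded_shifts0 h : shifts h 0 -> bounded_elt act h.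
Proof.
move=> [t0 /(_ t0 (lexx _))]; rewrite addr0 => hx x.
have hn n : act (h ^+ n)%g (rho t0) = rho t0.
  by elim: n => [|n IH]; rewrite ?(act1 W) // (act_expS W) IH.
have hV n : act (h ^- n)%g (rho t0) = rho t0 by rewrite -{1}(hn n) (actK W).
have bound k : act k (rho t0) = rho t0 -> d x (act k x) <= 2 * d x (rho t0).
  move=> kx; have := metric_triangle x (rho t0) (act k x).
  by rewrite -{2}kx (act_dist W) (metric_sym (rho t0)); lra.
by exists (2 * d x (rho t0)) => n; split; apply: bound.
Qed.

Lemma axis_inverse h A : axis act h^-1%g A -> axis act h A.
Proof.
move=> [c hc [[k k0 hk] ->]]; exists (fun t => c (- t)).
  by move=> s t; rewrite hc -normrN; congr `|_|; ring.
split; first exists k => // t.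
  apply: (@act_inj _ _ _ _ W (h^-1)%g); rewrite (actK W) hk.
  by congr c; ring.
by apply/seteqP; split=> x [t _ <-]; exists (- t); rewrite ?opprK.
Qed.

Lemma unbounded_axis h : H h -> ~ bounded_elt act h ->
  exists2 A, axis act h A & A `<=` T.
Proof.
move=> /(tree_stabP W)[k hk] hb; case: (ltrgtP k 0) => k0.
- have hV := shiftsV W hk; rewrite -oppr_gt0 in k0.
  have [A hA AL] := shifts_axis_exists W hV k0.
  by exists A; [exact: axis_inverse|exact: axis_in_tree W _ AL].
- have [A hA AL] := shifts_axis_exists W hk k0.
  by exists A => //; exact: axis_in_tree W _ AL.
by case: hb; apply: bounded_shifts0; rewrite -k0.
Qed.

Lemma tree_isometries : acts_by_isometries act H T (tree_dist act rho).
Proof.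
move=> h /(tree_stabP W)[k hk].
have hT x : T x -> T (act h x) by case/(tree_shifts W hk).
split=> // x y Tx Ty; rewrite !(tree_distE W) ?(tree_metric_shifts W hk) //; exact: hT.
Qed.

Lemma tree_acts_continuously : acts_continuously act H T (tree_dist act rho).
Proof.
move=> h x Hh Tx e e0; exists [set k | act k x = act h x].
  exact: nbhs_transporter W h x.
exists e => // k y Hk /= kx Ty xy; rewrite -kx.
by have [_ ->] := tree_isometries Hk.
Qed.

Lemma tree_acts_properly : acts_properly act H T (tree_dist act rho).
Proof.
move=> x r Tx r0.
apply: (subclosed_compact _ (@compact_displacement _ _ _ _ W x _ r0)).
  by apply: closedI; [exact: tree_stab_closed W|exact: closed_closure].
move=> h [_]; apply: closure_subset => k [Hk hd]; apply: le_trans hd.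
have [kT _] := tree_isometries Hk; rewrite (tree_distE W) //; last exact: kT.
by apply: (dist_le_tree_metric W) => //; apply: kT.
Qed.

Lemma tree_cocompact : acts_cocompactly act H T.
Proof.
exists (rho @` `[0, l]); split.
- by move=> _ [t _ <-]; apply: tree_line W t.
- apply: continuous_compact; last exact: segment_compact.
  by apply: continuous_subspaceT => t; apply: geodesic_line_continuous (axa_line W) t.
apply/seteqP; split=> [x Tx|_ [h /(tree_stabP W)[k hk] [_ [t _ <-] <-]]]; last first.
  by case: (tree_shifts W hk (tree_line W t)).
have [h [k [hk hx]]] := shifts_into_period l0 lP (height x).
have [Thx ex _] := tree_shifts W hk Tx.
have [|u u0 ux] := tree_transitive W Thx (tree_line W (height x + k)).
  by rewrite (height_line W).
exists (u * h)^-1%g.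
  by apply/(tree_stabP W); exists (- (0 + k)); apply: shiftsV W _ _ (shiftsM W u0 hk).
exists (rho (height x + k)).
  by exists (height x + k) => //; rewrite /= in_itv /=; lra.
by rewrite -ux -(actM W u h) (actK W).
Qed.

Lemma busemann_continuous : {within H, continuous busemann_character}.
Proof.
apply/subspace_continuousP => h /(tree_stabP W)[k hk] A /nbhs_singleton Ah.
have hb := busemann_characterE hk.
have [_ hh _] := tree_shifts W hk (tree_line W 0).
apply: filterS (nbhs_transporter W h (rho 0)) => m mx /(tree_stabP W)[b mb].
have [_ mh _] := tree_shifts W mb (tree_line W 0).
have kb : k = b by move: mh; rewrite mx hh => /addrI.
have e : busemann_character m = busemann_character h.
  by rewrite (busemann_characterE mb) hb kb.
by change (A (busemann_character m)); rewrite e.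
Qed.

Lemma busemann_image :
  busemann_character @` H = range (fun z : int => z%:~R * l).
Proof.
apply/seteqP; split=> [_ [h /(tree_stabP W)[k hk] <-]|_ [z _ <-]].
  have [z kz] := (lP k).1 (ex_intro _ h hk); exists (- z) => //.
  by rewrite (busemann_characterE hk) kz mulrNz mulNr.
have [h hz] := (lP (z%:~R * l)).2 (ex_intro _ z erefl).
exists (h^-1)%g; first by apply/(tree_stabP W); exists (- (z%:~R * l)); apply: shiftsV W _ _ hz.
by rewrite (busemann_characterE (shiftsV W hz)) opprK.
Qed.

End Conclusion.

Theorem theorem1p8 (R : realType) (X : metricType R) (G : topGroupType)
    (act : G -> X -> X) (rho : R -> X) (g : G) :
  npc_space X -> uniquely_geodesic X ->
  locally_compact [set: G] -> totally_disconnected [set: G] ->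
  is_action act ->
  acts_by_isometries act [set: G] [set: X] (@mdist R X) ->
  acts_properly act [set: G] [set: X] (@mdist R X) ->
  continuous (fun p : G * X => act p.1 p.2) ->
  (forall x, open [set h | act h x = x]) ->
  geodesic_line rho ->
  0 < tlen act g ->
  (forall t, act g (rho t) = rho (t + tlen act g)) ->
  let xi := boundary_class rho in
  let Gxi := boundary_stab act xi in
  let T := axis_union act rho in
  let dT := tree_dist act rho in
  let H := tree_stab act rho in
  let S := attracted_set act rho in
  let lambda := min_tlen act rho in
  0 < lambda /\
  (* (i) *)
  [/\ is_subgroup H, open_in Gxi H, S g, S `<=` H &
      forall h, S h -> scale H h = scale [set: G] h] /\
  (* (ii), first part *)
  (forall h, H h -> ~ bounded_elt act h ->
     exists2 A, axis act h A & A `<=` T) /\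
  (* (iii) *)
  [/\ closed T, path_connected_set T, metrizes_subspace T dT &
      exists (V : set X) (E : set (set X)) (len : set X -> R),
        [/\ combinatorial_tree V E, locally_finite_graph V E,
            finite_set (len @` E), geometric_realization T dT V E len &
            orbit_length_sum act H V E len lambda]] /\
  (* (iv) *)
  [/\ acts_by_isometries act H T dT, acts_continuously act H T dT,
      acts_properly act H T dT & acts_cocompactly act H T] /\
  (* (ii), second part, and (v) *)
  exists beta : G -> R,
    [/\ {within H, continuous beta},
        (forall h k, H h -> H k -> beta (h * k)%g = beta h + beta k),
        beta @` H = range (fun z : int => z%:~R * lambda),
        (forall h, H h -> `|beta h| = tlen act h /\
                          (S h <-> beta h < 0)) &
        forall h x0, H h -> T x0 ->
          scale H h = branching act rho x0 (- beta h)].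
Proof.
move=> npc ugeo _ _ hact hiso hprop _ hopen hline lpos hax xi Gxi T dT H S lambda.
have W : axial_action act rho g by split=> //; split.
have [l l0 lP] := shifts_discrete W.
have lE : lambda = l := min_tlenE W l0 lP.
have TE : T = horo_tree act rho := axis_union_tree W.
rewrite lE; split=> //; split.
  split.
  - exact: (tree_stab_subgroup W).
  - exact: (tree_stab_open W).
  - by apply/(attracted_shifts W); exists (tlen act g) => //; exact: (shifts_axis W).
  - exact: (attracted_sub_stab W).
  - by move=> h; apply: attracted_scale W h.
split.
  by move=> h Hh hb; rewrite TE; exact: unbounded_axis W h Hh hb.
split.
  rewrite TE; split.
  - exact: (tree_closed W).
  - exact: (tree_path_connected W).
  - exact: (tree_metrizes W).
  exists (vertices act rho l), (edges act rho l), (edge_length act rho l); split.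
  - exact: (vertices_tree W l0 lP).
  - exact: (vertices_locally_finite W l0 lP).
  - exact: (edge_lengths_finite W l0 lP).
  - exact: (tree_realization W l0 lP).
  - exact: (tree_orbit_length_sum W l0 lP).
split.
  rewrite TE; split.
  - exact: (tree_isometries W).
  - exact: (tree_acts_continuously W).
  - exact: (tree_acts_properly W).
  - exact: (tree_cocompact W l0 lP).
exists (busemann_character act rho); split.
- exact: (busemann_continuous W).
- move=> h k /(tree_stabP W)[a ha] /(tree_stabP W)[b hb].
  rewrite !(busemann_characterE W ha, busemann_characterE W hb).
  by rewrite (busemann_characterE W (shiftsM W ha hb)) opprD.
- exact: (busemann_image W lP).
- move=> h /(tree_stabP W)[k hk]; rewrite (busemann_characterE W hk) normrN.
  rewrite (tlen_shifts W hk) oppr_lt0; split=> //.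
  split=> [/(attracted_shifts W)[b b0 hb]|k0]; first by rewrite (shifts_uniq W hk hb).
  by apply/(attracted_shifts W); exists k.
move=> h x0 /(tree_stabP W)[k hk]; rewrite TE => Tx0.
by rewrite (busemann_characterE W hk) opprK; apply: (scale_branching W hk Tx0).
Qed.
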